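(* Let $d\ge1$ and let $X_1,X_2,\dots$ be iid with the uniform law $P_0$ on $[0,1]^d$. For every $\varepsilon>0$, $$\lim_{\delta\downarrow0}\limsup_{n\to\infty}\mathbb P^*\!\left(\sup_{j,l\in I_d:\ \rho(j,l)<\delta}|Z_n(j)-Z_n(l)|>\varepsilon\right)=0 .$$ The centered Gaussian process $G$ on $I_d$ with covariance $\mathrm{Cov}(G(j),G(l))=P_0(f_jf_l)-P_0f_j\,P_0f_l$ has a version with bounded, uniformly $\rho$-continuous sample paths. Moreover, for every corner $c$ and all $x,y\in[0,1]^d$, $$\rho((c,x),(c,y))^2\le\sum_{k=0}^{d-1}|x_k-y_k|,$$ so for each fixed corner $c$ this version is continuous in the location coordinate $x\in[0,1]^d$.
   Context: $\mathrm{Corner}(d)$ is the set of all functions $c:\{0,\dots,d-1\}\to\{\mathrm{true},\mathrm{false}\}$ (called corners) and $I_d=\mathrm{Corner}(d)\times[0,1]^d$. For a corner $c$ and $x\in[0,1]^d$: $\mathrm{cornerLe}(c,x)=\{s\in[0,1]^d:\ \text{for all }k,\ s_k\ge x_k\text{ if }c(k)=\mathrm{true},\ s_k\le x_k\text{ if }c(k)=\mathrm{false}\}$. For $j=(c,x)\in I_d$ let $f_j(y)=\mathbf 1\{y\in\mathrm{cornerLe}(c,x)\}$. $P_n=\frac1n\sum_{i=1}^n\delta_{X_i}$, $Pf=\int f\,dP$, $Z_n(j)=\sqrt n\,(P_n-P_0)f_j$, and $\rho(j,l)=\|f_j-f_l\|_{L^2(P_0)}$ is a semimetric on $I_d$.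 $\mathbb P^*$ denotes outer probability. *)

(* Defs.v *)
From HB Require Import structures.
From mathcomp Require Import all_boot all_order all_algebra.
From mathcomp Require Import all_classical all_reals all_analysis.

Set Implicit Arguments.
Unset Strict Implicit.
Unset Printing Implicit Defensive.

Import Order.TTheory GRing.Theory Num.Theory.
Import numFieldNormedType.Exports.

Local Open Scope classical_set_scope.
Local Open Scope ring_scope.

(* Points of R^d are d-tuples: n.-tuple R carries the product sigma-algebra. *)

Section uniform_law.
Context {R : realType}.

Definition unit_cube {d : nat} : set (d.-tuple R) :=
  [set x | forall k : 'I_d, 0 <= tnth x k <= 1].

Definition cons_pair (d : nat) (p : measurableTypeR R * d.-tuple R)
    : d.+1.-tuple R := [the d.+1.-tuple R of p.1 :: p.2].

Lemma measurable_cons_pair d :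
  measurable_fun [set: measurableTypeR R * d.-tuple R] (@cons_pair d).
Proof.
by apply: measurable_cons => // _ B mB; exact: (measurable_fst measurableT).
Qed.

HB.instance Definition _ (d : nat) :=
  isMeasurableFun.Build _ _ _ _ (@cons_pair d) (@measurable_cons_pair d).

(* The d-fold product of the uniform law on [0, 1]. *)
Fixpoint uniform_cube (d : nat) : probability (d.-tuple R) R :=
  match d return probability (d.-tuple R) R with
  | 0%N => \d_([tuple] : 0.-tuple R)
  | d'.+1 => distribution
      (uniform_prob (@ltr01 R) \x uniform_cube d')%E (@cons_pair d')
  end.

Lemma uniform_cube_box (d : nat) (A : 'I_d -> set R) :
  (forall k, measurable (A k)) ->
  uniform_cube d [set y | forall k, A k (tnth y k)] =
  (\prod_(k < d) uniform_prob (@ltr01 R) (A k))%E.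
Proof.
elim: d A => [A _|d IH A mA].
  rewrite big_ord0 /= diracE mem_set//.
  by case.
pose B := [set y : d.-tuple R | forall k : 'I_d, A (lift ord0 k) (tnth y k)].
have mB : measurable B.
  have -> : B = \bigcap_(k in [set: 'I_d])
      ((fun y => tnth y k) @^-1` A (lift ord0 k)).
    by apply/seteqP; split=> [y /= h k _|y h k]; [exact: h|exact: (h k)].
  apply: fin_bigcap_measurable => // k _.
  by rewrite -[X in measurable X]setTI; exact: measurable_tnth.
have -> : uniform_cube d.+1 [set y | forall k, A k (tnth y k)] =
  (uniform_prob (@ltr01 R) \x uniform_cube d)%E
    (A ord0 `*` B).
  rewrite /= /distribution /pushforward; congr (product_measure1 _ _ _).
  apply/seteqP; split=> [[a t] /= h|[a t] /= [h0 h] k].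
    split; first exact: (h ord0).
    by move=> k; have := h (lift ord0 k); rewrite tnthS.
  case: (unliftP ord0 k) => [j ->|->]; last exact: h0.
  by rewrite tnthS; exact: h.
rewrite product_measure1E//; last exact: (mA ord0).
by rewrite big_ord_recl; congr (_ * _)%E; exact: (IH (fun k => A (lift ord0 k))).
Qed.

End uniform_law.

Section corner_class.
Context {R : realType}.
Variable d : nat.

Definition corner := 'I_d -> bool.

Definition corner_index : set (corner * d.-tuple R) :=
  [set j | unit_cube j.2].

Definition cornerLe (c : corner) (x : d.-tuple R) : set (d.-tuple R) :=
  [set s | unit_cube s /\
    forall k : 'I_d, if c k then tnth x k <= tnth s k else tnth s k <= tnth x k].

Definition corner_fun (j : corner * d.-tuple R) : d.-tuple R -> R :=
  \1_(cornerLe j.1 j.2).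

Definition rho (j l : corner * d.-tuple R) : R :=
  fine (Lnorm (uniform_cube d) 2%:E (fun y => (corner_fun j y - corner_fun l y)%:E)).

Definition corner_cov (j l : corner * d.-tuple R) : R :=
  \int[uniform_cube d]_y (corner_fun j y * corner_fun l y) -
  (\int[uniform_cube d]_y corner_fun j y) *
  (\int[uniform_cube d]_y corner_fun l y).

(* X_1, X_2, ... are indexed from 0; the value at n = 0 is the zero measure. *)
Definition empirical_measure (X : nat -> d.-tuple R) (n : nat)
    : {measure set (d.-tuple R) -> \bar R} :=
  mscale (n%:R^-1)%:nng (msum (fun i => \d_(X i)) n).

Definition empirical_process (X : nat -> d.-tuple R) (n : nat)
    (j : corner * d.-tuple R) : R :=
  Num.sqrt n%:R *
  (\int[empirical_measure X n]_y corner_fun j y -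
   \int[uniform_cube d]_y corner_fun j y).

End corner_class.

Arguments corner_index {R} d.

Section processes.
Context {R : realType}.

Definition mutually_independent (dO dT : measure_display)
    (Omega : measurableType dO) (T : measurableType dT)
    (P : probability Omega R) (X : nat -> {RV P >-> T}) : Prop :=
  forall (J : seq nat) (A : nat -> set T),
    uniq J -> (forall i, measurable (A i)) ->
    P (\big[setI/setT]_(i <- J) (X i @^-1` A i)) =
    (\prod_(i <- J) P (X i @^-1` A i))%E.

Definition iid_with_law (dO dT : measure_display)
    (Omega : measurableType dO) (T : measurableType dT)
    (P : probability Omega R) (X : nat -> {RV P >-> T})
    (mu : probability T R) : Prop :=
  mutually_independent X /\
  forall (i : nat) (A : set T), measurable A -> distribution P (X i) A = mu A.

(* Normal laws, point masses included: [normal_prob m 0] is not the point mass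
   at m in the library. *)
Definition gaussian_law (mu : set R -> \bar R) : Prop :=
  exists m s : R, 0 <= s /\ forall A : set R, measurable A ->
    mu A = if s == 0 then \d_m A else normal_prob m s A.

Definition centered_gaussian_process (dO : measure_display)
    (Omega : measurableType dO) (Q : probability Omega R)
    (T : Type) (D : set T) (K : T -> T -> R) (G : T -> Omega -> R) : Prop :=
  [/\ forall t, D t -> measurable_fun [set: Omega] (G t),
      forall (m : nat) (t : 'I_m -> T) (a : 'I_m -> R), (forall i, D (t i)) ->
        gaussian_law (pushforward Q (fun w => \sum_(i < m) a i * G (t i) w)),
      forall t, D t -> 'E_Q[G t]%E = 0%E &
      forall s t, D s -> D t -> covariance Q (G s) (G t) = (K s t)%:E].

Definition version_of (dO : measure_display)
    (Omega : measurableType dO) (Q : probability Omega R)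
    (T : Type) (D : set T) (G H : T -> Omega -> R) : Prop :=
  forall t, D t -> measurable_fun [set: Omega] (H t) /\
    {ae Q, forall w, H t w = G t w}.

Definition oscillation (T : Type) (D : set T) (r : T -> T -> R) (delta : R)
    (g : T -> R) : \bar R :=
  ereal_sup [set `|g p.1 - g p.2|%:E |
    p in [set p | [/\ D p.1, D p.2 & r p.1 p.2 < delta]]].

Definition bounded_path (T : Type) (D : set T) (g : T -> R) : Prop :=
  exists M : R, forall t, D t -> `|g t| <= M.

Definition uniformly_continuous_path (T : Type) (D : set T) (r : T -> T -> R)
    (g : T -> R) : Prop :=
  forall e : R, 0 < e -> exists2 h : R, 0 < h &
    forall s t, D s -> D t -> r s t < h -> `|g s - g t| < e.

End processes.

(* Tuples carry no topology in the library; row vectors carry the usual one. *)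
Definition tuple_of_row {R : realType} (d : nat) (v : 'rV[R]_d) : d.-tuple R :=
  [tuple v ord0 k | k < d].

(* Main.v *)
(* Corner sets with corner in the grid of mesh 4^-m bracket every corner set up
   to P0-measure d 4^-m, and there are only (2 (4^m + 1))^d of them.  If the
   increments of a process over pairs of sets at P0-distance O(4^-m) have
   exponential tails at scale 2^-m, then with probability 1 - O(2^-m) all the
   increments between neighbouring grid sets of the levels m and m+1 are at most
   a constant times (3/4)^m, since exp (- c (3/2)^m) beats the number of pairs.
   For Z_n the tails hold while 4^m <= n, by a bound on the exponential moment,
   and bracketing at the last such level compares an arbitrary corner set with
   its grid approximation; this gives the asymptotic equicontinuity.  For a
   Gaussian process the tails hold at every level, so that by Borel-Cantelli the
   values at the grid approximations converge uniformly along almost every path,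
   to a version with bounded and uniformly continuous paths.

   The Gaussian process itself is the sum of the Haar series of the indicator
   f_j - P0 f_j along the binary tree of partitions generated by an enumeration
   of the grid sets; its independent standard normal coefficients are quantile
   transforms of the first coordinates of the X_i. *)

Require Import Defs.
From HB Require Import structures.
From mathcomp Require Import all_boot all_order all_algebra.
From mathcomp Require Import all_classical all_reals all_analysis.
From mathcomp Require Import measurable_realfun ring lra zify.

Set Implicit Arguments.
Unset Strict Implicit.
Unset Printing Implicit Defensive.

Import Order.TTheory GRing.Theory Num.Theory.
Import numFieldNormedType.Exports.

Local Open Scope classical_set_scope.
Local Open Scope ring_scope.

(** * Normal laws *)

(** The oscillation of [Z_n] is a supremum over an uncountable index set and need not be measurable.
    What is estimated is a finite union of measurable events about grid nodes that contains it, and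
    this also bounds the outer probability.

    The mesh shrinks by 4 so that the standard deviation of an increment, a square root of a
    P0-distance, shrinks by 2. The admissible increments shrink by 3/4: a ratio between 1/2 and 1
    makes them summable and still lets them outgrow the standard deviations. The exponential moments
    of [Z_n] at scale 2^-m need n 4^-m bounded below; at the last such level the error sqrt n 4^-m
    left by bracketing is already of order 1 / sqrt n.

    A Gaussian process is given by normality of its combinations, with unnamed parameters, and by
    its mean and covariance as integrals; the moment computations for normal laws connect the two.

    No extension theorem is needed for existence: cut at depth n, the Haar series has as covariance
    that of the conditional expectations given a finite partition, which is exact on sets that the
    partition resolves and nearly exact on sets close to them. *)

Section normal_law.
Context {R : realType}.
Implicit Types m s t : R.
Local Notation mu := (@lebesgue_measure R).

(** The Radon-Nikodym derivative and the density have the same integral over every measurable set,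
    hence agree almost everywhere. *)
Lemma ge0_integral_normal_probe m s (f : measurableTypeR R -> \bar R) :
  measurable_fun [set: measurableTypeR R] f -> (forall x, 0 <= f x)%E ->
  (\int[normal_prob m s]_x f x = \int[mu]_x (f x * (normal_pdf m s x)%:E))%E.
Proof.
move=> mf f0.
pose nu : {finite_measure set (measurableTypeR R) -> \bar R} := normal_prob m s.
have numu : nu `<< mu by exact: normal_prob_dominates.
have mpdf0 : measurable_fun [set: R] (EFin \o normal_pdf m s).
  by apply/measurable_EFinP; exact: measurable_normal_pdf.
have mpdf : measurable_fun [set: measurableTypeR R] (EFin \o normal_pdf m s) := mpdf0.
rewrite -(Radon_Nikodym_SigmaFinite.change_of_variables numu f0 measurableT mf).
apply: ae_eq_integral => //.
- apply: emeasurable_funM => //; apply: (measurable_int mu).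
  exact: Radon_Nikodym_SigmaFinite.f_integrable.
- exact: emeasurable_funM.
- apply: ae_eqe_mul2l; apply: integral_ae_eq => //.
    exact: Radon_Nikodym_SigmaFinite.f_integrable.
  by move=> E _ mE; rewrite -Radon_Nikodym_SigmaFinite.f_integral.
Qed.

Lemma ge0_integral_normal_prob m s (g : R -> R) :
  measurable_fun [set: R] g -> (forall x, 0 <= g x) ->
  (\int[normal_prob m s]_x (g x)%:E = \int[mu]_x (g x * normal_pdf m s x)%:E)%E.
Proof.
move=> mg g0.
have mf0 : measurable_fun [set: R] (EFin \o g) by apply/measurable_EFinP.
have mf : measurable_fun [set: measurableTypeR R] (EFin \o g) := mf0.
rewrite (ge0_integral_normal_probe m s mf) => [|x]; last by rewrite lee_fin.
by apply: eq_integral => x _; rewrite EFinM.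
Qed.

Lemma measurable_EFin_normal_pdf m s :
  measurable_fun [set: R] (fun x => (normal_pdf m s x)%:E).
Proof. by apply/measurable_EFinP; exact: measurable_normal_pdf. Qed.

Lemma normal_pdf_neq0 m s x : s != 0 ->
  normal_pdf m s x = normal_peak s * normal_fun m s x.
Proof. by move=> s0; rewrite normal_pdfE. Qed.

(** Exponential tilting: completing the square moves the mean and keeps the variance. *)
Lemma expR_normal_pdf m s t x : s != 0 ->
  expR (t * x) * normal_pdf m s x =
  expR (t * m + t ^+ 2 * s ^+ 2 / 2) * normal_pdf (m + t * s ^+ 2) s x.
Proof.
move=> s0; rewrite !normal_pdf_neq0// /normal_fun mulrCA [RHS]mulrCA.
rewrite -!expRD; congr (_ * expR _); rewrite -mulr_natr; field.
by rewrite s0.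
Qed.

Lemma normal_prob_mgf m s t : s != 0 ->
  (\int[normal_prob m s]_x (expR (t * x))%:E =
   (expR (t * m + t ^+ 2 * s ^+ 2 / 2))%:E)%E.
Proof.
move=> s0.
rewrite (@ge0_integral_normal_prob _ _ (fun x => expR (t * x)))//; last first.
  by apply: measurableT_comp => //; exact: measurable_funM.
under eq_integral => x _ do rewrite expR_normal_pdf// EFinM.
rewrite ge0_integralZl//; last 2 first.
  - exact: measurable_EFin_normal_pdf.
  - by move=> x _; rewrite lee_fin normal_pdf_ge0.
by rewrite integral_normal_pdf mule1.
Qed.

Lemma normal_peak_div s r : 0 < r -> normal_peak (s / r) = r * normal_peak s.
Proof.
move=> r0; rewrite /normal_peak; move: pi => p.
have -> : (s / r) ^+ 2 * p *+ 2 = r^-1 ^+ 2 * (s ^+ 2 * p *+ 2) by rewrite !mulr2n; ring.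
by rewrite sqrtrM ?sqr_ge0// sqrtr_sqr invfM ger0_norm ?invr_ge0 ?(ltW r0)// invrK.
Qed.

(** Tilting by a quadratic exponential keeps the mean and rescales the standard deviation; the
    prefactor is the ratio of the two peaks. *)
Lemma expR_sqr_normal_pdf m s t u x : s != 0 -> 0 < u ->
  1 - 2 * t * s ^+ 2 = u ^+ 2 ->
  expR (t * (x - m) ^+ 2) * normal_pdf m s x = u^-1 * normal_pdf m (s / u) x.
Proof.
move=> s0 u0 uE; have un0 : u != 0 by rewrite gt_eqF.
have su0 : s / u != 0 by rewrite mulf_neq0// invr_eq0.
rewrite !normal_pdf_neq0// mulrCA normal_peak_div// -[u * _ * _]mulrA mulKf//.
rewrite /normal_fun -expRD; congr (_ * expR _).
rewrite expr_div_n !mulr2n.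
have -> : t = (1 - u ^+ 2) / (2 * s ^+ 2) by rewrite -uE; field.
field.
by rewrite s0 un0 -mulr2n mulrn_eq0 expf_eq0/= s0.
Qed.

Lemma normal_prob_expR_sqr m s t : s != 0 -> 0 < 1 - 2 * t * s ^+ 2 ->
  (\int[normal_prob m s]_x (expR (t * (x - m) ^+ 2))%:E =
   ((Num.sqrt (1 - 2 * t * s ^+ 2))^-1)%:E)%E.
Proof.
move=> s0 u0; have su0 := sqr_sqrtr (ltW u0).
rewrite (@ge0_integral_normal_prob _ _ (fun x => expR (t * (x - m) ^+ 2)))//;
  last first.
  apply: measurableT_comp => //; apply: measurable_funM => //.
  by apply: measurable_funX; exact: measurable_funB.
under eq_integral => x _ do
  rewrite (@expR_sqr_normal_pdf _ _ _ (Num.sqrt (1 - 2 * t * s ^+ 2)))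
    ?sqrtr_gt0// EFinM.
rewrite ge0_integralZl//; last 2 first.
  - exact: measurable_EFin_normal_pdf.
  - by move=> x _; rewrite lee_fin normal_pdf_ge0.
by rewrite integral_normal_pdf ?mule1// mulf_neq0// invr_eq0 gt_eqF// sqrtr_gt0.
Qed.

End normal_law.

(** A first-order comparison at 0. It replaces differentiation of a transform under the integral
    sign. *)
Lemma nonpos_of_quadratic_bound {R : realFieldType} (x a c : R) : 0 < a ->
  (forall t, 0 < t < a -> t * x <= t ^+ 2 * c) -> x <= 0.
Proof.
move=> a0 h; rewrite leNgt; apply/negP => x0.
(* The second bound keeps [t * c] below half of [x]. *)
pose t := Num.min (a / 2) (x / (2 * (`|c| + 1))).
have c0 : 0 < `|c| + 1 by rewrite ltr_wpDl.
have t0 : 0 < t by rewrite lt_min divr_gt0//= divr_gt0// mulr_gt0.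
have ta : t < a by rewrite gt_min ltr_pdivrMr// ltr_pMr// ltr1n.
have := h t; rewrite t0 ta => /(_ isT).
rewrite expr2 -mulrA ler_pM2l// leNgt => /negP; apply.
have tx : t * (2 * (`|c| + 1)) <= x.
  by rewrite -ler_pdivlMr ?mulr_gt0// ge_min lexx orbT.
have ct : t * c <= t * `|c| by rewrite ler_wpM2l ?(ltW t0)// ler_norm.
nra.
Qed.

Lemma expR_le_inv {R : realType} (x : R) : x < 1 -> expR x <= (1 - x)^-1.
Proof.
move=> x1; rewrite -[x in expR x]opprK expRN lef_pV2 ?posrE ?expR_gt0 ?subr_gt0//.
exact: expR_ge1Dx.
Qed.

(** Follows from [expR_le_inv], since (1 - x)(1 + x + 2 x^2) = 1 + x^2 (1 - 2 x) is at least 1 for x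
    <= 1/2. *)
Lemma expR_le1DxD2sqr {R : realType} (x : R) : `|x| <= 2^-1 ->
  expR x <= 1 + x + 2 * x ^+ 2.
Proof.
rewrite ler_norml => /andP[xl xr].
have x1 : x < 1 by rewrite (le_lt_trans xr)// invf_lt1// ltr1n.
apply: (le_trans (expR_le_inv x1)).
rewrite invf_ple ?posrE ?subr_gt0//; last by nra.
rewrite -[leLHS]mul1r ler_pdivrMr; last by nra.
nra.
Qed.

(** Lets a finite moment generating function give a finite second moment. *)
Lemma sqr_le_expR {R : realType} (x : R) : x ^+ 2 <= 2 * (expR x + expR (- x)).
Proof.
wlog x0 : x / 0 <= x.
  move=> h; have [/h//|/ltW x0] := leP 0 x.
  by have := h (- x); rewrite oppr_ge0 sqrrN opprK addrC; exact.
have := expR_ge1Dxn 1 x0; have := expR_ge0 (- x).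
by rewrite (_ : (2`!)%:R = 2)//; lra.
Qed.

Section normal_random_variable.
Context d (Omega : measurableType d) (R : realType) (Q : probability Omega R).
Implicit Types (X : Omega -> R) (m s t : R).

(* [s = 0] is the point mass at [m], unlike for [normal_prob m 0] *)
Definition normal_rv X m s :=
  [/\ measurable_fun [set: Omega] X, 0 <= s &
    forall A : set R, measurable A ->
      Q (X @^-1` A) = if s == 0 then \d_m A else normal_prob m s A].

Lemma ge0_integral_normal_rv X m s (g : R -> R) : normal_rv X m s ->
  measurable_fun [set: R] g -> (forall x, 0 <= g x) ->
  (\int[Q]_w (g (X w))%:E =
   if s == 0%R then (g m)%:E else \int[normal_prob m s]_x (g x)%:E)%E.
Proof.
move=> [mX s0 QX] mg g0.
have mX' : measurable_fun [set: Omega] (X : Omega -> measurableTypeR R) := mX.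
pose Y : {mfun Omega >-> measurableTypeR R} :=
  @mfun_Sub _ _ Omega (measurableTypeR R) X (mem_set mX').
have mg' : measurable_fun [set: R] (EFin \o g) by apply/measurable_EFinP.
have mf : measurable_fun [set: measurableTypeR R] (EFin \o g) := mg'.
transitivity (\int[distribution Q Y]_x (g x)%:E)%E.
  by rewrite ge0_integral_distribution//= => x; rewrite lee_fin.
case: ifPn => s00.
  rewrite (@eq_measure_integral _ _ _ _ (\d_ (m : measurableTypeR R)))/=; last first.
    by move=> A mA _; have := QX _ mA; rewrite s00.
  by rewrite integral_dirac// diracT mul1e.
apply: eq_measure_integral => A mA _.
by have := QX _ mA; rewrite (negbTE s00).
Qed.

Lemma normal_rv_mgf X m s t : normal_rv X m s ->
  (\int[Q]_w (expR (t * X w))%:E =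
   (expR (t * m + t ^+ 2 * s ^+ 2 / 2))%:E)%E.
Proof.
move=> nX; rewrite (ge0_integral_normal_rv (g := fun x => expR (t * x)) nX)//.
  case: ifPn => [/eqP->|s0]; last exact: normal_prob_mgf.
  by rewrite expr0n/= mulr0 mul0r addr0.
by apply: measurableT_comp => //; exact: measurable_funM.
Qed.

(** Parametrised by the square root [u], it covers [s = 0] as well, where the equation forces
    [u = 1]. *)
Lemma normal_rv_expR_sqr X m s t u : normal_rv X m s -> 0 < u ->
  1 - 2 * t * s ^+ 2 = u ^+ 2 ->
  (\int[Q]_w (expR (t * (X w - m) ^+ 2))%:E = (u^-1)%:E)%E.
Proof.
move=> nX u0 uE.
rewrite (ge0_integral_normal_rv (g := fun x => expR (t * (x - m) ^+ 2)) nX)//.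
  case: ifPn => [/eqP s0|s0].
    rewrite subrr expr0n/= mulr0 expR0.
    move: uE; rewrite s0 expr0n/= mulr0 subr0 => /esym/eqP.
    by rewrite sqrf_eq1 => /orP[] /eqP uE;
      [rewrite uE invr1|move: u0; rewrite uE ltrNr oppr0 ltr10].
  rewrite normal_prob_expR_sqr// uE ?exprn_gt0// sqrtr_sqr.
  by rewrite ger0_norm ?ltW.
apply: measurableT_comp => //; apply: measurable_funM => //.
by apply: measurable_funX; exact: measurable_funB.
Qed.

Lemma Lfun2P X : measurable_fun [set: Omega] X ->
  (\int[Q]_w (X w ^+ 2)%:E < +oo)%E -> X \in Lfun Q 2%:E.
Proof.
move=> mX X2; rewrite inE; apply/andP; split; rewrite inE//=.
rewrite /finite_norm unlock poweR_lty//.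
rewrite (eq_integral (fun w => (X w ^+ 2)%:E))//= => w _.
by rewrite powR_mulrn// real_normK ?num_real.
Qed.

Lemma normal_rv_Lfun2 X m s : normal_rv X m s -> X \in Lfun Q 2%:E.
Proof.
move=> nX; have [mX _ _] := nX.
have mexp t : measurable_fun [set: Omega] (fun w => expR (t * X w)).
  by apply: measurableT_comp => //; exact: measurable_funM.
apply: Lfun2P => //.
apply: (@le_lt_trans _ _
  (\int[Q]_w (2%:E * ((expR (1 * X w))%:E + (expR (-1 * X w))%:E)))%E).
  apply: ge0_le_integral => //.
  - by move=> w _; rewrite lee_fin sqr_ge0.
  - by apply/measurable_EFinP; exact: measurable_funX.
  - apply/measurable_EFinP.
    by apply: measurable_funM => //; exact: measurable_funD.
  - by move=> w _; rewrite -EFinD -EFinM lee_fin mul1r mulN1r sqr_le_expR.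
rewrite ge0_integralZl//; last 2 first.
- by apply/measurable_EFinP; exact: measurable_funD.
- by move=> w _; rewrite -EFinD lee_fin addr_ge0 ?expR_ge0.
rewrite ge0_integralD//; [|exact/measurable_EFinP|exact/measurable_EFinP].
by rewrite !(normal_rv_mgf _ nX) -EFinD -EFinM ltry.
Qed.

Lemma normal_rv_Lfun1 X m s : normal_rv X m s -> X \in Lfun Q 1.
Proof.
by move=> nX; apply: Lfun_subset12 (normal_rv_Lfun2 nX); rewrite fin_num_measure.
Qed.

Lemma integrable_expR_normal_rv X m s t : normal_rv X m s ->
  Q.-integrable [set: Omega] (fun w => (expR (t * X w))%:E).
Proof.
move=> nX; have [mX _ _] := nX; apply/integrableP; split.
  apply/measurable_EFinP; apply: measurableT_comp => //.
  exact: measurable_funM.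
under eq_integral do rewrite gee0_abs ?lee_fin ?expR_ge0//.
by rewrite (normal_rv_mgf _ nX) ltry.
Qed.

(** The tangent inequality for the exponential gives [1 + t * e <= expR (t * m + t ^+ 2 * s ^+ 2 /
    2)] for the mean [e]; small [t] of both signs then force [e = m]. *)
Lemma normal_rv_mean X m s : normal_rv X m s -> ('E_Q[X] = m%:E)%E.
Proof.
move=> nX; have X1 := normal_rv_Lfun1 nX.
have fE := expectation_fin_num X1.
have iX : Q.-integrable [set: Omega] (EFin \o X) by exact/Lfun1_integrable.
rewrite -(fineK fE); congr (_%:E); set e := fine _.
have key t : 1 + t * e <= expR (t * m + t ^+ 2 * s ^+ 2 / 2).
  rewrite -lee_fin -(normal_rv_mgf _ nX).
  have -> : ((1 + t * e)%:E = \int[Q]_w (1 + t * X w)%:E)%E.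
    under eq_integral do rewrite EFinD EFinM.
    rewrite integralD//=; [|exact: finite_measure_integrable_cst|exact: integrableZl].
    rewrite integral_cst//= integralZl//= probability_setT mul1e.
    by rewrite EFinD EFinM fineK// unlock.
  apply: le_integral => //.
  - under eq_fun do rewrite EFinD EFinM.
    apply: integrableD => //; [exact: finite_measure_integrable_cst|].
    exact: integrableZl.
  - exact: integrable_expR_normal_rv nX.
  - by move=> w _; rewrite lee_fin expR_ge1Dx.
(* For [|t| < a] the exponent [y] below stays in the range of [expR_le1DxD2sqr]. *)
pose a := (2 * (`|m| + s ^+ 2 + 1))^-1.
have a0 : 0 < a by rewrite invr_gt0 mulr_gt0// ltr_wpDl// addr_ge0// sqr_ge0.
pose c := s ^+ 2 / 2 + 2 * (`|m| + s ^+ 2 / 2) ^+ 2.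
have {}key t : `|t| < a -> t * (e - m) <= t ^+ 2 * c.
  move=> ta; pose y := t * m + t ^+ 2 * s ^+ 2 / 2.
  have t1 : `|t| <= 1.
    rewrite (le_trans (ltW ta))// invf_le1 ?mulr_gt0//.
      by have := normr_ge0 m; have := sqr_ge0 s; lra.
    by rewrite ltr_wpDl// addr_ge0// sqr_ge0.
  have yt : `|y| <= `|t| * (`|m| + s ^+ 2 / 2).
    rewrite (le_trans (ler_normD _ _))// mulrDr lerD//; first by rewrite normrM.
    have s2 : 0 <= s ^+ 2 / 2 by rewrite divr_ge0// sqr_ge0.
    rewrite -mulrA normrM normrX [X in _ * X]ger0_norm// ler_wpM2r// expr2.
    by rewrite ler_piMr.
  have y2 : `|y| <= 2^-1.
    rewrite (le_trans yt)// -[leRHS]mulr1.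
    have : `|t| * (2 * (`|m| + s ^+ 2 + 1)) <= 1.
      by rewrite -ler_pdivlMr ?div1r ?(ltW ta)// -invr_gt0.
    have := normr_ge0 t; have := normr_ge0 m; have := sqr_ge0 s; nra.
  have := le_trans (key t) (expR_le1DxD2sqr y2).
  have : y ^+ 2 <= t ^+ 2 * (`|m| + s ^+ 2 / 2) ^+ 2.
    by rewrite -(real_normK (num_real y)) -(real_normK (num_real t)) -exprMn
      lerXn2r// nnegrE// mulr_ge0// addr_ge0// divr_ge0// sqr_ge0.
  by rewrite /c /y; lra.
apply/eqP; rewrite -subr_eq0 eq_le; apply/andP; split.
  apply: (nonpos_of_quadratic_bound (c := c) a0) => t /andP[t0 ta].
  by apply: key; rewrite gtr0_norm.
rewrite -oppr_le0; apply: (nonpos_of_quadratic_bound (c := c) a0) => t /andP[t0 ta].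
by have := key (- t); rewrite normrN gtr0_norm// sqrrN mulrN mulNr; exact.
Qed.

(** As for the mean, with the transform of [(X - m) ^+ 2], whose linear term in [t] carries the
    variance. *)
Lemma normal_rv_variance X m s : normal_rv X m s -> ('V_Q[X] = (s ^+ 2)%:E)%E.
Proof.
move=> nX; have [mX _ _] := nX; have X2 := normal_rv_Lfun2 nX.
have X1 := normal_rv_Lfun1 nX.
have fV := variance_fin_num X2.
have mXm : measurable_fun [set: Omega] (fun w => (X w - m) ^+ 2).
  by apply: measurable_funX; exact: measurable_funB.
have VE : ('V_Q[X] = \int[Q]_w ((X w - m) ^+ 2)%:E)%E.
  by rewrite /variance covariance.unlock (normal_rv_mean nX) expectation.unlock.
have iX : Q.-integrable [set: Omega] (fun w => ((X w - m) ^+ 2)%:E).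
  apply/integrableP; split; first by apply/measurable_EFinP.
  under eq_integral do rewrite gee0_abs ?lee_fin ?sqr_ge0//.
  by rewrite -VE ltey_eq fV.
rewrite -(fineK fV); congr (_%:E); set v := fine _.
have v0 : 0 <= v by rewrite fine_ge0// variance_ge0.
have key t u : 0 < u -> 1 - 2 * t * s ^+ 2 = u ^+ 2 -> 1 + t * v <= u^-1.
  move=> u0 uE; rewrite -lee_fin -(normal_rv_expR_sqr nX u0 uE).
  have -> : ((1 + t * v)%:E = \int[Q]_w (1 + t * (X w - m) ^+ 2)%:E)%E.
    under eq_integral do rewrite EFinD EFinM.
    rewrite integralD//=; [|exact: finite_measure_integrable_cst|exact: integrableZl].
    rewrite integral_cst//= integralZl//= probability_setT mul1e.
    by rewrite EFinD EFinM fineK// VE.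
  apply: le_integral => //.
  - under eq_fun do rewrite EFinD EFinM.
    apply: integrableD => //; [exact: finite_measure_integrable_cst|].
    exact: integrableZl.
  - apply/integrableP; split.
      apply/measurable_EFinP; apply: measurableT_comp => //.
      exact: measurable_funM.
    under eq_integral do rewrite gee0_abs ?lee_fin ?expR_ge0//.
    by rewrite (normal_rv_expR_sqr nX u0 uE) ltry.
  - by move=> w _; rewrite lee_fin expR_ge1Dx.
pose a := (2 * (v + s ^+ 2 + 1))^-1.
have s20 : 0 <= s ^+ 2 by exact: sqr_ge0.
have a0 : 0 < a by rewrite invr_gt0 mulr_gt0// ltr_wpDl// addr_ge0.
(* Half of the higher-order terms of (1 + t v)^2 (1 - 2 t s^2) <= 1, after dropping the favourable
   t^2 v^2 and bounding t^3 by t^2. *)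
pose c := 2 * v * s ^+ 2 + v ^+ 2 * s ^+ 2.
have {}key t : `|t| < a -> t * (v - s ^+ 2) <= t ^+ 2 * c.
  move=> ta.
  have ta1 : `|t| * (2 * (v + s ^+ 2 + 1)) < 1.
    by rewrite -ltr_pdivlMr ?div1r// -invr_gt0.
  have := ta1; rewrite -[X in _ * X]ger0_norm ?mulr_ge0 ?addr_ge0//.
  rewrite -normrM ltr_norml => /andP[tl tr].
  have t1 : `|t| <= 1.
    have := normr_ge0 t; have : 0 <= v + s ^+ 2 by rewrite addr_ge0.
    by nra.
  have u0 : 0 < 1 - 2 * t * s ^+ 2.
    rewrite subr_gt0 (le_lt_trans _ ta1)//.
    have := normr_ge0 t; have := ler_norm t; nra.
  have tv : 0 <= 1 + t * v.
    have := normr_ge0 t; have := ler_norm (- t); rewrite normrN; nra.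
  have su0 : 0 < Num.sqrt (1 - 2 * t * s ^+ 2) by rewrite sqrtr_gt0.
  have := key t _ su0 (esym (sqr_sqrtr (ltW u0))).
  rewrite -[leRHS]mul1r ler_pdivlMr// => h.
  have : (1 + t * v) ^+ 2 * (1 - 2 * t * s ^+ 2) <= 1.
    by rewrite -{1}(sqr_sqrtr (ltW u0)) -exprMn exprn_ile1// mulr_ge0//.
  have : t ^+ 2 * t <= t ^+ 2.
    rewrite ler_piMr ?sqr_ge0// (le_trans (ler_norm t))//.
  rewrite /c; have := sqr_ge0 (t * v); have := sqr_ge0 v.
  nra.
apply/eqP; rewrite -subr_eq0 eq_le; apply/andP; split.
  apply: (nonpos_of_quadratic_bound (c := c) a0) => t /andP[t0 ta].
  by apply: key; rewrite gtr0_norm.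
rewrite -oppr_le0; apply: (nonpos_of_quadratic_bound (c := c) a0) => t /andP[t0 ta].
by have := key (- t); rewrite normrN gtr0_norm// sqrrN mulrN mulNr; exact.
Qed.

End normal_random_variable.

(** * Affine changes of variables and centred normal laws *)

Definition image_measure d d' (T1 : measurableType d) (T2 : measurableType d')
    (R : realType) (m : {measure set T1 -> \bar R}) (f : T1 -> T2)
    (mf : measurable_fun [set: T1] f) : {measure set T2 -> \bar R} :=
  measure_function_pushforward__canonical__measure_function_Measure m mf.

(** By uniqueness of Lebesgue measure it suffices to compare both sides on half-open intervals. *)
Lemma lebesgue_measure_affine {R : realType} (c b : R) (A : set R) : c != 0 ->
  measurable A ->
  (@lebesgue_measure R A =
   `|c|%:E * @lebesgue_measure R [set x | A (c * x + b)%R])%E.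
Proof.
move=> c0 mA.
have mf : measurable_fun [set: R] (fun x : R => c * x + b).
  by apply: measurable_funD => //; exact: measurable_funM.
have mf' : measurable_fun [set: measurableTypeR R]
  ((fun x : R => c * x + b) : measurableTypeR R -> measurableTypeR R) := mf.
pose nu := mscale (NngNum (normr_ge0 c)) (image_measure (@lebesgue_measure R) mf').
apply: (@lebesgue_measure_unique R nu) => //.
move=> X [[u v]] _ <-.
rewrite -[RHS]/(`|c|%:E * @lebesgue_measure R
  ((fun x : R => c * x + b)%R @^-1` `]u, v]%classic))%E /=.
have [vu|uv] := leP v u.
  rewrite set_itv_ge ?bnd_simp -?leNgt// preimage_set0.
  by rewrite !measure0 mule0.
have cc : 0 < `|c| by rewrite normr_gt0.
have [cp|cn|/eqP] := ltgtP 0 c; last by rewrite eq_sym (negbTE c0).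
  rewrite (_ : _ @^-1` _ = `](u - b) / c, (v - b) / c]%classic); last first.
    apply/seteqP; split=> x /=; rewrite !in_itv/=.
      by rewrite ltr_pdivrMr// ler_pdivlMr// ltrBlDr lerBrDr mulrC.
    by rewrite ltr_pdivrMr// ler_pdivlMr// ltrBlDr lerBrDr mulrC.
  rewrite !lebesgue_measure_itv/= !lte_fin uv ltr_pM2r ?invr_gt0// ltrD2r uv.
  rewrite -!EFinD -EFinM; congr _%:E; rewrite gtr0_norm//; field.
  by rewrite gt_eqF.
(* A negative [c] reverses the interval, so that the closed end moves to the left; the measure does
   not see it. *)
rewrite (_ : _ @^-1` _ = `[(v - b) / c, (u - b) / c[%classic); last first.
  apply/seteqP; split=> x /=; rewrite !in_itv/=.
    by rewrite ltr_ndivlMr// ler_ndivrMr// ltrBlDr lerBrDr mulrC andbC.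
  by rewrite ltr_ndivlMr// ler_ndivrMr// ltrBlDr lerBrDr mulrC andbC.
rewrite !lebesgue_measure_itv/= !lte_fin uv ltr_nM2r ?invr_lt0// ltrD2r uv.
rewrite -!EFinD -EFinM; congr _%:E; rewrite ltr0_norm//; field.
by rewrite lt_eqF.
Qed.

Lemma ge0_integral_affine {R : realType} (c b : R) (g : R -> R) : c != 0 ->
  measurable_fun [set: R] g -> (forall x, 0 <= g x) ->
  (\int[@lebesgue_measure R]_x (g x)%:E =
   \int[@lebesgue_measure R]_x (`|c| * g (c * x + b)%R)%:E)%E.
Proof.
move=> c0 mg g0.
have mf : measurable_fun [set: R] (fun x : R => c * x + b).
  by apply: measurable_funD => //; exact: measurable_funM.
have mf' : measurable_fun [set: measurableTypeR R]
  ((fun x : R => c * x + b) : measurableTypeR R -> measurableTypeR R) := mf.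
have mg0 : measurable_fun [set: R] (EFin \o g) by apply/measurable_EFinP.
have mg' : measurable_fun [set: measurableTypeR R] (EFin \o g) := mg0.
pose nu := mscale (NngNum (normr_ge0 c)) (image_measure (@lebesgue_measure R) mf').
rewrite (@eq_measure_integral _ _ _ _ nu); last first.
  by move=> A mA _; exact: (lebesgue_measure_affine b c0 mA).
rewrite ge0_integral_mscale//=; last by move=> x _; rewrite lee_fin.
rewrite ge0_integral_pushforward//=; last by move=> x _; rewrite lee_fin.
rewrite preimage_setT -ge0_integralZl//=.
- have mgh : measurable_fun [set: R] (fun x => (g (c * x + b))%:E).
    by apply/measurable_EFinP; exact: measurableT_comp mg mf.
  exact: mgh.
- by move=> x _; rewrite lee_fin.
Qed.

(** With the point mass at [s = 0] the family is closed under scaling and convolution. Negative [s]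
    is allowed, as only [s ^+ 2] matters ([normal0_sqr]). *)
HB.lock Definition normal0 {R : realType} (s : R) :
    probability (measurableTypeR R) R :=
  if s == 0 then (\d_ (0 : measurableTypeR R) : probability _ R)
  else (normal_prob 0 s : probability _ R).
Canonical normal0_unlockable := Unlockable normal0.unlock.

Section normal_law.
Context {R : realType}.
Implicit Types s t : R.
Local Notation T := (measurableTypeR R).

Lemma normal0E s (A : set R) : measurable A ->
  normal0 s A = if s == 0 then \d_(0 : R) A else normal_prob 0 s A.
Proof. by rewrite unlock; case: ifP. Qed.

Lemma normal0_pdf s (A : set R) : measurable A -> s != 0 ->
  normal0 s A = (\int[@lebesgue_measure R]_x (\1_A x * normal_pdf 0 s x)%:E)%E.
Proof.
move=> mA s0; rewrite normal0E// (negbTE s0) /normal_prob integral_mkcond.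
apply: eq_integral => x _; rewrite patchE indicE.
by case: ifPn => xA; rewrite ?mul1r ?mul0r.
Qed.

Lemma normal_pdf_scale c s x : c != 0 -> s != 0 ->
  `|c| * normal_pdf 0 (c * s) (c * x) = normal_pdf 0 s x.
Proof.
move=> c0 s0; have cs0 : c * s != 0 by rewrite mulf_neq0.
have cc : 0 < `|c| by rewrite normr_gt0.
have cK : (c * s) ^+ 2 = (s / `|c|^-1) ^+ 2.
  by rewrite invrK !exprMn real_normK ?num_real// mulrC.
rewrite !normal_pdf_neq0// mulrA; congr (_ * _).
  rewrite /normal_peak cK -/(normal_peak _) normal_peak_div ?invr_gt0//.
  by rewrite mulVKf// gt_eqF.
rewrite /normal_fun !subr0; congr expR; rewrite !mulr2n; field.
by rewrite -!mulr2n !mulrn_eq0 !expf_eq0/= mulf_eq0 (negbTE c0) (negbTE s0).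
Qed.

Lemma normal0_scale c s (A : set R) : measurable A ->
  normal0 (`|c| * s) A = normal0 s [set x | A (c * x)].
Proof.
move=> mA.
have mcx : measurable_fun [set: R] (fun x : R => c * x) by exact: measurable_funM.
have mcA : measurable [set x : R | A (c * x)].
  by rewrite -[X in measurable X]setTI; exact: mcx.
have [->|s0] := eqVneq s 0.
  rewrite mulr0 (normal0E _ mA) (normal0E _ mcA) eqxx !diracE; congr (_%:R%:E).
  by congr nat_of_bool; apply/idP/idP; rewrite !in_setE/= mulr0.
have [->|c0] := eqVneq c 0.
  rewrite normr0 mul0r (normal0E 0 mA) eqxx diracE.
  have [A0|A0] := pselect (A 0).
    rewrite mem_set// (_ : [set x | _] = setT) ?probability_setT//.
    by apply/seteqP; split => x //= _; rewrite mul0r.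
  rewrite memNset// (_ : [set x | _] = set0) ?measure0//.
  by apply/seteqP; split => x //=; rewrite mul0r.
have cs0 : `|c| * s != 0 by rewrite mulf_neq0// normr_eq0.
have E : normal_pdf 0 (`|c| * s) = normal_pdf 0 (c * s) :> (R -> R).
  apply/funext => x; rewrite !normal_pdf_neq0 ?mulf_neq0 ?normr_eq0//.
  by rewrite /normal_peak /normal_fun !exprMn real_normK ?num_real.
rewrite (normal0_pdf mA cs0) (normal0_pdf mcA s0) E.
rewrite (ge0_integral_affine 0 c0)/=.
- apply: eq_integral => x _; congr _%:E.
  by rewrite addr0 mulrCA normal_pdf_scale// !indicE.
- by apply: measurable_funM; [exact: measurable_indic|exact: measurable_normal_pdf].
- by move=> x; rewrite mulr_ge0// normal_pdf_ge0.
Qed.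

Lemma normal0_sqr s t (A : set R) : measurable A -> s ^+ 2 = t ^+ 2 ->
  normal0 s A = normal0 t A.
Proof.
move=> mA st; rewrite (normal0E s mA) (normal0E t mA).
have -> : (s == 0) = (t == 0) by rewrite -[LHS](@expf_eq0 _ s 2) st expf_eq0.
case: ifPn => [_|t0]; first by [].
rewrite /normal_prob.
have s0 : s != 0 by rewrite -[_ == _](@expf_eq0 _ s 2) st expf_eq0.
apply: eq_integral => x _; rewrite !normal_pdf_neq0//.
by rewrite /normal_peak /normal_fun st.
Qed.

(** Disintegration of the joint density of a summand and of the sum: the density of the sum at [z],
    times the conditional density of the summand given the sum. *)
Lemma normal_pdf_mul s t u x z : s != 0 -> t != 0 -> u != 0 ->
  s ^+ 2 + t ^+ 2 = u ^+ 2 ->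
  normal_pdf 0 s x * normal_pdf 0 t (z - x) =
  normal_pdf 0 u z * normal_pdf (z * s ^+ 2 / u ^+ 2) (s * t / u) x.
Proof.
move=> s0 t0 u0 stu.
have w0 : s * t / u != 0 by rewrite !mulf_neq0 ?invr_eq0.
rewrite !normal_pdf_neq0// mulrACA [RHS]mulrACA; congr (_ * _).
  rewrite /normal_peak; have := pi_ge0 R; move: pi => p p0.
  have k0 r : 0 <= r ^+ 2 * p *+ 2 by rewrite mulrn_wge0// mulr_ge0// sqr_ge0.
  rewrite -!invfM -!sqrtrM//; congr (Num.sqrt _)^-1.
  rewrite !mulr2n; field.
  exact: u0.
rewrite /normal_fun -!expRD; congr expR.
have st0 : s ^+ 2 + t ^+ 2 != 0 by rewrite stu expf_eq0.
rewrite [(s * t / u) ^+ 2]expr_div_n -stu !mulr2n; field.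
by rewrite st0 -!mulr2n !mulrn_eq0/= !expf_eq0/= mulf_eq0 !negb_or s0 t0 st0.
Qed.

(** After Tonelli the conditional density of [normal_pdf_mul] integrates to 1. The point masses have
    no such density and are treated apart. *)
Lemma normal0_convolution s t u (A : set R) : measurable A ->
  s ^+ 2 + t ^+ 2 = u ^+ 2 ->
  (normal0 s \x normal0 t)%E [set z | A (z.1 + z.2)] = normal0 u A.
Proof.
move=> mA stu.
have mB : measurable [set z : T * T | A (z.1 + z.2)].
  have mD : measurable_fun [set: T * T] (fun z : T * T => (z.1 : R) + z.2).
    by apply: measurable_funD; [exact: measurable_fst|exact: measurable_snd].
  by rewrite -[X in measurable X]setTI; exact: mD.
set B := (X in _ X = _) in mB *.
have xB x : xsection B x = [set y | A (x + y)].
  by apply/seteqP; split => y; rewrite /xsection/= in_setE.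
have mBx x : measurable [set y : R | A (x + y)] by rewrite -xB; exact: measurable_xsection.
rewrite -[LHS]/(\int[normal0 s]_x (normal0 t (xsection B x)))%E.
have [s0|s0] := eqVneq s 0.
  rewrite (@eq_measure_integral _ _ _ _ (\d_ (0 : T)))/=; last first.
    by move=> C mC _; rewrite (normal0E s mC) s0 eqxx.
  rewrite integral_dirac//; last exact: measurable_fun_xsection.
  rewrite diracT mul1e /= xB; under eq_set do rewrite add0r.
  by apply: normal0_sqr => //; rewrite -stu s0 expr0n add0r.
have [t0|t0] := eqVneq t 0.
  transitivity (\int[normal0 s]_x (\1_A x)%:E)%E; last first.
    rewrite integral_indic//= setIT; apply: normal0_sqr => //.
    by rewrite -stu t0 expr0n addr0.
  apply: eq_integral => x _.
  rewrite /= xB (normal0E t (mBx x)) t0 eqxx diracE indicE.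
  by congr (_%:R%:E); congr nat_of_bool; apply/idP/idP; rewrite !in_setE/= addr0.
have u0 : u != 0.
  by rewrite -[_ == _](@expf_eq0 _ u 2) -stu paddr_eq0 ?sqr_ge0// !expf_eq0 negb_and s0.
(* The joint density of the first summand [z.1] and the sum [z.2], restricted to sums in [A]. *)
pose f (z : T * T) : \bar R :=
  (\1_A (z.2 : R) * (normal_pdf 0 s z.1 * normal_pdf 0 t ((z.2 : R) - z.1)))%:E.
have f0 z : (0 <= f z)%E by rewrite lee_fin !mulr_ge0// normal_pdf_ge0.
have mf : measurable_fun [set: T * T] f.
  have m1 : measurable_fun [set: T * T] (fun z : T * T => (z.1 : R)).
    exact: measurable_fst.
  have m2 : measurable_fun [set: T * T] (fun z : T * T => (z.2 : R)).
    exact: measurable_snd.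
  apply/measurable_EFinP; apply: measurable_funM.
    exact: measurableT_comp (measurable_indic mA) m2.
  apply: measurable_funM.
    exact: measurableT_comp (measurable_normal_pdf 0 s) m1.
  by apply: measurableT_comp (measurable_normal_pdf 0 t) _; exact: measurable_funB.
transitivity (\int[@lebesgue_measure R]_x \int[@lebesgue_measure R]_z f (x, z))%E.
  rewrite (@eq_measure_integral _ _ _ _ (normal_prob 0 s))/=; last first.
    by move=> C mC _; rewrite (normal0E s mC) (negbTE s0).
  rewrite ge0_integral_normal_probe//; last exact: measurable_fun_xsection.
  apply: eq_integral => x _; rewrite xB (normal0_pdf (mBx x) t0).
  have mg : measurable_fun [set: R] (fun z => \1_A z * normal_pdf 0 t (z - x)).
    apply: measurable_funM; first exact: measurable_indic.
    by apply: measurableT_comp (measurable_normal_pdf 0 t) _; exact: measurable_funB.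
  have g0 z : 0 <= \1_A z * normal_pdf 0 t (z - x).
    by rewrite mulr_ge0// normal_pdf_ge0.
  transitivity ((\int[@lebesgue_measure R]_z (\1_A z * normal_pdf 0 t (z - x))%:E)
      * (normal_pdf 0 s x)%:E)%E.
    congr (_ * _)%E; rewrite (ge0_integral_affine x (oner_neq0 R) mg g0).
    apply: eq_integral => y _; congr _%:E; rewrite normr1 !mul1r addrK !indicE.
    congr (_%:R * _); congr nat_of_bool.
    by apply/idP/idP; rewrite !in_setE/= [x + y]addrC.
  rewrite -ge0_integralZr//.
  - by apply: eq_integral => z _; rewrite -EFinM /f/= mulrAC -mulrA [X in _ * X]mulrC.
  - have mg' : measurable_fun [set: R] (fun z => (\1_A z * normal_pdf 0 t (z - x))%:E).
      by apply/measurable_EFinP.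
    exact: mg'.
  - by move=> z _; rewrite lee_fin.
  - by rewrite lee_fin normal_pdf_ge0.
rewrite (@fubini_tonelli _ _ _ _ _ (@lebesgue_measure R) (@lebesgue_measure R) f mf f0).
rewrite (normal0_pdf mA u0); apply: eq_integral => z _.
have w0 : s * t / u != 0 by rewrite !mulf_neq0 ?invr_eq0.
transitivity (\int[@lebesgue_measure R]_x ((\1_A z * normal_pdf 0 u z)%:E *
   (normal_pdf (z * s ^+ 2 / u ^+ 2) (s * t / u) x)%:E))%E.
  apply: eq_integral => x _; rewrite -EFinM /f/=; congr _%:E.
  by rewrite (normal_pdf_mul x z s0 t0 u0 stu) mulrA.
rewrite ge0_integralZl//; first by rewrite integral_normal_pdf// mule1.
- exact: measurable_EFin_normal_pdf.
- by move=> x _; rewrite lee_fin normal_pdf_ge0.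
- by rewrite lee_fin mulr_ge0// normal_pdf_ge0.
Qed.

End normal_law.

(** * Tail bounds and laws of almost sure limits *)

Section tails.
Context d (Omega : measurableType d) (R : realType) (Q : probability Omega R).
Implicit Types (X Y : Omega -> R).

Lemma measurable_set_preimage X (A : set R) : measurable_fun [set: Omega] X ->
  measurable A -> measurable (X @^-1` A).
Proof. by move=> mX mA; rewrite -[X in measurable X]setTI; exact: mX. Qed.

Lemma measurable_set_gt X a : measurable_fun [set: Omega] X ->
  measurable [set w | a < X w].
Proof.
move=> mX; rewrite (_ : [set w | _] = X @^-1` `]a, +oo[%classic).
  exact: measurable_set_preimage.
by apply/seteqP; split=> w /=; rewrite in_itv/= andbT.
Qed.

Lemma measurable_set_ge X a : measurable_fun [set: Omega] X ->
  measurable [set w | a <= X w].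
Proof.
move=> mX; rewrite (_ : [set w | _] = X @^-1` `[a, +oo[%classic).
  exact: measurable_set_preimage.
by apply/seteqP; split=> w /=; rewrite in_itv/= andbT.
Qed.

Lemma exponential_tail X (sigma C lambda : R) : 0 < sigma ->
  measurable_fun [set: Omega] X ->
  (\int[Q]_w (expR (sigma^-1 * X w))%:E <= C%:E)%E ->
  (\int[Q]_w (expR (- sigma^-1 * X w))%:E <= C%:E)%E ->
  (Q [set w | lambda < `|X w|]%R <= (2 * C * expR (- (lambda / sigma)))%:E)%E.
Proof.
move=> s0 mX.
have one Y : measurable_fun [set: Omega] Y ->
    (\int[Q]_w (expR (sigma^-1 * Y w))%:E <= C%:E)%E ->
    (Q [set w | lambda <= Y w]%R <= (C * expR (- (lambda / sigma)))%:E)%E.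
  move=> mY YC; pose Z : {mfun Omega >-> R} := mfun_Sub (mem_set mY).
  have si : 0 < sigma^-1 by rewrite invr_gt0.
  apply: (le_trans (@chernoff _ _ _ Q Z _ lambda si)).
  rewrite EFinM [sigma^-1 * _]mulrC lee_wpmul2r ?lee_fin ?expR_ge0//.
  apply: le_trans YC; rewrite /mmt_gen_fun expectation.unlock.
  by under eq_integral do rewrite /= mulrC.
move=> h1 h2.
apply: (@le_trans _ _ (Q ([set w | lambda <= X w] `|` [set w | lambda <= - X w])%R)).
  apply: le_measure; rewrite ?inE.
  - by apply: measurable_set_gt; exact: measurableT_comp.
  - by apply: measurableU; apply: measurable_set_ge => //; exact: measurableT_comp.
  - move=> w /= h; have [x0|x0] := leP 0 (X w).
      by left; rewrite -(ger0_norm x0) ltW.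
    by right; rewrite -(ltr0_norm x0) ltW.
apply: (le_trans (measureU2 _ _ _)); 
  [exact: measurable_set_ge|
   by apply: measurable_set_ge; exact: measurableT_comp|].
rewrite -mulrA mulr_natl mulr2n EFinD leeD//; first exact: one.
apply: one; first exact: measurableT_comp.
by under eq_integral do rewrite mulrN -mulNr.
Qed.

(** Up to a null set [E] lies in the lower limit of the [F n], and continuity from below applies to
    the increasing intersections [L k]. *)
Lemma measure_liminf_le (F : nat -> set Omega) (E : set Omega) (c : \bar R) N :
  (forall n, measurable (F n)) -> measurable E ->
  {ae Q, forall w, E w -> exists n0, forall n, (n0 <= n)%N -> F n w} ->
  (forall n, (N <= n)%N -> (Q (F n) <= c)%E) -> (Q E <= c)%E.
Proof.
move=> mF mE [Z [mZ Z0 EZ]] Fc.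
pose L k := \bigcap_(n in [set n | (k <= n)%N]) F n.
have mL k : measurable (L k) by apply: bigcap_measurable => //; exists k => /=.
have EL : E `<=` (\bigcup_k L k) `|` Z.
  move=> w Ew; have [Zw|Zw] := pselect (Z w); [by right|left].
  have : E w -> exists n0, forall n, (n0 <= n)%N -> F n w.
    by apply: contrapT => h; apply: Zw; exact: EZ.
  by move=> /(_ Ew) [n0 h]; exists n0.
apply: (@le_trans _ _ (Q (\bigcup_k L k))).
  apply: (@le_trans _ _ (Q ((\bigcup_k L k) `|` Z))).
    by apply: le_measure; rewrite ?inE//; apply: measurableU => //; exact: bigcup_measurable.
  by rewrite (le_trans (measureU2 _ _ _))//; [exact: bigcup_measurable|rewrite [X in (_ + X)%E]Z0 adde0].
have cvL : Q (L k) @[k --> \oo] --> Q (\bigcup_k L k).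
  apply: nondecreasing_cvg_mu => //; first exact: bigcup_measurable.
  move=> k l kl; apply/subsetPset => w Lw n /= ln; apply: Lw => /=.
  exact: leq_trans ln.
apply: (cvge_le _ cvL); near=> k.
apply: (@le_trans _ _ (Q (F (maxn k N)))); last by apply: Fc; rewrite leq_maxr.
by apply: le_measure; rewrite ?inE// => w; apply => /=; rewrite leq_maxl.
Unshelve. all: by end_near. Qed.

Lemma law_eq_of_rays X (mu : probability (measurableTypeR R) R) :
  measurable_fun [set: Omega] X ->
  (forall x, Q (X @^-1` `]x, +oo[%classic) = mu `]x, +oo[%classic) ->
  forall A : set R, measurable A -> Q (X @^-1` A) = mu A.
Proof.
move=> mX gt_eq.
have mX' : measurable_fun [set: Omega] (X : Omega -> measurableTypeR R) := mX.
pose nu := image_measure Q mX'.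
move=> A mA.
apply: (@measure_unique _ _ (measurableTypeR R) (@RGenOInfty.G R)
  (fun n => `](- n%:R)%R, +oo[%classic) _ _ _ _ nu mu) => //.
- exact: RGenOInfty.measurableE.
- move=> _ _ [x ->] [y ->]; exists (Num.max x y).
  by apply/seteqP; split=> z /=; rewrite !in_itv/= !andbT gt_max => /andP.
- by move=> n; exists (- n%:R).
- apply/seteqP; split => // x _; exists (Num.bound `|x|) => //=.
  rewrite in_itv/= andbT ltrNl (le_lt_trans _ (archi_boundP (normr_ge0 x)))//.
  by rewrite -normrN ler_norm.
- by move=> _ [x ->]; exact: gt_eq.
- move=> k; rewrite (le_lt_trans _ (ltry 1))//.
  apply: (@probability_le1 _ _ _ Q); exact: measurable_set_preimage.
Qed.

(** If the limit lies in an open set, so do the approximants eventually; this gives one inequality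
    on open sets, and on rays complements give the other. *)
Lemma lim_same_law (Y : nat -> Omega -> R) X
    (mu : probability (measurableTypeR R) R) :
  (forall n, measurable_fun [set: Omega] (Y n)) ->
  measurable_fun [set: Omega] X ->
  (forall n (A : set R), measurable A -> Q (Y n @^-1` A) = mu A) ->
  {ae Q, forall w, Y n w @[n --> \oo] --> X w} ->
  forall A : set R, measurable A -> Q (X @^-1` A) = mu A.
Proof.
move=> mY mX Ymu YX.
have openle (U : set R) : open U -> (Q (X @^-1` U) <= mu U)%E.
  move=> oU; have mU : measurable U by exact: open_measurable.
  apply: (@measure_liminf_le (fun n => Y n @^-1` U) _ _ 0%N).
  - by move=> n; exact: measurable_set_preimage.
  - exact: measurable_set_preimage.
  - apply: filterS YX => w YXw Uw.
    have : \forall n \near \oo, U (Y n w) by apply: YXw; exact: open_nbhs_nbhs.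
    by move=> [n0 _ h]; exists n0.
  - by move=> n _; rewrite Ymu.
have gt_eq x : Q (X @^-1` `]x, +oo[%classic) = mu `]x, +oo[%classic.
  apply/eqP; rewrite eq_le; apply/andP; split; first exact/openle/interval_open.
  (* The converse inequality uses [openle] on the open ray below [z], with [z] decreasing to [x]. *)
  have h : mu `[(x + k.+1%:R^-1)%R, +oo[%classic @[k --> \oo] --> mu `]x, +oo[%classic.
    rewrite itvoyEbigcup; apply: nondecreasing_cvg_mu => //.
      exact: bigcup_measurable.
    move=> k l kl; apply/subsetPset => y; rewrite /= !in_itv/= !andbT.
    by apply: le_trans; rewrite lerD2l lef_pV2 ?posrE// ler_nat.
  apply: (cvge_le _ h); near=> k.
  set z := (x + _)%R.
  have zx : (Q (X @^-1` `]-oo, z[%classic) <= mu `]-oo, z[%classic)%E.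
    exact/openle/interval_open.
  apply: (@le_trans _ _ (Q (X @^-1` `[z, +oo[%classic))).
    have E1 : Q (X @^-1` `]-oo, z[%classic) = (1 - Q (X @^-1` `[z, +oo[%classic))%E.
      rewrite -(probability_setC Q (measurable_set_preimage mX (measurable_itv _))).
      by rewrite preimage_setC setCitvr.
    have E2 : mu `]-oo, z[%classic = (1 - mu `[z, +oo[%classic)%E.
      by rewrite -(probability_setC mu (measurable_itv _)) setCitvr.
    move: zx; rewrite E1 E2.
    have fq : Q (X @^-1` `[z, +oo[%classic) \is a fin_num.
      by apply: fin_num_measure; exact: measurable_set_preimage.
    have fm : mu `[z, +oo[%classic \is a fin_num by exact: fin_num_measure.
    by rewrite -(fineK fq) -(fineK fm) -!EFinB !lee_fin lerD2l lerN2.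
  apply: le_measure; rewrite ?inE; [exact: measurable_set_preimage..|].
  move=> w /=; rewrite !in_itv/= !andbT; apply: lt_le_trans.
  by rewrite ltrDl.
exact: law_eq_of_rays.
Unshelve. all: by end_near. Qed.

End tails.

Section centered_normal.
Context d (Omega : measurableType d) (R : realType) (Q : probability Omega R).
Implicit Types (X Y : Omega -> R).

Definition centered_normal X (s : R) := measurable_fun [set: Omega] X /\
  forall A : set R, measurable A -> Q (X @^-1` A) = normal0 s A.

Lemma centered_normal_rv X s : centered_normal X s -> normal_rv Q X 0 `|s|.
Proof.
move=> [mX QX]; split => // A mA.
rewrite (QX _ mA) -(normal0E _ mA); apply: normal0_sqr => //.
by rewrite real_normK ?num_real.
Qed.

Lemma centered_normal_gaussian X s : centered_normal X s ->
  gaussian_law (pushforward Q X).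
Proof.
by move=> /centered_normal_rv [mX s0 QX]; exists 0, `|s|; split.
Qed.

Lemma centered_normal_scale X s c : centered_normal X s ->
  centered_normal (fun w => c * X w) (c * s).
Proof.
move=> [mX QX]; split; first exact: measurable_funM.
move=> A mA.
have mcx : measurable_fun [set: R] (fun x : R => c * x) by exact: measurable_funM.
have mcA : measurable [set x : R | A (c * x)].
  by rewrite -[X in measurable X]setTI; exact: mcx.
transitivity (normal0 s [set x | A (c * x)]); first exact: (QX _ mcA).
rewrite -(normal0_scale c s mA); apply: normal0_sqr => //.
by rewrite !exprMn real_normK ?num_real.
Qed.

(** The event [E] stands for constraints on further variables; it lets the induction of
    [sum_xi_cylinder] work with cylinders instead of independent sigma-algebras. *)
Lemma normal0_add_independent X Y (E : set Omega) (s t u : R) :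
  measurable_fun [set: Omega] X -> measurable_fun [set: Omega] Y ->
  measurable E -> s ^+ 2 + t ^+ 2 = u ^+ 2 ->
  (forall A B : set R, measurable A -> measurable B ->
    Q (X @^-1` A `&` Y @^-1` B `&` E) = (normal0 s A * normal0 t B * Q E)%E) ->
  forall A : set R, measurable A ->
  Q ((fun w => X w + Y w) @^-1` A `&` E) = (normal0 u A * Q E)%E.
Proof.
move=> mX mY mE stu indep A mA.
pose T := measurableTypeR R.
have mXY : measurable_fun [set: Omega] ((fun w => (X w, Y w)) : Omega -> T * T).
  exact: measurable_fun_pair mX mY.
pose nu := image_measure (mrestr Q mE) mXY.
have QE0 : 0 <= fine (Q E) by rewrite fine_ge0.
have QEf : Q E \is a fin_num by exact: fin_num_measure.
(* The mass of [E] is put into the first factor, so that the joint law restricted to [E] is a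
   product measure. *)
pose m1 : {finite_measure set T -> \bar R} :=
  mscale (NngNum QE0) (normal0 s).
have h : forall C, measurable C -> (m1 \x normal0 t)%E C = nu C.
  apply: product_measure_unique => B C mB mC.
  rewrite -[LHS]/(Q (X @^-1` B `&` Y @^-1` C `&` E)) indep//.
  rewrite -[RHS]/((fine (Q E))%:E * normal0 s B * normal0 t C)%E (fineK QEf).
  by rewrite -[RHS]muleA [RHS]muleC.
pose B := [set z : T * T | A ((z.1 : R) + z.2)].
have mB : measurable B.
  have mD : measurable_fun [set: T * T] (fun z : T * T => (z.1 : R) + z.2).
    by apply: measurable_funD; [exact: measurable_fst|exact: measurable_snd].
  by rewrite -[X in measurable X]setTI; exact: mD.
transitivity (nu B); first by [].
rewrite -(h _ mB) -(normal0_convolution mA stu).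
rewrite -[LHS]/(\int[m1]_x (normal0 t (xsection B x)))%E.
rewrite -[X in (X * _)%E]/(\int[normal0 s]_x
  (normal0 t (xsection B x)))%E.
rewrite ge0_integral_mscale//; last exact: measurable_fun_xsection.
by rewrite [LHS]muleC/= (fineK QEf).
Qed.

End centered_normal.

Section independent_normals.
Context d (Omega : measurableType d) (R : realType) (Q : probability Omega R).
Variable xi : nat -> Omega -> R.
Hypothesis mxi : forall i, measurable_fun [set: Omega] (xi i).
Hypothesis xi_indep : forall (J : seq nat) (A : nat -> set R), uniq J ->
  (forall i, measurable (A i)) ->
  Q (\big[setI/setT]_(i <- J) (xi i @^-1` A i)) =
  (\prod_(i <- J) normal0 1 (A i))%E.

Lemma measurable_sum_xi (a : nat -> R) (J : seq nat) :
  measurable_fun [set: Omega] (fun w => \sum_(i <- J) a i * xi i w).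
Proof.
by apply: measurable_sum => i; exact: measurable_funM.
Qed.

Lemma measurable_cylinder (B : nat -> set R) (J : seq nat) :
  (forall i, measurable (B i)) ->
  measurable (\big[setI/setT]_(i <- J) (xi i @^-1` B i)).
Proof.
move=> mB; elim: J => [|i J IH]; first by rewrite big_nil.
rewrite big_cons; apply: measurableI => //.
exact: measurable_set_preimage.
Qed.

(** Induction on [J]: the law of one term is tested by turning its index into a constraint of the
    cylinder over [J'], hence the generality in [J']. *)
Lemma sum_xi_cylinder (a : nat -> R) (J J' : seq nat) (A : set R)
    (B : nat -> set R) : uniq (J ++ J') -> measurable A ->
  (forall i, measurable (B i)) ->
  Q ((fun w => \sum_(i <- J) a i * xi i w) @^-1` A `&`
     \big[setI/setT]_(i <- J') (xi i @^-1` B i)) =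
  (normal0 (Num.sqrt (\sum_(i <- J) a i ^+ 2)) A *
   Q (\big[setI/setT]_(i <- J') (xi i @^-1` B i)))%E.
Proof.
elim: J J' A B => [|i J IH] J' A B.
  move=> _ mA mB; set E := \big[_/_]_(_ <- _) _.
  rewrite big_nil sqrtr0 (normal0E 0 mA) eqxx diracE.
  have [A0|A0] := pselect (A 0).
    rewrite mem_set// mul1e (_ : _ @^-1` _ = setT) ?setTI//.
    by apply/seteqP; split => w //= _; rewrite big_nil.
  rewrite memNset// mul0e (_ : _ @^-1` _ = set0) ?set0I ?measure0//.
  by apply/seteqP; split => w //=; rewrite big_nil.
rewrite cat_cons cons_uniq mem_cat negb_or => /andP[/andP[iJ iJ'] uJ] mA mB.
have uJ' : uniq J' by move: uJ; rewrite cat_uniq => /and3P[].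
have uiJ' : uniq (i :: J') by rewrite /= iJ' uJ'.
have uJi : uniq (J ++ i :: J').
  by rewrite -cat1s uniq_catCA /= cat_uniq; rewrite /= mem_cat (negbTE iJ) (negbTE iJ')
    -cat_uniq.
set E := \big[_/_]_(_ <- _) _.
have mE : measurable E by exact: measurable_cylinder.
pose u := Num.sqrt (\sum_(i <- i :: J) a i ^+ 2).
pose t := Num.sqrt (\sum_(i <- J) a i ^+ 2).
have stu : a i ^+ 2 + t ^+ 2 = u ^+ 2.
  by rewrite !sqr_sqrtr ?big_cons// ?addr_ge0 ?sumr_ge0 ?sqr_ge0// => ? _; exact: sqr_ge0.
have -> : (fun w => \sum_(i0 <- i :: J) a i0 * xi i0 w) =
          (fun w => a i * xi i w + \sum_(i0 <- J) a i0 * xi i0 w).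
  by apply/funext => w; rewrite big_cons.
apply: (normal0_add_independent (s := a i) (t := t)) => //.
- exact: measurable_funM.
- exact: measurable_sum_xi.
move=> C D mC mD.
have mcx : measurable_fun [set: R] (fun x : R => a i * x) by exact: measurable_funM.
have maC : measurable [set x : R | C (a i * x)].
  by rewrite -[X in measurable X]setTI; exact: mcx.
pose B' k := if k == i then [set x : R | C (a i * x)] else B k.
have mB' k : measurable (B' k) by rewrite /B'; case: ifP.
have EE : E = \big[setI/setT]_(i0 <- J') (xi i0 @^-1` B' i0).
  apply: eq_big_seq => k kJ'; rewrite /B' ifF//.
  by apply/negbTE; apply: contraNneq iJ' => <-.
have E' : (fun w => a i * xi i w) @^-1` C `&` E =
    \big[setI/setT]_(i0 <- i :: J') (xi i0 @^-1` B' i0).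
  by rewrite big_cons -EE /B' eqxx.
rewrite setIAC E' [X in Q X]setIC IH// -/t.
rewrite xi_indep// big_cons -xi_indep// -EE {1}/B' eqxx.
have -> : normal0 1 [set x | C (a i * x)] = normal0 (a i) C.
  apply: etrans (esym (normal0_scale (a i) 1 mC)) _.
  by apply: (normal0_sqr mC); rewrite mulr1 real_normK ?num_real.
by rewrite muleA; congr (_ * _)%E; exact: muleC.
Qed.

Lemma sum_xi_normal (a : nat -> R) (J : seq nat) : uniq J ->
  centered_normal Q (fun w => \sum_(i <- J) a i * xi i w)
    (Num.sqrt (\sum_(i <- J) a i ^+ 2)).
Proof.
move=> uJ; split; first exact: measurable_sum_xi.
move=> A mA; have := @sum_xi_cylinder a J [::] A (fun=> setT).
by rewrite cats0 big_nil setIT probability_setT mule1; exact.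
Qed.

End independent_normals.

Lemma centered_normal_tail d (Omega : measurableType d) (R : realType)
    (Q : probability Omega R) (X : Omega -> R) (s e : R) :
  centered_normal Q X s -> 0 < e ->
  (Q [set w | e < `|X w|]%R <= (s ^+ 2 / e ^+ 2)%:E)%E.
Proof.
move=> nX e0; have mX : measurable_fun [set: Omega] X by case: nX.
have nrv := centered_normal_rv nX.
pose Z : {mfun Omega >-> R} := mfun_Sub (mem_set mX).
have := @chebyshev _ _ _ Q Z _ e0.
rewrite (normal_rv_mean nrv) (normal_rv_variance nrv) /= => h.
apply: (@le_trans _ _ (Q [set w | e <= `|X w - 0|])).
  apply: le_measure; rewrite ?inE.
  - by apply: measurable_set_gt; exact: measurableT_comp.
  - by apply: measurable_set_ge; apply: measurableT_comp => //; exact: measurable_funB.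
  - by move=> w /= /ltW; rewrite subr0.
by rewrite (le_trans h)// -EFinM lee_fin real_normK ?num_real// mulrC.
Qed.

Section normal_limit.
Context d (Omega : measurableType d) (R : realType) (Q : probability Omega R).

(** If [v > 0], rescaling by factors tending to 1 gives every late [Y n] exactly the limiting law,
    and [lim_same_law] applies. If [v = 0], Chebyshev's bound shows that the limit is almost surely
    0. *)
Lemma centered_normal_lim (Y : nat -> Omega -> R) (X : Omega -> R)
    (s : nat -> R) (v : R) :
  (forall n, centered_normal Q (Y n) (s n)) ->
  measurable_fun [set: Omega] X ->
  s n ^+ 2 @[n --> \oo] --> v ->
  {ae Q, forall w, Y n w @[n --> \oo] --> X w} ->
  centered_normal Q X (Num.sqrt v).
Proof.
move=> nY mX sv YX; split => // A mA.
have v0 : 0 <= v.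
  by apply: (cvgr_to_ge sv); apply: nearW => n; exact: sqr_ge0.
have mY n : measurable_fun [set: Omega] (Y n) by case: (nY n).
move: v0; rewrite le_eqVlt => /predU1P[v0|v0]; last first.
  have [N _ sN] : \forall n \near \oo, 0 < s n ^+ 2.
    by apply: (cvgr_gt _ sv).
  have s0 n : (N <= n)%N -> s n != 0.
    by move=> /sN /=; rewrite exprn_even_gt0.
  pose c n := Num.sqrt v / `|s n|.
  have c1 : c n @[n --> \oo] --> (1 : R).
    have : Num.sqrt v / Num.sqrt (s n ^+ 2) @[n --> \oo] --> Num.sqrt v / Num.sqrt v.
      apply: cvgM; first exact: cvg_cst.
      apply: cvgV; first by rewrite gt_eqF// sqrtr_gt0.
      by apply: cvg_comp sv _; exact: sqrt_continuous.
    rewrite divff ?gt_eqF ?sqrtr_gt0//.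
    by under eq_fun do rewrite sqrtr_sqr.
  apply: (@lim_same_law _ _ _ Q (fun n w => c (n + N)%N * Y (n + N)%N w)) => //.
  - by move=> n; exact: measurable_funM.
  - move=> n B mB; have [_ ->//] := centered_normal_scale (c (n + N)%N) (nY (n + N)%N).
    apply: (normal0_sqr mB); rewrite /c !exprMn exprVn real_normK ?num_real//.
    by rewrite divfK// expf_neq0// s0// leq_addl.
  - apply: filterS YX => w Yw.
    rewrite -[X w]mul1r.
    apply: (@cvgM _ _ _ _ (fun n => c (n + N)%N) (fun n => Y (n + N)%N w)).
      by rewrite cvg_shiftn.
    by rewrite (cvg_shiftn N (Y ^~ w)).
have X0 : Q [set w | X w <> 0] = 0%E.
  have -> : [set w | X w <> 0] = \bigcup_k [set w | k.+1%:R^-1 < `|X w|].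
    apply/seteqP; split => w /= => [Xw0|[k _ /= Xk] Xw0]; last first.
      by move: Xk; rewrite Xw0 normr0 ltNge invr_ge0 ler0n.
    have x0 : 0 < `|X w| by rewrite normr_gt0; exact/eqP.
    exists (Num.bound `|X w|^-1) => //=.
    rewrite invf_plt ?posrE//.
    rewrite (lt_trans (archi_boundP _))// ?invr_ge0// ltr_nat//.
  have mk k : measurable [set w | k.+1%:R^-1 < `|X w|].
    by apply: measurable_set_gt; exact: measurableT_comp.
  have Qk k : Q [set w | k.+1%:R^-1 < `|X w|] = 0%E.
    apply/eqP; rewrite eq_le measure_ge0 andbT; apply/lee_addgt0Pr => e e0.
    rewrite add0e.
    have k0 : 0 < (k.+1%:R^-1 : R) by rewrite invr_gt0.
    have [N _ sN] : \forall n \near \oo, s n ^+ 2 < e * (k.+1%:R^-1) ^+ 2.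
      by apply: (cvgr_lt _ sv); rewrite -v0 mulr_gt0// exprn_gt0.
    apply: (@measure_liminf_le _ _ _ _ (fun n => [set w | k.+1%:R^-1 < `|Y n w|]) _ _ N).
    + by move=> n; apply: measurable_set_gt; exact: measurableT_comp.
    + exact: mk.
    + apply: filterS YX => w Yw Xw.
      have : \forall n \near \oo, k.+1%:R^-1 < `|Y n w|.
        by apply: (cvgr_gt _ (cvg_norm Yw)).
      by move=> [n0 _ h]; exists n0.
    + move=> n Nn.
      apply: (le_trans (centered_normal_tail (nY n) k0)).
      by rewrite lee_fin ler_pdivrMr ?exprn_gt0// ltW// sN.
  have mU : measurable (\bigcup_k [set w | k.+1%:R^-1 < `|X w|]).
    exact: bigcup_measurable.
  apply: (proj1 (@negligibleP _ _ _ Q _ mU)); apply: negligible_bigcup => k.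
  exact: (proj2 (@negligibleP _ _ _ Q _ (mk k)) (Qk k)).
have mX0 : measurable [set w | X w <> 0].
  rewrite (_ : [set w | _] = X @^-1` (~` [set 0]))//.
  by apply: measurable_set_preimage => //; exact: measurableC.
have mXA : measurable (X @^-1` A) by exact: measurable_set_preimage.
have noA (B : set R) : measurable B -> ~ B 0 -> Q (X @^-1` B) = 0%E.
  move=> mB B0; apply/eqP; rewrite eq_le measure_ge0 andbT -X0.
  apply: le_measure; rewrite ?inE//; first exact: measurable_set_preimage.
  by move=> w /= Bw X0w; apply: B0; rewrite -X0w.
rewrite -v0 sqrtr0 (normal0E 0 mA) eqxx diracE.
have [A0|A0] := pselect (A 0); last by rewrite memNset// noA.
rewrite mem_set// -[X @^-1` A]setCK probability_setC; last exact: measurableC.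
by rewrite preimage_setC noA ?sube0//; exact: measurableC.
Unshelve. all: by end_near. Qed.

End normal_limit.

Lemma mem_bigsetU (T : Type) (I : eqType) (s : seq I) (F : I -> set T) x :
  (exists2 i, i \in s & F i x) -> (\big[setU/set0]_(i <- s) F i) x.
Proof.
elim: s => [[]//|i s IH [k]]; rewrite inE big_cons => /orP[/eqP->|ks] Fk; first by left.
by right; apply: IH; exists k.
Qed.

Lemma measure_bigsetU_le d (T : measurableType d) (R : realType)
    (mu : {measure set T -> \bar R}) (I : Type) (s : seq I) (F : I -> set T) :
  (forall i, measurable (F i)) ->
  (mu (\big[setU/set0]_(i <- s) F i) <= \sum_(i <- s) mu (F i))%E.
Proof.
move=> mF; elim: s => [|i s IH]; first by rewrite !big_nil measure0.
rewrite !big_cons (le_trans (measureU2 _ _ _))//; last exact: leeD2l.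
exact: bigsetU_measurable.
Qed.

(** * Corner sets and their grid approximations *)

Section corner_distance.
Context {R : realType} (d : nat).
Local Notation T := (corner d * d.-tuple R)%type.
Local Notation P0 := (@uniform_cube R d).
Implicit Types (j l q : T) (c : corner d) (x y : d.-tuple R).

Definition cset j : set (d.-tuple R) := cornerLe j.1 j.2.

Lemma measurable_tnth_itv (k : 'I_d) (A : set R) : measurable A ->
  measurable [set s : d.-tuple R | A (tnth s k)].
Proof.
by move=> mA; rewrite -[X in measurable X]setTI; exact: measurable_tnth.
Qed.

Lemma measurable_forall_tnth (A : 'I_d -> set R) : (forall k, measurable (A k)) ->
  measurable [set s : d.-tuple R | forall k, A k (tnth s k)].
Proof.
move=> mA.
have -> : [set s : d.-tuple R | forall k, A k (tnth s k)] =
    \bigcap_(k in [set: 'I_d]) [set s : d.-tuple R | A k (tnth s k)].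
  by apply/seteqP; split=> [s /= h k _|s h k]; [exact: h|exact: (h k)].
by apply: fin_bigcap_measurable => // k _; exact: measurable_tnth_itv.
Qed.

Lemma measurable_cset j : measurable (cset j).
Proof.
pose B k : set R :=
  if j.1 k then `[tnth j.2 k, +oo[%classic else `]-oo, tnth j.2 k]%classic.
rewrite (_ : cset j = [set s | forall k, `[0, 1]%classic (tnth s k)] `&`
    [set s | forall k, B k (tnth s k)]).
  apply: measurableI; first exact: (measurable_forall_tnth (A := fun=> `[0, 1]%classic)).
  by apply: measurable_forall_tnth => k; rewrite /B; case: ifP.
apply/seteqP; split => s [us sc]; split => k.
- by have := us k; rewrite /= in_itv.
- by have := sc k; rewrite /B; case: ifP; rewrite /= in_itv/= ?andbT.
- by have := us k; rewrite /= in_itv.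
- by have := sc k; rewrite /B; case: ifP; rewrite /= in_itv/= ?andbT.
Qed.

Definition cprob (A : set (d.-tuple R)) : R := fine (P0 A).

Lemma cprobE A : measurable A -> (cprob A)%:E = P0 A.
Proof. by move=> mA; rewrite fineK// fin_num_measure. Qed.

Lemma cprob_ge0 A : 0 <= cprob A.
Proof. by rewrite fine_ge0. Qed.

Lemma le_cprob A B : measurable A -> measurable B -> A `<=` B ->
  cprob A <= cprob B.
Proof.
by move=> mA mB AB; rewrite -lee_fin !cprobE//; apply: le_measure; rewrite ?inE.
Qed.

Lemma cprobU_le A B : measurable A -> measurable B ->
  cprob (A `|` B) <= cprob A + cprob B.
Proof.
move=> mA mB; rewrite -lee_fin EFinD !cprobE//; last exact: measurableU.
exact: measureU2.
Qed.

Definition symdiff (A B : set (d.-tuple R)) := (A `\` B) `|` (B `\` A).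

Lemma measurable_symdiff A B : measurable A -> measurable B -> measurable (symdiff A B).
Proof. by move=> mA mB; apply: measurableU; exact: measurableD. Qed.

(** The square of [rho] ([rho_sqr]). As the measure of a symmetric difference it satisfies the
    triangle inequality itself, so that square roots can wait until the end. *)
Definition cdist j l : R := cprob (symdiff (cset j) (cset l)).

Lemma measurable_cdist_set j l : measurable (symdiff (cset j) (cset l)).
Proof. by apply: measurable_symdiff; exact: measurable_cset. Qed.
Hint Resolve measurable_cdist_set measurable_cset : core.

Lemma cdist_ge0 j l : 0 <= cdist j l.
Proof. exact: cprob_ge0. Qed.

Lemma cdistC j l : cdist j l = cdist l j.
Proof. by rewrite /cdist /symdiff setUC. Qed.

Lemma cdist_triangle q j l : cdist j l <= cdist j q + cdist q l.
Proof.
apply: le_trans (cprobU_le (measurable_cdist_set _ _) (measurable_cdist_set _ _)).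
apply: le_cprob => //; first exact: measurableU.
move=> s [[js ls]|[ls js]]; have [qs|qs] := pselect (cset q s).
- by right; left.
- by left; left.
- by left; right.
- by right; right.
Qed.

Lemma corner_fun_diff_sqr j l y :
  (corner_fun j y - corner_fun l y) ^+ 2 = \1_(symdiff (cset j) (cset l)) y.
Proof.
rewrite /corner_fun -/(cset j) -/(cset l) !indicE /symdiff.
have [jy|jy] := pselect (cset j y); have [ly|ly] := pselect (cset l y).
- rewrite (mem_set jy) (mem_set ly) memNset ?subrr ?expr0n//.
  by move=> [[]|[]].
- rewrite (mem_set jy) (memNset ly) mem_set ?subr0 ?expr1n//; by left.
- rewrite (mem_set ly) (memNset jy) mem_set ?sub0r ?sqrrN ?expr1n//; by right.
- rewrite (memNset jy) (memNset ly) memNset ?subrr ?expr0n//.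
  by move=> [[]|[]].
Qed.

Lemma rho_sqrt j l : rho j l = Num.sqrt (cdist j l).
Proof.
rewrite /rho unlock /Lnorm.
rewrite (eq_integral (fun y => (\1_(symdiff (cset j) (cset l)) y)%:E)); last first.
  move=> y _ /=; rewrite powR_mulrn// real_normK ?num_real//.
  by rewrite corner_fun_diff_sqr.
rewrite integral_indic//= setIT -cprobE// poweR_EFin/=.
by rewrite -powR12_sqrt ?cprob_ge0.
Qed.

Lemma rho_sqr j l : rho j l ^+ 2 = cdist j l.
Proof. by rewrite rho_sqrt sqr_sqrtr// cdist_ge0. Qed.

Lemma corner_covE j l :
  corner_cov j l = cprob (cset j `&` cset l) - cprob (cset j) * cprob (cset l).
Proof.
have RI A : measurable A -> \int[P0]_y (\1_A y : R) = cprob A.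
  by move=> mA; rewrite /Rintegral integral_indic// setIT.
rewrite /corner_cov /corner_fun -/(cset j) -/(cset l) !RI//; congr (_ - _).
rewrite -RI; last exact: measurableI.
apply: eq_Rintegral => y _; move: (cset j) (cset l) => A B.
by rewrite indicI.
Qed.

Lemma cdistE j l : cdist j l =
  cprob (cset j) + cprob (cset l) - 2 * cprob (cset j `&` cset l).
Proof.
have mj := measurable_cset j; have ml := measurable_cset l.
have mD (A B : set (d.-tuple R)) : measurable A -> measurable B ->
    cprob A = cprob (A `&` B) + cprob (A `\` B).
  move=> mA mB; apply: EFin_inj; rewrite EFinD !cprobE//.
  - by rewrite [RHS]addeC; exact: measureDI.
  - exact: measurableD.
  - exact: measurableI.
have E : cdist j l = cprob (cset j `\` cset l) + cprob (cset l `\` cset j).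
  have m1 := measurableD mj ml; have m2 := measurableD ml mj.
  have m3 := measurable_symdiff mj ml.
  apply: EFin_inj; rewrite EFinD /cdist (cprobE m1) (cprobE m2) (cprobE m3).
  apply: measureU => //.
  by apply/seteqP; split => s // [[js ls] [ls' _]].
rewrite E [cprob (cset j)](mD _ _ mj ml) [cprob (cset l)](mD _ _ ml mj).
by rewrite [cset l `&` cset j]setIC; ring.
Qed.

Lemma empirical_processE (X : nat -> d.-tuple R) n j :
  empirical_process X n j =
  Num.sqrt n%:R * (n%:R^-1 * (\sum_(i < n) \1_(cset j) (X i)) - cprob (cset j)).
Proof.
rewrite /empirical_process /corner_fun -/(cset j); congr (_ * (_ - _)); last first.
  by rewrite /Rintegral integral_indic// setIT.
have mI : measurable_fun [set: d.-tuple R] (fun y => (\1_(cset j) y : R)%:E).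
  by apply/measurable_EFinP; exact: measurable_indic.
rewrite /Rintegral /empirical_measure ge0_integral_mscale//=.
rewrite ge0_integral_measure_sum//.
rewrite (eq_bigr (fun i : 'I_n => (\1_(cset j) (X i))%:E)) => [|i _].
  by rewrite sumEFin -EFinM.
by rewrite integral_dirac// diracT mul1e.
Qed.

Lemma uniform_prob_itv_le (a b : R) : a <= b ->
  (uniform_prob (@ltr01 R) `[a, b]%classic <= (b - a)%:E)%E.
Proof.
move=> ab; rewrite /uniform_prob.
have <- : (\int[@lebesgue_measure R]_(x in `[a, b]) 1%:E = (b - a)%:E)%E.
  rewrite integral_cst//= mul1e lebesgue_measure_itv/= lte_fin.
  by case: ltgtP ab => // -> _; rewrite subrr.
apply: ge0_le_integral => //.
- by move=> x _; rewrite lee_fin uniform_pdf_ge0.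
- have h : measurable_fun [set: R] (fun u => (uniform_pdf (0 : R) 1 u)%:E).
    by apply/measurable_EFinP; exact: measurable_uniform_pdf.
  exact: measurable_funTS h.
- by move=> x _; rewrite lee_fin /uniform_pdf; case: ifP => // _; rewrite subr0 invr1.
Qed.

Definition slab (k : 'I_d) (a b : R) : set (d.-tuple R) :=
  [set s | Num.min a b <= tnth s k <= Num.max a b].

Lemma measurable_slab k a b : measurable (slab k a b).
Proof.
rewrite (_ : slab k a b =
    [set s : d.-tuple R | `[Num.min a b, Num.max a b]%classic (tnth s k)]).
  exact: measurable_tnth_itv.
by apply/seteqP; split => s; rewrite /slab/= in_itv.
Qed.

Lemma cprob_slab_le k a b : cprob (slab k a b) <= `|a - b|.
Proof.
rewrite -lee_fin cprobE; last exact: measurable_slab.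
pose A k' : set R := if k' == k then `[Num.min a b, Num.max a b]%classic else setT.
have mA k' : measurable (A k') by rewrite /A; case: ifP.
have -> : slab k a b = [set y | forall k', A k' (tnth y k')].
  apply/seteqP; split => s; rewrite /slab/A/= => h.
    by move=> k'; case: eqP => [->|//]; rewrite /= in_itv.
  by have := h k; rewrite eqxx/= in_itv.
rewrite uniform_cube_box// (bigD1 k)//= big1 ?mule1; last first.
  by move=> k' /negbTE k'k; rewrite /A k'k probability_setT.
rewrite {1}/A eqxx (le_trans (uniform_prob_itv_le _))//.
  by rewrite ge_min le_max lexx.
rewrite lee_fin; case: (leP a b) => ab.
  by rewrite distrC ger0_norm ?subr_ge0.
by rewrite gtr0_norm ?subr_gt0.
Qed.

(** A point of exactly one of the two sets violates a constraint of the other in some coordinate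
    [k], hence lies in the slab between [x_k] and [y_k]. *)
Lemma cdist_lipschitz c x y :
  cdist (c, x) (c, y) <= \sum_(k < d) `|tnth x k - tnth y k|.
Proof.
apply: (@le_trans _ _ (cprob (\big[setU/set0]_(k < d) slab k (tnth x k) (tnth y k)))).
  apply: le_cprob => //.
    by apply: bigsetU_measurable => k _; exact: measurable_slab.
  have half (u v : d.-tuple R) s : cset (c, u) s -> ~ cset (c, v) s ->
      exists k, slab k (tnth u k) (tnth v k) s.
    move=> [us uc] nv; apply: contrapT => /forallNP h; apply: nv; split => // k.
    have := uc k; have := h k; rewrite /slab/=; case: (c k) => h1 h2.
      rewrite leNgt; apply/negP => sv; apply: h1.
      by rewrite ge_min h2 le_max (ltW sv) orbT.
    rewrite leNgt; apply/negP => sv; apply: h1.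
    by rewrite ge_min le_max h2 (ltW sv) orbT.
  move=> s sd; apply: mem_bigsetU.
  case: sd => -[h1 h2]; have [k hk] := half _ _ _ h1 h2; exists k => //.
  by move: hk; rewrite /slab/= minC maxC.
rewrite -lee_fin cprobE; last by apply: bigsetU_measurable => k _; exact: measurable_slab.
apply: (le_trans (measure_bigsetU_le _ _ _)); first by move=> k; exact: measurable_slab.
rewrite -sumEFin; apply: lee_sum => k _.
have := cprob_slab_le k (tnth x k) (tnth y k).
by rewrite -lee_fin cprobE//; exact: measurable_slab.
Qed.

End corner_distance.
#[global] Hint Resolve measurable_cdist_set measurable_cset : core.

Section grid.
Context {R : realType} (d : nat).
Local Notation T := (corner d * d.-tuple R)%type.
Implicit Types (j l q : T) (c : corner d) (m : nat).

(** Corners are stored as finite functions, so that the index type is finite and can carry union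
    bounds and finite sums. *)
Definition grid_index m : finType :=
  ({ffun 'I_d -> bool} * {ffun 'I_d -> 'I_(4 ^ m).+1})%type.

Definition grid_node m (p : grid_index m) : T :=
  ((fun k => p.1 k), [tuple (p.2 k)%:R / (4 ^ m)%:R | k < d]).

Lemma card_grid_index m : (#|grid_index m| <= 4 ^ (d * m.+1))%N.
Proof.
rewrite card_prod !card_ffun !card_ord card_bool -expnMn (mulnC d) expnM.
have h : (2 * (4 ^ m).+1 <= 4 ^ m.+1)%N by rewrite expnS; have := expn_gt0 4 m; lia.
by case: (posnP d) => [->//|d0]; rewrite leq_exp2r.
Qed.

Lemma grid_node_unit_cube m (p : grid_index m) : corner_index d (grid_node p).
Proof.
move=> k; rewrite tnth_mktuple/= divr_ge0 ?ler0n//= ler_pdivrMr ?ltr0n ?expn_gt0//.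
by rewrite mul1r ler_nat -ltnS ltn_ord.
Qed.

(** The successor of the truncation serves as a ceiling, one too large at grid points; the cap
    [4 ^ m] keeps the nodes in the unit cube. *)
Definition round_down m (u : R) : nat := minn (Num.truncn ((4 ^ m)%:R * u)) (4 ^ m).
Definition round_up m (u : R) : nat := minn (Num.truncn ((4 ^ m)%:R * u)).+1 (4 ^ m).

Lemma round_downP m (u : R) : 0 <= u <= 1 ->
  (round_down m u)%:R / (4 ^ m)%:R <= u.
Proof.
move=> /andP[u0 u1]; rewrite ler_pdivrMr ?ltr0n ?expn_gt0// mulrC.
rewrite (le_trans (_ : _ <= (Num.truncn ((4 ^ m)%:R * u))%:R))//.
  by rewrite ler_nat geq_minl.
by rewrite truncn_le// mulr_ge0.
Qed.

Lemma round_upP m (u : R) : 0 <= u <= 1 ->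
  u <= (round_up m u)%:R / (4 ^ m)%:R.
Proof.
move=> /andP[u0 u1]; rewrite ler_pdivlMr ?ltr0n ?expn_gt0// mulrC.
rewrite /round_up; case: leqP => _; first by rewrite ltW// truncnS_gt.
by rewrite ler_piMr.
Qed.

Lemma round_up_down m (u : R) :
  0 <= ((round_up m u)%:R - (round_down m u)%:R : R) <= 1.
Proof.
have /andP[h1 h2] : (round_down m u <= round_up m u <= (round_down m u).+1)%N.
  by rewrite /round_up /round_down; lia.
by rewrite subr_ge0 ler_nat h1/= lerBlDr addrC natr1 ler_nat.
Qed.

Lemma round_lt m (u : R) b :
  ((if b then round_up m u else round_down m u) < (4 ^ m).+1)%N.
Proof. by rewrite ltnS; case: b; rewrite geq_minr. Qed.

(** A lower constraint tightens as its threshold grows, an upper one as it falls; hence the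
    direction depends on [j.1 k == e]. *)
Definition round_index m (e : bool) j : grid_index m :=
  ([ffun k => j.1 k],
   [ffun k => Ordinal (round_lt m (tnth j.2 k) (j.1 k == e))]).

(* Rounding every coordinate so that the corner set shrinks ([lower]), resp. grows ([upper]). *)
Definition lower m j : T := grid_node (round_index m true j).
Definition upper m j : T := grid_node (round_index m false j).

Lemma grid_node_round m e j : grid_node (round_index m e j) =
  (j.1, [tuple (if j.1 k == e then round_up m (tnth j.2 k)
                else round_down m (tnth j.2 k))%:R / (4 ^ m)%:R | k < d]).
Proof.
rewrite /grid_node/=; congr pair; first by apply/funext => k; rewrite ffunE.
by apply: eq_from_tnth => k; rewrite !tnth_mktuple ffunE.
Qed.

Lemma lower_sub m j : corner_index d j -> cset (lower m j) `<=` cset j.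
Proof.
move=> Dj s; rewrite /lower grid_node_round => -[us h]; split => // k.
have := h k; rewrite /= tnth_mktuple; case: (j.1 k) => /= hk.
  by apply: le_trans hk; apply: round_upP; exact: Dj.
by apply: (le_trans hk); apply: round_downP; exact: Dj.
Qed.

Lemma sub_upper m j : corner_index d j -> cset j `<=` cset (upper m j).
Proof.
move=> Dj s; rewrite /upper grid_node_round => -[us h]; split => // k.
have := h k; rewrite /= tnth_mktuple; case: (j.1 k) => /= hk.
  by apply: le_trans hk; apply: round_downP; exact: Dj.
by apply: (le_trans hk); apply: round_upP; exact: Dj.
Qed.

Lemma lower_index m j : corner_index d (lower m j).
Proof. exact: grid_node_unit_cube. Qed.

(** A bracket is covered by [d] slabs of width 4^-m, one for each coordinate. *)
Definition mesh m : R := d%:R / (4 ^ m)%:R.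

Lemma cdist_lower_upper m j : corner_index d j ->
  cdist (lower m j) (upper m j) <= mesh m.
Proof.
move=> Dj; rewrite /lower /upper !grid_node_round.
apply: (le_trans (cdist_lipschitz _ _ _)).
rewrite /mesh [leRHS](_ : _ = \sum_(k < d) (4 ^ m)%:R^-1); last first.
  by rewrite sumr_const card_ord mulr_natl.
apply: ler_sum => k _; rewrite !tnth_mktuple -mulrBl normrM.
rewrite [X in _ * X]ger0_norm ?invr_ge0 ?ler0n// ler_piMl ?invr_ge0 ?ler0n//.
have /andP[h1 h2] := round_up_down m (tnth j.2 k).
by case: (j.1 k) => /=; [|rewrite distrC]; rewrite ger0_norm.
Qed.

Lemma cdist_lower m j : corner_index d j -> cdist (lower m j) j <= mesh m.
Proof.
move=> Dj; apply: le_trans (cdist_lower_upper m Dj).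
apply: le_cprob; [exact: measurable_cdist_set|exact: measurable_cdist_set|].
move=> s [[ls js]|[js ls]]; first by exfalso; apply: js; exact: (lower_sub Dj ls).
by right; split => //; exact: sub_upper.
Qed.

Lemma mesh_gt0 m : (0 < d)%N -> 0 < mesh m.
Proof. by move=> d0; rewrite divr_gt0 ?ltr0n ?expn_gt0. Qed.

Lemma meshS m : mesh m.+1 = mesh m / 4.
Proof. by rewrite /mesh expnS natrM invfM mulrA mulrAC. Qed.

End grid.

(** * Chaining along the grids *)

Section chaining.
Context {R : realType} (d : nat) (hd : (0 < d)%N).
Local Notation T := (corner d * d.-tuple R)%type.
Implicit Types (j l q : T) (m : nat).

(** The square root of [16 * mesh d m]. With the 16, the exponent per observation, 1 / (scale * sqrt
    n), is at most 1/4 while 4^m <= n, as [empirical_mgf_bound] requires. *)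
Definition chain_scale m : R := 4 * Num.sqrt d%:R / 2 ^+ m.
(* The ratio of the step to the scale grows like (3/2)^m, at least linearly, and the
   constant [ln (2 * 16 ^+ d)] makes the tail beat the number of pairs of level m. *)
Definition chain_step m : R :=
  8 * Num.sqrt d%:R * ln (2 * 16 ^+ d) * (3 / 4) ^+ m.

Let sd0 : 0 < Num.sqrt (d%:R : R).
Proof. by rewrite sqrtr_gt0 ltr0n. Qed.

Lemma chain_scale_gt0 m : 0 < chain_scale m.
Proof. by rewrite divr_gt0 ?exprn_gt0// mulr_gt0. Qed.

Lemma chain_scale_sqr m : chain_scale m ^+ 2 = 16 * mesh d m.
Proof.
have h2 : (2 : R) ^+ 2 = 4 by rewrite -natrX.
have h4 : (4 : R) ^+ 2 = 16 by rewrite -natrX.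
rewrite /chain_scale /mesh expr_div_n exprMn sqr_sqrtr ?ler0n// h4.
by rewrite -exprM mulnC exprM h2 natrX mulrA.
Qed.

Let ln_ge0' : 0 <= ln (2 * 16 ^+ d : R).
Proof.
rewrite ln_ge0// mulr_ege1 ?ler1n// exprn_ege1// ler1n//.
Qed.

Lemma chain_step_ge0 m : 0 <= chain_step m.
Proof. by rewrite !mulr_ge0// ?sqrtr_ge0// exprn_ge0. Qed.

(** Makes sums of steps telescope; 4 is 1 / (1 - 3/4). *)
Lemma chain_stepS m : chain_step m = 4 * (chain_step m - chain_step m.+1).
Proof. by rewrite /chain_step exprS; field. Qed.

Lemma cvg_chain_step : chain_step m @[m --> \oo] --> (0 : R).
Proof.
rewrite -[X in _ --> X](mulr0 (8 * Num.sqrt d%:R * ln (2 * 16 ^+ d))).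
apply: cvgMr; apply: cvg_expr; rewrite ger0_norm//; lra.
Qed.

Lemma chain_rate m :
  expR (- (chain_step m / chain_scale m)) <= ((2 * 16 ^+ d) ^+ m.+2)^-1.
Proof.
have sd := lt0r_neq0 sd0.
set L := ln (2 * 16 ^+ d : R).
have -> : chain_step m / chain_scale m = 2 * L * (3 / 2) ^+ m.
  rewrite /chain_step /chain_scale -/L.
  have -> : (3 / 4 : R) ^+ m = (3 / 2) ^+ m / 2 ^+ m.
    by rewrite -exprVn -exprMn; congr (_ ^+ _); field.
  have p2 : (2 : R) ^+ m != 0 by rewrite expf_neq0.
  by field; rewrite sd p2.
(* Multiplied by [2 * L], Bernoulli's bound yields exactly the exponent [L * m.+2]. *)
have bern : 1 + m%:R / 2 <= (3 / 2 : R) ^+ m.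
  elim: m => [|m IH]; first by rewrite mul0r addr0 expr0.
  have : 0 <= (m%:R : R) by rewrite ler0n.
  by rewrite exprS -natr1; nra.
have -> : ((2 * 16 ^+ d) ^+ m.+2)^-1 = expR (- (L * m.+2%:R)).
  rewrite expRN; congr _^-1; rewrite [L * _]mulrC expRM_natl lnK// posrE.
  by rewrite mulr_gt0// exprn_gt0.
rewrite ler_expR lerN2 -addn2 natrD.
have := ln_ge0'; rewrite -/L; nra.
Qed.

(** Two consecutive levels together, so that one event controls both the passage to the next level
    and the comparison of neighbours within a level. *)
Definition pair_index m : finType := (@grid_index d m + @grid_index d m.+1)%type.

Definition pair_node m (p : pair_index m) : T :=
  match p with inl a => grid_node a | inr a => grid_node a end.

Lemma card_pair_index m : (#|pair_index m| <= 2 * 4 ^ (d * m.+2))%N.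
Proof.
rewrite card_sum mul2n -addnn leq_add ?card_grid_index//.
by rewrite (leq_trans (card_grid_index _ _))// leq_pexp2l// leq_mul2l leqnSn orbT.
Qed.

Lemma pair_node_index m (p : pair_index m) : corner_index d (pair_node p).
Proof. by case: p => a; exact: grid_node_unit_cube. Qed.

Context dO (Omega : measurableType dO) (Q : probability Omega R) (Z : T -> Omega -> R).
Hypothesis mZ : forall q, corner_index d q -> measurable_fun [set: Omega] (Z q).

(** The factor 3 leaves room for two roundings and one distance, each up to a mesh
    ([good_lower_close]). The level is a parameter because for [Z_n] the bound holds only while 4^m
    <= n. *)
Definition level_tail (C : R) m := forall q q', corner_index d q ->
  corner_index d q' -> cdist q q' <= 3 * mesh d m -> forall lambda : R,
  (Q [set w | lambda < `|Z q w - Z q' w|]%R <=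
   (2 * C * expR (- (lambda / chain_scale m)))%:E)%E.

Definition bad_pair m (p : pair_index m * pair_index m) : set Omega :=
  if cdist (pair_node p.1) (pair_node p.2) <= 3 * mesh d m
  then [set w | chain_step m < `|Z (pair_node p.1) w - Z (pair_node p.2) w|]
  else set0.

Definition bad m : set Omega :=
  \big[setU/set0]_(p : pair_index m * pair_index m) bad_pair p.

Lemma measurable_bad_pair m (p : pair_index m * pair_index m) :
  measurable (bad_pair p).
Proof.
rewrite /bad_pair; case: ifP => // _; apply: measurable_set_gt.
apply: measurableT_comp => //; apply: measurable_funB; apply: mZ;
  exact: pair_node_index.
Qed.

Lemma measurable_bad m : measurable (bad m).
Proof. by apply: bigsetU_measurable => p _; exact: measurable_bad_pair. Qed.

(** There are at most 4 * 16^(d (m + 2)) pairs; in the bound of [chain_rate] the powers of 16 cancel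
    this number and the powers of 2 remain. *)
Lemma bad_prob (C : R) m : 0 <= C -> level_tail C m ->
  (Q (bad m) <= (2 * C / 2 ^+ m)%:E)%E.
Proof.
move=> C0 tail; apply: (le_trans (measure_bigsetU_le _ _ _)).
  exact: measurable_bad_pair.
set b := (2 * C * expR (- (chain_step m / chain_scale m))).
have b0 : 0 <= b by rewrite !mulr_ge0// expR_ge0.
apply: (@le_trans _ _ (\sum_(p : pair_index m * pair_index m) b%:E)%E).
  apply: lee_sum => p _; rewrite /bad_pair; case: ifP => // h.
    by apply: tail => //; exact: pair_node_index.
  by rewrite measure0 lee_fin.
rewrite sumEFin lee_fin sumr_const card_prod -[b *+ _]mulr_natl.
have cN : (#|pair_index m| * #|pair_index m| <= 4 * 16 ^ (d * m.+2))%N.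
  rewrite (leq_trans (leq_mul (card_pair_index m) (card_pair_index m)))//.
  by rewrite mulnACA -expnMn.
apply: (@le_trans _ _ ((4 * 16 ^ (d * m.+2))%:R * (2 * C * ((2 * 16 ^+ d) ^+ m.+2)^-1))).
  apply: ler_pM => //; first by rewrite ler_nat.
  by rewrite ler_wpM2l ?mulr_ge0// chain_rate.
rewrite natrM natrX exprM exprMn.
set x := (16 ^+ d) ^+ m.+2; have x0 : x != 0 by rewrite expf_neq0// expf_neq0.
rewrite (exprS 2 m.+1) (exprS 2 m).
have y0 : (2 : R) ^+ m != 0 by rewrite expf_neq0.
rewrite le_eqVlt; apply/orP; left; apply/eqP; field.
by rewrite x0 y0.
Qed.

Section good_event.
Variable w : Omega.

Lemma good_pair m (a b : pair_index m) : ~ bad m w ->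
  cdist (pair_node a) (pair_node b) <= 3 * mesh d m ->
  `|Z (pair_node a) w - Z (pair_node b) w| <= chain_step m.
Proof.
move=> gw ab; rewrite leNgt; apply/negP => h; apply: gw; apply: mem_bigsetU.
by exists (a, b); rewrite ?mem_index_enum// /bad_pair ab.
Qed.

Lemma good_lowerS m j : corner_index d j -> ~ bad m w ->
  `|Z (lower m.+1 j) w - Z (lower m j) w| <= chain_step m.
Proof.
move=> Dj gw.
apply: (@good_pair m (inr (round_index m.+1 true j)) (inl (round_index m true j)) gw).
rewrite -/(lower _ _) -/(lower _ _) (le_trans (cdist_triangle j _ _))//.
have h1 := cdist_lower m Dj; have h2 := cdist_lower m.+1 Dj.
rewrite meshS in h2; rewrite cdistC in h1; have := mesh_gt0 (R := R) m hd.
by lra.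
Qed.

Lemma good_lower_telescope m0 n j : corner_index d j ->
  (forall m, (m0 <= m < m0 + n)%N -> ~ bad m w) ->
  `|Z (lower (m0 + n) j) w - Z (lower m0 j) w| <=
    4 * (chain_step m0 - chain_step (m0 + n)).
Proof.
move=> Dj; elim: n => [|n IH] gw.
  by rewrite addn0 !subrr normr0 mulr0.
have h1 := IH (fun m hm => gw m ltac:(lia)).
have h2 := good_lowerS Dj (gw (m0 + n)%N ltac:(lia)).
rewrite addnS -(subrKA (Z (lower (m0 + n) j) w)).
rewrite (le_trans (ler_normD _ _))// (le_trans (lerD h2 h1))//.
by rewrite [X in X + _]chain_stepS; lra.
Qed.

Lemma good_lower_close m j l : corner_index d j -> corner_index d l ->
  cdist j l <= mesh d m -> ~ bad m w ->
  `|Z (lower m j) w - Z (lower m l) w| <= chain_step m.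
Proof.
move=> Dj Dl jl gw.
apply: (@good_pair m (inl (round_index m true j)) (inl (round_index m true l)) gw).
rewrite -/(lower _ _) -/(lower _ _) (le_trans (cdist_triangle j _ _))//.
have h1 := cdist_lower m Dj; have h2 := cdist_lower m Dl.
have h3 := cdist_triangle l j (lower m l); rewrite [X in _ <= _ + X]cdistC in h3.
by lra.
Qed.

Lemma good_bracket m j : corner_index d j -> ~ bad m w ->
  `|Z (lower m j) w - Z (upper m j) w| <= chain_step m.
Proof.
move=> Dj gw.
apply: (@good_pair m (inl (round_index m true j)) (inl (round_index m false j)) gw).
rewrite -/(lower _ _) -/(upper _ _) (le_trans (cdist_lower_upper m Dj))//.
by have := mesh_gt0 (R := R) m hd; lra.
Qed.

End good_event.
End chaining.

(** * Exponential moments of the empirical process *)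

Section independent_products.
Context (R : realType) (dO dT : measure_display) (Omega : measurableType dO)
  (T : measurableType dT) (P : probability Omega R) (X : nat -> {RV P >-> T})
  (mu : probability T R) (hX : iid_with_law X mu).

Definition cylinder (J : seq nat) (B : nat -> set T) : set Omega :=
  \big[setI/setT]_(i <- J) (X i @^-1` B i).

Lemma measurable_X_preimage i (B : set T) : measurable B ->
  measurable (X i @^-1` B).
Proof.
move=> mB; rewrite -[X in measurable X]setTI.
exact: (measurable_funP (X i)).
Qed.

Lemma measurable_cylinder_iid J B : (forall i, measurable (B i)) ->
  measurable (cylinder J B).
Proof.
move=> mB; rewrite /cylinder; elim: J => [|i J IH]; first by rewrite big_nil.
rewrite big_cons; apply: measurableI => //; exact: measurable_X_preimage.
Qed.

Lemma cylinder_prob J B : uniq J -> (forall i, measurable (B i)) ->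
  P (cylinder J B) = (\prod_(i <- J) mu (B i))%E.
Proof.
move=> uJ mB; have [ind law] := hX; rewrite /cylinder ind//.
by apply: eq_bigr => i _; exact: law.
Qed.

Variables (I : finType) (S : I -> set T) (G : I -> R).
Hypothesis mS : forall b, measurable (S b).
Hypothesis G0 : forall b, 0 <= G b.

(** For a simple function the expectation of a product reduces to probabilities of cylinders, which
    is the form in which independence is given. *)
Definition simple_comb (y : T) : R := \sum_b G b * \1_(S b) y.

Lemma simple_comb_ge0 y : 0 <= simple_comb y.
Proof. by apply: sumr_ge0 => b _; rewrite mulr_ge0. Qed.

Lemma measurable_simple_comb i : measurable_fun [set: Omega] (fun w => simple_comb (X i w)).
Proof.
apply: measurable_sum => b; apply: measurable_funM => //.
exact: (measurableT_comp (measurable_indic (mS b)) (measurable_funP (X i))).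
Qed.

(** One factor is expanded at a time: its index passes from [J] to [J'], where the set [S b] becomes
    a constraint. The cylinder in the statement carries this induction. *)
Lemma integral_independent_prod J J' B : uniq (J ++ J') ->
  (forall i, measurable (B i)) ->
  (\int[P]_w (\1_(cylinder J' B) w * \prod_(i <- J) simple_comb (X i w))%:E =
   ((\sum_b G b * fine (mu (S b))) ^+ size J)%:E * P (cylinder J' B))%E.
Proof.
elim: J J' B => [|k J IH] J' B uJ mB.
  rewrite expr0 mul1e.
  under eq_integral do rewrite big_nil mulr1.
  by rewrite integral_indic ?setIT//; exact: measurable_cylinder_iid.
move: uJ; rewrite cat_cons cons_uniq mem_cat negb_or => /andP[/andP[kJ kJ'] uJ].
have uJ' : uniq J' by move: uJ; rewrite cat_uniq => /and3P[].
have ukJ' : uniq (k :: J') by rewrite /= kJ' uJ'.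
have uJk : uniq (J ++ k :: J').
  by rewrite -cat1s uniq_catCA /= cat_uniq; rewrite /= mem_cat (negbTE kJ) (negbTE kJ')
    -cat_uniq.
pose B' b i := if i == k then S b else B i.
have mB' b i : measurable (B' b i) by rewrite /B'; case: ifP.
have cylE b : cylinder (k :: J') (B' b) = X k @^-1` S b `&` cylinder J' B.
  rewrite /cylinder big_cons {1}/B' eqxx; congr (_ `&` _).
  apply: eq_big_seq => i iJ'; rewrite /B' ifF//.
  by apply/negbTE; apply: contraNneq kJ' => <-.
pose f b w := \1_(cylinder (k :: J') (B' b)) w * \prod_(i <- J) simple_comb (X i w).
have f0 b w : 0 <= f b w.
  by rewrite mulr_ge0// prodr_ge0// => i _; exact: simple_comb_ge0.
have mf b : measurable_fun [set: Omega] (f b).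
  apply: measurable_funM; first exact/measurable_indic/measurable_cylinder_iid.
  elim: (J) => [|i J0 IHJ].
    by under eq_fun do rewrite big_nil; exact: measurable_cst.
  under eq_fun do rewrite big_cons.
  by apply: measurable_funM => //; exact: measurable_simple_comb.
transitivity (\int[P]_w (\sum_b (G b * f b w)%:E))%E.
  apply: eq_integral => w _; rewrite sumEFin big_cons; congr _%:E.
  rewrite mulrCA {1}/simple_comb mulr_suml.
  apply: eq_bigr => b _; rewrite /f cylE indicI/=.
  have -> : \1_(X k @^-1` S b) w = \1_(S b) (X k w) :> R.
    by rewrite !indicE; congr (_%:R); apply/idP/idP; rewrite !in_setE.
  by rewrite !mulrA.
rewrite ge0_integral_sum//; last 2 first.
- by move=> b; apply/measurable_EFinP; exact: measurable_funM.
- by move=> b w _; rewrite lee_fin mulr_ge0.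
have fmu b : mu (S b) \is a fin_num by exact: fin_num_measure.
have fP : P (cylinder J' B) \is a fin_num.
  by apply: fin_num_measure; exact: measurable_cylinder_iid.
transitivity (\sum_b (G b * ((\sum_b G b * fine (mu (S b))) ^+ size J *
   (fine (mu (S b)) * fine (P (cylinder J' B)))))%:E)%E.
  apply: eq_bigr => b _.
  under eq_integral do rewrite EFinM.
  rewrite ge0_integralZl//; last 3 first.
  - exact/measurable_EFinP.
  - by move=> w _; rewrite lee_fin.
  - by rewrite lee_fin.
  rewrite EFinM EFinM; congr (_ * _)%E; rewrite IH//; congr (_ * _)%E.
  rewrite cylinder_prob// big_cons {1}/B' eqxx EFinM !fineK//; congr (_ * _)%E.
  rewrite cylinder_prob//; apply: eq_big_seq => i iJ'; rewrite /B' ifF//.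
  by apply/negbTE; apply: contraNneq kJ' => <-.
rewrite sumEFin -[in RHS](fineK fP) -EFinM; congr _%:E.
rewrite /= exprS -mulrA mulr_suml; apply: eq_bigr => b _.
by rewrite -!mulrA; congr (_ * _); rewrite mulrCA.
Qed.

Corollary integral_iid_prod n :
  (\int[P]_w (\prod_(i < n) simple_comb (X i w))%:E =
   ((\sum_b G b * fine (mu (S b))) ^+ n)%:E)%E.
Proof.
have := @integral_independent_prod (index_iota 0 n) [::] (fun=> setT).
rewrite cats0 iota_uniq /cylinder big_nil indicT size_iota subn0 probability_setT mule1.
move=> <- //; apply: eq_integral => w _.
by rewrite big_mkord mul1r.
Qed.

End independent_products.

Section empirical_increments.
Context (R : realType) (d : nat) (hd : (0 < d)%N) (dO : measure_display)
  (Omega : measurableType dO) (P : probability Omega R)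
  (X : nat -> {RV P >-> d.-tuple R}) (hX : iid_with_law X (uniform_cube d)).
Local Notation T := (corner d * d.-tuple R)%type.
Implicit Types (j l : T).

Let Z n j (w : Omega) : R := empirical_process (fun i => X i w) n j.

Lemma measurable_empirical n j : measurable_fun [set: Omega] (Z n j).
Proof.
rewrite /Z; under eq_fun do rewrite empirical_processE.
apply: measurable_funM => //; apply: measurable_funB => //.
apply: measurable_funM => //; apply: measurable_sum => i.
exact: (measurableT_comp (measurable_indic (measurable_cset j)) (measurable_funP (X i))).
Qed.

Section increments.
Variables j l : T.
Let A := cset j.
Let B := cset l.
Let mA : measurable A. Proof. exact: measurable_cset. Qed.
Let mB : measurable B. Proof. exact: measurable_cset. Qed.

(** The four atoms generated by [A] and [B]; the difference of indicators is constant on each, so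
    its exponential is a simple function. *)
Let S (b : bool * bool) : set (d.-tuple R) :=
  (if b.1 then A else ~` A) `&` (if b.2 then B else ~` B).

Let mS b : measurable (S b).
Proof. by apply: measurableI; case: ifP => // _; exact: measurableC. Qed.

Let p b := cprob (S b).

Lemma cprob_setUD (E F : set (d.-tuple R)) : measurable E -> measurable F ->
  cprob E = cprob (E `&` F) + cprob (E `&` ~` F).
Proof.
move=> mE mF; have mEF := measurableI _ _ mE mF.
have mEFC := measurableI _ _ mE (measurableC mF).
apply: EFin_inj; rewrite EFinD !cprobE// -measureU//.
  by rewrite -setIUr setUv setIT.
by rewrite setIACA setICr setI0.
Qed.

Let p_sum : p (true, true) + p (true, false) + (p (false, true) + p (false, false)) = 1.
Proof.
rewrite /p /S/= -!cprob_setUD//; last exact: measurableC.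
have := cprob_setUD measurableT mA; rewrite !setTI => <-.
by rewrite /cprob probability_setT.
Qed.

Let pjE : cprob A = p (true, true) + p (true, false).
Proof. by rewrite /p /S/= -cprob_setUD. Qed.

Let plE : cprob B = p (true, true) + p (false, true).
Proof. by rewrite /p /S/= ![_ `&` B]setIC -cprob_setUD. Qed.

Let rE : cdist j l = p (true, false) + p (false, true).
Proof.
rewrite /cdist /symdiff -/A -/B /p /S/= [~` A `&` B]setIC -!setDE.
have m1 : measurable (A `\` B) by exact: measurableD.
have m2 : measurable (B `\` A) by exact: measurableD.
apply: EFin_inj; rewrite EFinD !cprobE//; last exact: measurableU.
rewrite measureU// !setDE setIACA [~` B `&` ~` A]setIC setIACA setICr.
by rewrite set0I.
Qed.

Let h (y : d.-tuple R) : R := \1_A y - \1_B y.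
Let muh : R := cprob A - cprob B.
Let G u (b : bool * bool) : R := expR (u * ((b.1%:R - b.2%:R) - muh)).

Let exph u y : expR (u * (h y - muh)) = simple_comb S (G u) y.
Proof.
rewrite /simple_comb /h !indicE.
have S01 b : \1_(S b) y = ((y \in A) == b.1)%:R * ((y \in B) == b.2)%:R :> R.
  rewrite /S indicI/= !indicE; congr (_ * _); case: b => -[] [] /=;
    rewrite ?in_setC; by case: (_ \in _).
under eq_bigr do rewrite S01.
rewrite (eq_bigr (fun b : bool * bool => G u b * (((y \in A), (y \in B)) == b)%:R)).
  rewrite (bigD1 ((y \in A), (y \in B)))//= eqxx mulr1 big1 ?addr0//.
  by move=> b /negbTE; rewrite eq_sym => ->; rewrite mulr0.
by move=> -[b1 b2] _; rewrite -natrM mulnb -pair_eqE.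
Qed.

(** The centred difference is at most 2 in absolute value, so the exponent is at most 1/2 and
    [expR_le1DxD2sqr] applies. The linear term has mean 0, and the variance is at most the second
    moment [cdist j l]. *)
Lemma empirical_mgf_bound u : `|u| <= 4^-1 ->
  \sum_b G u b * fine (uniform_cube d (S b)) <= expR (2 * u ^+ 2 * cdist j l).
Proof.
move=> u4.
rewrite (eq_bigr (fun b : bool * bool => G u (b.1, b.2) * p (b.1, b.2))); last first.
  by move=> [b1 b2] _.
rewrite -(pair_bigA _ (fun b1 b2 => G u (b1, b2) * p (b1, b2)))/= !big_bool.
have p0 b : 0 <= p b by exact: cprob_ge0.
have muhE : muh = p (true, false) - p (false, true) by rewrite /muh pjE plE; ring.
apply: (@le_trans _ _ (1 + 2 * u ^+ 2 * cdist j l)); last exact: expR_ge1Dx.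
have muh1 : `|muh| <= 1.
  rewrite muhE ler_norml; have := p0 (true, true); have := p0 (false, false).
  by have := p0 (true, false); have := p0 (false, true); have := p_sum; lra.
have Gle (b1 b2 : bool) : G u (b1, b2) <=
    1 + u * ((b1%:R - b2%:R) - muh) + 2 * (u * ((b1%:R - b2%:R) - muh)) ^+ 2.
  apply: expR_le1DxD2sqr; rewrite normrM.
  have h2 : `|b1%:R - b2%:R - muh| <= 2.
    rewrite (le_trans (ler_normB _ _))// -[2]/(1 + 1) lerD//.
    by case: b1; case: b2; rewrite /= ?subrr ?subr0 ?sub0r ?normrN ?normr0 ?normr1.
  by apply: (le_trans (ler_pM (normr_ge0 _) (normr_ge0 _) u4 h2)); lra.
apply: (@le_trans _ _
  (\sum_(b1 : bool) \sum_(b2 : bool) (1 + u * ((b1%:R - b2%:R) - muh) +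
     2 * (u * ((b1%:R - b2%:R) - muh)) ^+ 2) * p (b1, b2))).
  by rewrite !big_bool; rewrite !lerD// ler_wpM2r.
rewrite !big_bool/= rE.
have -> : p (true, true) = 1 - p (true, false) - p (false, true) - p (false, false).
  by rewrite -p_sum; ring.
(* The square of the mean is the gap between second moment and variance. *)
have := sqr_ge0 (u * muh); rewrite muhE; lra.
Qed.

Lemma integral_empirical_exp n u : `|u| <= 4^-1 ->
  (\int[P]_w (expR (u * \sum_(i < n) (h (X i w) - muh)))%:E <=
   (expR (2 * u ^+ 2 * cdist j l *+ n))%:E)%E.
Proof.
move=> u4.
rewrite (_ : (\int[P]_w _)%E =
    (\int[P]_w (\prod_(i < n) simple_comb S (G u) (X i w))%:E)%E); last first.
  apply: eq_integral => w _; congr _%:E; rewrite mulr_sumr expR_sum.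
  by apply: eq_bigr => i _; rewrite exph.
rewrite (integral_iid_prod hX mS)//; last by move=> b; exact: expR_ge0.
rewrite lee_fin -mulr_natl expRM_natl lerXn2r ?nnegrE ?expR_ge0//.
  by apply: sumr_ge0 => b _; rewrite mulr_ge0 ?expR_ge0// fine_ge0.
exact: empirical_mgf_bound.
Qed.

Lemma empirical_increment n w : (0 < n)%N ->
  Z n j w - Z n l w = (Num.sqrt n%:R)^-1 * \sum_(i < n) (h (X i w) - muh).
Proof.
move=> n0; rewrite /Z !empirical_processE -mulrBr -/A -/B.
rewrite sumrB sumr_const card_ord /h sumrB /muh.
have nn : (n%:R : R) != 0 by rewrite pnatr_eq0 -lt0n.
have sn : Num.sqrt (n%:R : R) != 0 by rewrite gt_eqF// sqrtr_gt0 ltr0n.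
apply: (mulfI sn); rewrite mulVKf// mulrA -expr2 sqr_sqrtr ?ler0n//.
by rewrite -mulr_natl; field.
Qed.

End increments.

(** While 4^m <= n the number [mesh d m * n] is at least 1, which keeps [u] within 1/4; the exponent
    then reduces to [cdist j l / (8 * mesh d m)], at most 3/8. *)
Lemma empirical_level_tail n m : (4 ^ m <= n)%N -> level_tail P (Z n) (expR 1) m.
Proof.
move=> mn j l Dj Dl jl lambda.
have n0 : (0 < n)%N by rewrite (leq_trans _ mn)// expn_gt0.
have sn : 0 < Num.sqrt (n%:R : R) by rewrite sqrtr_gt0 ltr0n.
have cs := chain_scale_gt0 (R := R) hd m.
(* The sign [e] treats the two tails at once. *)
have key (e : R) : e ^+ 2 = 1 ->
    (\int[P]_w (expR (e * (chain_scale d m)^-1 * (Z n j w - Z n l w)))%:E <= (expR 1)%:E)%E.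
  move=> e1; under eq_integral do rewrite empirical_increment// mulrA.
  set u := _ / _ / _.
  have u2 : u ^+ 2 = (16 * mesh d m * n%:R)^-1.
    by rewrite /u !exprMn e1 mul1r !exprVn chain_scale_sqr sqr_sqrtr ?ler0n// -invfM.
  have mesh1 : 1 <= mesh d m * n%:R :> R.
    rewrite /mesh mulrAC ler_pdivlMr ?ltr0n ?expn_gt0// mul1r -natrM ler_nat.
    by rewrite (leq_trans mn)// leq_pmull.
  have u16 : u ^+ 2 <= 16^-1.
    by rewrite u2 -mulrA invfM ler_piMr// invf_le1// (lt_le_trans ltr01).
  apply: (le_trans (integral_empirical_exp j l n _)).
    rewrite -(@ler_sqr _ `|u|) ?nnegrE// real_normK ?num_real//.
    by rewrite (le_trans u16)//; lra.
  rewrite lee_fin ler_expR -mulr_natr u2.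
  have N0 : (n%:R : R) != 0 by rewrite pnatr_eq0 -lt0n.
  have M0 := mesh_gt0 (R := R) m hd.
  have -> : 2 * (16 * mesh d m * n%:R)^-1 * cdist j l * n%:R = cdist j l / (8 * mesh d m).
    by field; rewrite N0 gt_eqF.
  have M8 : 0 < 8 * mesh d m :> R by lra.
  have jl8 : cdist j l <= 1 * (8 * mesh d m) by lra.
  by rewrite (ler_pdivrMr _ _ M8); exact: jl8.
apply: (exponential_tail (X := fun w => Z n j w - Z n l w) (C := expR 1) lambda cs).
- by apply: measurable_funB; exact: measurable_empirical.
- rewrite -[(chain_scale d m)^-1]mul1r; apply: key; exact: expr1n.
- rewrite -[- (chain_scale d m)^-1]mulN1r; apply: key.
  by rewrite sqrrN expr1n.
Qed.

End empirical_increments.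

(** * Asymptotic equicontinuity *)

Lemma limn_esup_le_near {R : realType} (u : nat -> \bar R) (b : \bar R) N :
  (forall n, (N <= n)%N -> (u n <= b)%E) -> (limn_esup u <= b)%E.
Proof.
move=> ub; apply: (@le_trans _ _ (ereal_sup (u @` [set n | (N <= n)%N]))).
  by apply: ereal_inf_lbound => /=; exists [set n | (N <= n)%N] => //; exists N.
by apply: ge_ereal_sup => _ [n Nn <-]; exact: ub.
Qed.

Lemma limn_esup_ge0 {R : realType} (u : nat -> \bar R) :
  (forall n, (0 <= u n)%E) -> (0 <= limn_esup u)%E.
Proof.
move=> u0; apply: le_ereal_inf_tmp => _ [V [N _ NV] <-].
by apply: (le_trans (u0 N)); apply: ereal_sup_ubound; exists N => //; apply: NV => /=.
Qed.

Lemma sum_inv_exp2_le {R : realFieldType} (m0 n : nat) :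
  \sum_(m0 <= m < m0 + n) (2 ^+ m)^-1 <= 2 / 2 ^+ m0 :> R.
Proof.
suff -> : \sum_(m0 <= m < m0 + n) (2 ^+ m)^-1 = 2 / 2 ^+ m0 - 2 / 2 ^+ (m0 + n) :> R.
  by rewrite lerBlDr lerDl divr_ge0// exprn_ge0.
elim: n => [|n IH]; first by rewrite addn0 big_geq// subrr.
rewrite addnS big_nat_recr ?leq_addr//= IH exprS.
have h k : (2 : R) ^+ k != 0 by rewrite expf_neq0.
by field; rewrite !h.
Qed.

Lemma dist3_le {R : realDomainType} (b c a e x y z : R) :
  `|a - b| <= x -> `|b - c| <= y -> `|c - e| <= z -> `|a - e| <= x + y + z.
Proof.
move=> h1 h2 h3; rewrite (le_trans (ler_distD b _ _))// -addrA lerD//.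
by rewrite (le_trans (ler_distD c _ _))// lerD.
Qed.

Lemma chaining_arith {R : realFieldType} (x y z : R) : 0 <= x -> 0 <= y ->
  (z + 4 * y + (x - 4 * x)) + y + (z + 4 * y + (x - 4 * x)) <= 11 * y + 2 * z.
Proof. by lra. Qed.

Lemma mesh_arith {R : realFieldType} (x y z : R) : x <= 4 * z -> 0 <= y ->
  2 * x * y <= 8 * y * z.
Proof. by move=> xz y0; nra. Qed.

Section asymptotic_equicontinuity.
Context (R : realType) (d : nat) (hd : (0 < d)%N) (dO : measure_display)
  (Omega : measurableType dO) (P : probability Omega R)
  (X : nat -> {RV P >-> d.-tuple R}) (hX : iid_with_law X (uniform_cube d)).
Local Notation T := (corner d * d.-tuple R)%type.

Let Z n (j : T) (w : Omega) : R := empirical_process (fun i => X i w) n j.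

(* [P_n] is monotone and [P0] moves by at most the mesh, so the increment of [Z_n]
   inside a bracket is controlled by its increment across the bracket. *)
Lemma empirical_bracket n m (j : T) w : corner_index d j ->
  `|Z n j w - Z n (lower m j) w| <=
  `|Z n (lower m j) w - Z n (upper m j) w| + Num.sqrt n%:R * mesh d m.
Proof.
move=> Dj; rewrite /Z !empirical_processE.
set sn := Num.sqrt _; have sn0 : 0 <= sn by exact: sqrtr_ge0.
pose a (q : T) := n%:R^-1 * \sum_(i < n) \1_(cset q) (X i w) : R.
have amono q q' : cset q `<=` cset q' -> a q <= a q'.
  move=> qq'; rewrite /a ler_wpM2l ?invr_ge0//; apply: ler_sum => i _.
  rewrite !indicE; have [iq|iq] := boolP (_ \in cset q); last by rewrite ler0n.
  by rewrite (mem_set (qq' _ (set_mem iq))).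
have h1 := amono _ _ (@lower_sub _ _ m _ Dj); have h2 := amono _ _ (@sub_upper _ _ m _ Dj).
have p1 : cprob (cset (lower m j)) <= cprob (cset j).
  by apply: le_cprob; [exact: measurable_cset..|exact: lower_sub].
have p2 : cprob (cset j) <= cprob (cset (upper m j)).
  by apply: le_cprob; [exact: measurable_cset..|exact: sub_upper].
have p3 : cprob (cset (upper m j)) <= cprob (cset (lower m j)) + mesh d m.
  apply: (@le_trans _ _ (cprob (cset (lower m j) `|` symdiff (cset (lower m j)) (cset (upper m j))))).
    have mC q : measurable (cset q : set (d.-tuple R)) by exact: measurable_cset.
    apply: le_cprob => //; first by apply: measurableU => //; exact: measurable_symdiff.
    move=> s us; have [ls|ls] := pselect (cset (lower m j) s); first by left.
    by right; right.
  apply: (le_trans (cprobU_le _ _)); [exact: measurable_cset|exact: measurable_cdist_set|].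
  by rewrite lerD2l; exact: cdist_lower_upper.
rewrite -!/(a _) -!mulrBr !normrM (ger0_norm sn0) -mulrDr ler_wpM2l//.
have := ler_norm (- (a (lower m j) - cprob (cset (lower m j)) -
  (a (upper m j) - cprob (cset (upper m j))))).
rewrite normrN => h; rewrite ler_norml.
have := normr_ge0 (a (lower m j) - cprob (cset (lower m j)) -
  (a (upper m j) - cprob (cset (upper m j)))).
by move=> h0; apply/andP; split; lra.
Qed.

(** The path goes from [j] to its lower approximation at level [M] by bracketing, down to level [m0]
    by telescoping, across to [l] there, and back up. *)
Lemma good_empirical_increment n m0 M w (j l : T) :
  (m0 <= M)%N -> (forall m, (m0 <= m <= M)%N -> ~ bad (Z n) m w) ->
  corner_index d j -> corner_index d l -> cdist j l <= mesh d m0 ->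
  `|Z n j w - Z n l w| <= 11 * chain_step d m0 + 2 * (Num.sqrt n%:R * mesh d M).
Proof.
move=> m0M gw Dj Dl jl.
have gM : ~ bad (Z n) M w by apply: gw; rewrite m0M leqnn.
have step q : corner_index d q ->
    (* The step of the last bracket is absorbed by the negative end term of the telescoping sum. *)
    `|Z n q w - Z n (lower m0 q) w| <= Num.sqrt n%:R * mesh d M + 4 * chain_step d m0
      + (chain_step d M - 4 * chain_step d M).
  move=> Dq; have h1 := empirical_bracket n M w Dq.
  have h2 := good_bracket hd Dq gM.
  have := @good_lower_telescope _ _ hd _ _ (Z n) w m0 (M - m0) q Dq.
  rewrite subnKC// => h3.
  have {}h3 := h3 (fun m hm => gw m ltac:(lia)).
  rewrite (le_trans (ler_distD (Z n (lower M q) w) _ _))//.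
  rewrite (le_trans (lerD (le_trans h1 (lerD h2 (lexx _))) h3))//.
  move: (chain_step _ _) (chain_step _ _) (_ * mesh _ _) => x y z.
  by rewrite le_eqVlt; apply/orP; left; apply/eqP; ring.
have h1 := step _ Dj; have h2 := step _ Dl.
have h3 := good_lower_close Dj Dl jl (gw m0 ltac:(lia)).
have c0 := chain_step_ge0 (R := R) d M; have c1 := chain_step_ge0 (R := R) d m0.
rewrite distrC in h2; apply: (le_trans (dist3_le h1 h3 h2)).
exact: chaining_arith.
Qed.

Lemma bad_union_prob n m0 M : (4 ^ M <= n)%N -> (m0 <= M)%N ->
  (P (\big[setU/set0]_(m0 <= m < M.+1) bad (Z n) m) <= (4 * expR 1 / 2 ^+ m0)%:E)%E.
Proof.
move=> Mn m0M.
have mb m : measurable (bad (Z n) m).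
  by apply: measurable_bad => q _; exact: measurable_empirical.
apply: (le_trans (measure_bigsetU_le _ _ mb)).
apply: (@le_trans _ _ (\sum_(m0 <= m < M.+1) (2 * expR 1 / 2 ^+ m)%:E)%E).
  rewrite !big_seq; apply: lee_sum => m; rewrite mem_index_iota ltnS => /andP[_ mM].
  apply: bad_prob => //.
  - by move=> q _; exact: measurable_empirical.
  - apply: empirical_level_tail => //; apply: leq_trans Mn.
    by rewrite leq_pexp2l.
rewrite sumEFin lee_fin -mulr_sumr.
have -> : M.+1 = (m0 + (M.+1 - m0))%N by lia.
apply: (le_trans (ler_wpM2l _ (sum_inv_exp2_le _ _))); first by rewrite mulr_ge0// expR_ge0.
by rewrite le_eqVlt; apply/orP; left; apply/eqP; rewrite mulrACA mulrCA !mulrA; ring.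
Qed.

(** The level [m0] is fixed first, from [eps] and [eta]; it determines how small [delta] must be.
    Only the last level [M] grows with [n]. *)
Lemma asymptotic_equicontinuity (eps : R) : 0 < eps ->
  (fun delta : R => limn_esup (fun n : nat =>
    (P^*)%mu [set w : Omega |
      (eps%:E < oscillation (corner_index d) (@rho R d) delta
        (empirical_process (fun i => X i w) n))%E])) @ 0^'+ --> 0%E.
Proof.
move=> eps0.
set F := (F in F @ _ --> _).
have F0 delta : (0 <= F delta)%E by apply: limn_esup_ge0 => n; exact: mu_ext_ge0.
suff main : forall eta : R, 0 < eta -> \forall delta \near 0^'+, (F delta <= eta%:E)%E.
  apply/fine_cvgP; split.
    apply: filterS (main 1 ltr01) => delta F1.
    by rewrite ge0_fin_numE// (le_lt_trans F1)// ltry.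
  apply/cvgrPdist_le => eta eta0; apply: filterS (main eta eta0) => delta Fd.
  rewrite sub0r normrN /= ger0_norm ?fine_ge0// -lee_fin fineK//.
  by rewrite ge0_fin_numE// (le_lt_trans Fd)// ltry.
move=> eta eta0.
have [m0 [m0eps m0eta]] : exists m0, 11 * chain_step d m0 <= eps / 2 /\
    4 * expR 1 / 2 ^+ m0 <= eta :> R.
  have c1 : \forall m \near \oo, chain_step d m < eps / 22 :> R.
    by apply: (cvgr_lt _ (@cvg_chain_step R d)); rewrite divr_gt0.
  have c2 : \forall m \near \oo, 4 * expR 1 * 2^-1 ^+ m < eta :> R.
    have h : 4 * expR 1 * (2^-1 : R) ^+ m @[m --> \oo] --> 4 * expR 1 * 0.
      by apply: cvgMr; apply: cvg_expr; rewrite ger0_norm// invf_lt1// ltr1n.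
    by apply: (cvgr_lt _ h); rewrite mulr0.
  near \oo => m0; exists m0; split.
    have : chain_step d m0 < eps / 22 :> R by near: m0.
    by lra.
  by rewrite -exprVn ltW//; near: m0.
have M0 := mesh_gt0 (R := R) m0 hd.
near=> delta.
have dm : delta < Num.sqrt (mesh d m0).
  by near: delta; apply: nbhs_right_lt; rewrite sqrtr_gt0.
have [N [N1 N2]] : exists N, (4 ^ m0 <= N)%N /\ forall n, (N <= n)%N ->
    8 * d%:R / Num.sqrt n%:R <= eps / 2 :> R.
  (* From [x <= n] follows [16 * d / eps <= sqrt n], which is the claim. *)
  pose x := (16 * d%:R / eps) ^+ 2 : R.
  exists (maxn (4 ^ m0) (Num.bound x)); split; first by rewrite leq_maxl.
  move=> n nN; have xn : x <= n%:R.
    rewrite (le_trans (ltW (archi_boundP _)))// ?ler_nat ?(leq_trans _ nN)// ?leq_maxr//.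
    exact: sqr_ge0.
  have x0 : 0 < x by rewrite exprn_gt0// divr_gt0// mulr_gt0// ltr0n.
  have sx : Num.sqrt x <= Num.sqrt n%:R by rewrite ler_wsqrtr.
  have y0 : 0 < 16 * d%:R / eps by rewrite divr_gt0// mulr_gt0// ltr0n.
  rewrite sqrtr_sqr gtr0_norm// in sx.
  have sn0 : 0 < Num.sqrt n%:R :> R by apply: lt_le_trans sx.
  rewrite ler_pdivrMr//.
  rewrite ler_pdivrMr// in sx.
  by lra.
apply: (limn_esup_le_near (N := N)) => n Nn.
(* The last level with exponential tails. As n < 4^(M + 1), the bracketing error is at most 8 d /
   sqrt n. *)
pose M := trunc_log 4 n.
have n0 : (0 < n)%N by rewrite (leq_trans _ Nn)// (leq_trans _ N1)// expn_gt0.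
have Mn : (4 ^ M <= n)%N by exact: trunc_logP.
have nM : (n < 4 ^ M.+1)%N by exact: trunc_log_ltn.
have m0M : (m0 <= M)%N.
  by apply: trunc_log_max => //; exact: leq_trans N1 Nn.
have sn0 : 0 < Num.sqrt n%:R :> R by rewrite sqrtr_gt0 ltr0n.
have small : 2 * (Num.sqrt n%:R * mesh d M) <= eps / 2.
  apply: le_trans (N2 _ Nn); rewrite ler_pdivlMr//.
  have -> : 2 * (Num.sqrt n%:R * mesh d M) * Num.sqrt n%:R =
      2 * Num.sqrt n%:R ^+ 2 * mesh d M :> R by ring.
  rewrite sqr_sqrtr ?ler0n// /mesh mulrA.
  have p4 : (0 : R) < (4 ^ M)%:R by rewrite ltr0n expn_gt0.
  have n4 : n%:R <= 4 * (4 ^ M)%:R :> R by rewrite -natrM ler_nat -expnS ltnW.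
  have d0 : 0 <= d%:R :> R by rewrite ler0n.
  by rewrite ler_pdivrMr//; exact: mesh_arith.
have mb m : measurable (bad (Z n) m).
  by apply: measurable_bad => q _; exact: measurable_empirical.
pose U := \big[setU/set0]_(m0 <= m < M.+1) bad (Z n) m.
have mU : measurable U by apply: bigsetU_measurable => m _.
apply: (@le_trans _ _ (P U)); last first.
  by apply: (le_trans (bad_union_prob Mn m0M)); rewrite lee_fin.
(* Monotonicity of the outer measure suffices: outside [U] the oscillation is at most [eps]. *)
rewrite -(measurable_mu_extE P mU); apply: le_mu_ext => w /= osc.
apply: contrapT => nU.
have gw m : (m0 <= m <= M)%N -> ~ bad (Z n) m w.
  move=> mM bm; apply: nU; apply: mem_bigsetU; exists m => //.
  by rewrite mem_index_iota ltnS.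
move: osc; rewrite ltNge => /negP; apply.
apply: ge_ereal_sup => _ [[j l] /= [Dj Dl jl] <-]; rewrite lee_fin.
have jl' : cdist j l <= mesh d m0.
  have rd : rho j l < Num.sqrt (mesh d m0) by apply: lt_trans jl _.
  by rewrite rho_sqrt ltr_sqrt// in rd; exact: ltW.
apply: (le_trans (good_empirical_increment m0M gw Dj Dl jl')).
by lra.
Unshelve. all: by end_near.
Qed.

End asymptotic_equicontinuity.

(** * The continuous version *)

Lemma cvg_of_tail_bound {R : realType} (u b : nat -> R) m0 :
  b m @[m --> \oo] --> (0 : R) ->
  (forall m n, (m0 <= m)%N -> `|u (m + n)%N - u m| <= b m) -> cvg (u @ \oo).
Proof.
move=> b0 ub; apply/cauchy_cvgP; apply: cauchy_exP => e e0.
have bm : \forall m \near \oo, b m < e by exact: (cvgr_lt _ b0).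
near \oo => m; exists (u m).
exists m => //= n mn; rewrite /ball/= distrC -(subnKC mn).
rewrite (le_lt_trans (ub m (n - m)%N _))//; first by near: m; exact: nbhs_infty_ge.
by near: m.
Unshelve. all: by end_near. Qed.

Lemma lim_tail_bound {R : realType} (u : nat -> R) l c m :
  u @ \oo --> l -> (forall n, `|u (m + n)%N - u m| <= c) -> `|l - u m| <= c.
Proof.
move=> ul uc; have h : `|u n - u m| @[n --> \oo] --> `|l - u m|.
  by apply: cvg_norm; apply: cvgB => //; exact: cvg_cst.
apply: (cvgr_to_le h); exists m => // n /= mn.
by rewrite -(subnKC mn).
Qed.

Lemma chain_step_arith {R : realFieldType} (x e : R) :
  x < e / 9 -> 4 * x + (x + 4 * x) < e.
Proof. lra. Qed.

Section borel_cantelli.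
Context d (Omega : measurableType d) (R : realType) (Q : probability Omega R).

Lemma lim_sup_set_geometric0 (F : nat -> set Omega) (c : R) : 0 <= c ->
  (forall n, measurable (F n)) -> (forall n, (Q (F n) <= (c / 2 ^+ n)%:E)%E) ->
  Q (lim_sup_set F) = 0%E.
Proof.
move=> c0 mF QF; apply: (lim_sup_set_cvg0 mF).
apply: (@le_lt_trans _ _ (2 * c)%:E); last exact: ltry.
apply: (le_trans _ (epsilon_trick0 xpredT (mulr_ge0 (ler0n R 2) c0))).
apply: lee_nneseries => n; first by [].
move=> _; rewrite (le_trans (QF n))// lee_fin natrX exprS.
have p2 : (2 : R) ^+ n != 0 by rewrite expf_neq0.
by rewrite le_eqVlt; apply/orP; left; apply/eqP; field.
Qed.

Lemma not_lim_sup_setP (F : nat -> set Omega) w : ~ lim_sup_set F w <->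
  exists m0, forall m, (m0 <= m)%N -> ~ F m w.
Proof.
split=> [nF|[m0 h] lF].
  apply: contrapT => /forallNP h; apply: nF => n _.
  have /existsNP[m] := h n; move/not_implyP => [nm] /contrapT Fm.
  by exists m.
by have [m /= m0m Fm] := lF m0 I; exact: (h m).
Qed.

Lemma measurable_lim_sup_set (F : nat -> set Omega) :
  (forall n, measurable (F n)) -> measurable (lim_sup_set F).
Proof.
move=> mF; apply: bigcap_measurable => // k _.
by apply: bigcup_measurable => j _.
Qed.

End borel_cantelli.

Section gaussian_version.
Context (R : realType) (d : nat) (hd : (0 < d)%N).
Local Notation T := (corner d * d.-tuple R)%type.
Context dQ (Omega : measurableType dQ) (Q : probability Omega R) (G : T -> Omega -> R).
Hypothesis hG : centered_gaussian_process Q (corner_index d) (@corner_cov R d) G.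
Implicit Types (j l q : T).

Let mG q : corner_index d q -> measurable_fun [set: Omega] (G q).
Proof. by case: hG => + _ _ _; exact. Qed.

Lemma gaussian_law_normal_rv (Y : Omega -> R) : measurable_fun [set: Omega] Y ->
  gaussian_law (pushforward Q Y) -> exists m s, normal_rv Q Y m s.
Proof. by move=> mY [m [s [s0 h]]]; exists m, s; split. Qed.

Lemma gaussian_marginal q : corner_index d q -> exists m s, normal_rv Q (G q) m s.
Proof.
move=> Dq; apply: gaussian_law_normal_rv; first exact: mG.
have [_ law _ _] := hG; have := law 1%N (fun=> q) (fun=> 1) (fun=> Dq).
by under eq_fun do rewrite big_ord_recl big_ord0 mul1r addr0.
Qed.

(** The coefficients 1 and -1 give normality; mean and covariance identify the parameters. The
    variance is [cdist j l] minus the square of the difference of the two probabilities. *)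
Lemma gaussian_increment j l : corner_index d j -> corner_index d l ->
  exists2 s, normal_rv Q (fun w => G j w - G l w) 0 s & s ^+ 2 <= cdist j l.
Proof.
move=> Dj Dl.
have mD : measurable_fun [set: Omega] (fun w => G j w - G l w).
  by apply: measurable_funB; exact: mG.
have [m [s nD]] : exists m s, normal_rv Q (fun w => G j w - G l w) m s.
  apply: gaussian_law_normal_rv => //; have [_ law _ _] := hG.
  have := law 2%N (fun i => if i == ord0 then j else l)
    (fun i => if i == ord0 then 1 else -1).
  under eq_fun do rewrite big_ord_recl big_ord1/= mul1r mulN1r.
  by apply=> i; case: ifP.
have [m1 [s1 nj]] := gaussian_marginal Dj.
have [m2 [s2 nl]] := gaussian_marginal Dl.
have [_ _ mean cov] := hG.
have m0 : m = 0.
  apply: EFin_inj; rewrite -(normal_rv_mean nD).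
  rewrite -[X in ('E_Q[X])%E]/(G j \- G l)%R expectationB.
  - by rewrite (mean _ Dj) (mean _ Dl) sube0.
  - exact: normal_rv_Lfun1 nj.
  - exact: normal_rv_Lfun1 nl.
exists s; first by rewrite -m0.
rewrite -lee_fin -(normal_rv_variance nD).
rewrite -[X in ('V_Q[X])%E]/(G j \- G l)%R varianceB.
- rewrite /variance !cov// (_ : (_ + _ - _)%E =
      (corner_cov j j + corner_cov l l - 2 * corner_cov j l)%:E); last first.
    by rewrite EFinB EFinD EFinM.
  rewrite lee_fin !corner_covE cdistE.
  rewrite !setIid; have := sqr_ge0 (cprob (cset j) - cprob (cset l) : R).
  by rewrite expr2; lra.
- exact: normal_rv_Lfun2 nj.
- exact: normal_rv_Lfun2 nl.
Qed.

(** The variance is below the squared scale at every level, so no restriction on [m] arises and the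
    bracketing step disappears. *)
Lemma gaussian_level_tail m : level_tail Q G (expR 1) m.
Proof.
move=> j l Dj Dl jl lambda.
have [s nD sd] := gaussian_increment Dj Dl.
have cs := chain_scale_gt0 (R := R) hd m.
have [mD _ _] := nD.
have s1 : s ^+ 2 <= chain_scale d m ^+ 2.
  rewrite chain_scale_sqr (le_trans sd)// (le_trans jl)//.
  by have := mesh_gt0 (R := R) m hd; lra.
have key (e : R) : e ^+ 2 = 1 ->
    expR (e * (chain_scale d m)^-1 * 0 + (e * (chain_scale d m)^-1) ^+ 2 * s ^+ 2 / 2)
      <= expR 1.
  move=> e1; rewrite mulr0 add0r ler_expR exprMn e1 mul1r exprVn mulrC.
  apply: (@le_trans _ _ (2^-1 * 1)); last by rewrite mulr1 invf_le1// ler1n.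
  by rewrite ler_wpM2l// mulrC ler_pdivrMr ?exprn_gt0// mul1r.
apply: (exponential_tail (X := fun w => G j w - G l w) (C := expR 1) lambda cs) => //.
- by rewrite (normal_rv_mgf _ nD) lee_fin -[(chain_scale d m)^-1]mul1r key// expr1n.
- rewrite (normal_rv_mgf _ nD) lee_fin -[- (chain_scale d m)^-1]mulN1r key//.
  by rewrite sqrrN expr1n.
Qed.

Let badG m := bad G m.

Let measurable_badG m : measurable (badG m).
Proof. exact: measurable_bad. Qed.

(** One exceptional null set serves all [j], because the bad events involve grid nodes only. *)
Definition good_set : set Omega := ~` lim_sup_set badG.

Lemma measurable_good_set : measurable good_set.
Proof. by apply: measurableC; exact: measurable_lim_sup_set. Qed.

Lemma bad_set_null : Q (lim_sup_set badG) = 0%E.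
Proof.
apply: (@lim_sup_set_geometric0 _ _ _ _ _ (2 * expR 1)) => //.
by move=> n; apply: bad_prob => //; exact: gaussian_level_tail.
Qed.

(** The value 0 off [good_set] makes every path, and not only almost every one, bounded and
    uniformly continuous. *)
Definition limit_version j w : R :=
  if w \in good_set then lim (G (lower m j) w @[m --> \oo]) else 0.

Lemma good_set_tail w : good_set w -> exists m0, forall m n j, (m0 <= m)%N ->
  corner_index d j -> `|G (lower (m + n) j) w - G (lower m j) w| <= 4 * chain_step d m.
Proof.
move=> /not_lim_sup_setP[m0 h]; exists m0 => m n j m0m Dj.
have gw k : (m <= k < m + n)%N -> ~ bad G k w.
  by move=> /andP[mk _]; apply: h; exact: leq_trans mk.
apply: (le_trans (good_lower_telescope hd Dj gw)).
by rewrite ler_pM2l// gerBl chain_step_ge0.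
Qed.

Lemma cvg_limit_version w j : good_set w -> corner_index d j ->
  G (lower m j) w @[m --> \oo] --> limit_version j w.
Proof.
move=> gw Dj; rewrite /limit_version mem_set//.
have [m0 h] := good_set_tail gw.
apply: (@cvg_of_tail_bound _ (fun m => G (lower m j) w) (fun m => 4 * chain_step d m) m0).
  by rewrite -[X in _ --> X](mulr0 4); apply: cvgMr; exact: cvg_chain_step.
by move=> m n m0m; exact: h.
Qed.

Lemma measurable_limit_version j : corner_index d j ->
  measurable_fun [set: Omega] (limit_version j).
Proof.
move=> Dj.
apply: (@measurable_fun_cvg _ _ _ _ (fun m w => \1_good_set w * G (lower m j) w)).
  move=> m; apply: measurable_funM.
    exact/measurable_indic/measurable_good_set.
  by apply: mG; exact: lower_index.
move=> w _; have [gw|gw] := pselect (good_set w).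
  rewrite indicE mem_set//; under eq_fun do rewrite mul1r.
  exact: cvg_limit_version.
rewrite /limit_version indicE memNset//; under eq_fun do rewrite mul0r.
exact: cvg_cst.
Qed.

(** A second use of Borel-Cantelli, for the increments between a fixed [j] and its approximations,
    shows that they converge to [G j]. This null set depends on [j], which a version permits. *)
Lemma limit_version_ae j : corner_index d j ->
  {ae Q, forall w, limit_version j w = G j w}.
Proof.
move=> Dj.
pose F m := [set w | chain_step d m < `|G (lower m j) w - G j w|].
have mF m : measurable (F m).
  apply: measurable_set_gt; apply: measurableT_comp => //.
  by apply: measurable_funB; apply: mG => //; exact: lower_index.
have QF : Q (lim_sup_set F) = 0%E.
  apply: (@lim_sup_set_geometric0 _ _ _ _ _ (2 * expR 1)) => //.
  move=> m; apply: (le_trans (gaussian_level_tail _ Dj _ _)).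
  - exact: lower_index.
  - rewrite (le_trans (cdist_lower m Dj))//.
    by have := mesh_gt0 (R := R) m hd; lra.
  - rewrite lee_fin ler_wpM2l ?mulr_ge0 ?expR_ge0//.
    apply: (le_trans (chain_rate hd m)).
    rewrite lef_pV2 ?posrE ?exprn_gt0 ?mulr_gt0 ?exprn_gt0//.
    rewrite exprMn (le_trans (ler_weXn2l _ (ltnW (ltnSn _))))//; first by rewrite ler1n.
    rewrite (le_trans (ler_weXn2l _ (ltnW (ltnSn _))))//; first by rewrite ler1n.
    by rewrite ler_peMr ?exprn_ge0// exprn_ege1// exprn_ege1// ler1n.
exists (lim_sup_set badG `|` lim_sup_set F); split.
- by apply: measurableU; exact: measurable_lim_sup_set.
- apply/eqP; rewrite eq_le measure_ge0 andbT.
  rewrite (le_trans (measureU2 _ _ _))//; try exact: measurable_lim_sup_set.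
  by rewrite /= bad_set_null QF adde0.
- move=> w /= Hw; apply: contrapT => /not_orP[gw /not_lim_sup_setP[m0 h]]; apply: Hw.
  have c1 := cvg_limit_version gw Dj.
  have c2 : G (lower m j) w @[m --> \oo] --> G j w.
    apply/cvgrPdist_le => e e0.
    have me : \forall m \near \oo, chain_step d m < e.
      exact: (cvgr_lt _ (@cvg_chain_step R d) _ e0).
    near=> m; rewrite distrC.
    apply: (@le_trans _ _ (chain_step d m)); last by apply: ltW; near: m.
    rewrite leNgt; apply/negP => hm; apply: (h m _ hm).
    by near: m; exact: nbhs_infty_ge.
  exact: (cvg_unique _ c1 c2).
Unshelve. all: by end_near. Qed.

Lemma limit_version_lower w m0 : good_set w ->
  (forall m n j, (m0 <= m)%N -> corner_index d j ->
    `|G (lower (m + n) j) w - G (lower m j) w| <= 4 * chain_step d m) ->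
  forall m j, (m0 <= m)%N -> corner_index d j ->
  `|limit_version j w - G (lower m j) w| <= 4 * chain_step d m.
Proof.
move=> gw h m j m0m Dj.
apply: (lim_tail_bound (cvg_limit_version gw Dj)) => n.
exact: h.
Qed.

(** From some level on the approximation error is uniform in [j], and that level has finitely many
    nodes. *)
Lemma limit_version_bounded w :
  bounded_path (corner_index d) (fun j => limit_version j w).
Proof.
have [gw|gw] := pselect (good_set w); last first.
  by exists 0 => j _; rewrite /limit_version memNset// normr0.
have [m0 h] := good_set_tail gw.
exists (4 * chain_step d m0 + \sum_(p : grid_index d m0) `|G (grid_node p) w|) => j Dj.
have h1 := limit_version_lower gw h (leqnn m0) Dj.
rewrite -[limit_version j w](subrK (G (lower m0 j) w)) (le_trans (ler_normD _ _))//.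
rewrite lerD// (bigD1 (round_index m0 true j))//= lerDl sumr_ge0//.
Qed.

Lemma limit_version_uniformly_continuous w :
  uniformly_continuous_path (corner_index d) (@rho R d) (fun j => limit_version j w).
Proof.
move=> e e0; have [gw|gw] := pselect (good_set w); last first.
  exists 1 => // s t _ _ _; rewrite /limit_version memNset// subrr normr0//.
have [m0 h] := good_set_tail gw.
move: (gw) => /not_lim_sup_setP[m1 gm].
(* Nine steps: four for each of the two approximation errors, one between the grid nodes. *)
have ce : \forall m \near \oo, chain_step d m < e / 9.
  by apply: (cvgr_lt _ (@cvg_chain_step R d)); rewrite divr_gt0.
near \oo => m.
have m0m : (m0 <= m)%N by near: m; exact: nbhs_infty_ge.
have m1m : (m1 <= m)%N by near: m; exact: nbhs_infty_ge.
have cm : chain_step d m < e / 9 by near: m.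
exists (Num.sqrt (mesh d m)); first by rewrite sqrtr_gt0 mesh_gt0.
move=> s t Ds Dt; rewrite rho_sqrt ltr_sqrt ?mesh_gt0// => /ltW st.
have h1 := limit_version_lower gw h m0m Ds.
have h2 := limit_version_lower gw h m0m Dt; rewrite distrC in h2.
have h3 := good_lower_close Ds Dt st (gm m m1m).
rewrite (le_lt_trans (ler_distD (G (lower m s) w) _ _))//.
rewrite (le_lt_trans (lerD h1 (le_trans (ler_distD (G (lower m t) w) _ _) (lerD h3 h2))))//.
exact: chain_step_arith.
Unshelve. all: by end_near. Qed.

End gaussian_version.

Lemma corner_path_continuous (R : realType) (d : nat) (g : corner d * d.-tuple R -> R)
    (c : corner d) :
  uniformly_continuous_path (corner_index d) (@rho R d) g ->
  {within [set v : 'rV[R]_d | unit_cube (tuple_of_row v)],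
    continuous (fun v => g (c, tuple_of_row v))}.
Proof.
move=> ug; apply/subspace_continuousP => x Dx.
apply/cvgrPdist_lt => e e0; have [h h0 gh] := ug _ e0.
(* Dividing by [d.+1] makes the sum of [d] coordinate differences strictly smaller than [h ^+ 2]. *)
pose r := h ^+ 2 / d.+1%:R.
have r0 : 0 < r by rewrite divr_gt0// exprn_gt0.
near=> v.
have Dv : unit_cube (tuple_of_row v).
  by near: v; exact: withinT.
have xv : ball x r v.
  by near: v; apply: cvg_within; exact: nbhsx_ballx.
apply: gh => //.
rewrite rho_sqrt -(ger0_norm (ltW h0)) -sqrtr_sqr ltr_sqrt ?exprn_gt0//.
rewrite (le_lt_trans (cdist_lipschitz c _ _))//.
apply: (@le_lt_trans _ _ (\sum_(k < d) r)).
  apply: ler_sum => k _; rewrite !tnth_mktuple ltW//.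
  by have [_] := xv; exact.
rewrite sumr_const card_ord -mulr_natr /r mulrAC ltr_pdivrMr//.
by rewrite ltr_pM2l ?exprn_gt0// ltr_nat.
Unshelve. all: by end_near. Qed.

(** * Existence of the limit process *)

Lemma cvg_of_geometric_steps {R : realType} (u : nat -> R) m0 :
  (forall m, (m0 <= m)%N -> `|u m.+1 - u m| <= 2^-1 ^+ m) -> cvg (u @ \oo).
Proof.
move=> h; apply: (@cvg_of_tail_bound _ _ (fun m => 2 * 2^-1 ^+ m) m0).
  by rewrite -[X in _ --> X](mulr0 2); apply: cvgMr; apply: cvg_expr; rewrite ger0_norm// invf_lt1// ltr1n.
move=> m n m0m.
suff : `|u (m + n)%N - u m| <= 2 * (2^-1 ^+ m - 2^-1 ^+ (m + n)).
  move=> h1; apply: (le_trans h1); rewrite ler_pM2l// gerBl.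
  by rewrite exprn_ge0// invr_ge0.
elim: n => [|n IH]; first by rewrite addn0 !subrr normr0 mulr0.
rewrite addnS (le_trans (ler_distD (u (m + n)%N) _ _))//.
have := h (m + n)%N (leq_trans m0m (leq_addr _ _)).
move: IH; rewrite exprS.
set x := `|u (m + n)%N - _|; set y := `|_ - u (m + n)%N|.
set p := 2^-1 ^+ (m + n); set q := 2^-1 ^+ m; lra.
Qed.

Lemma cvg_finite_sum {R : realType} (I : Type) (r : seq I) (f : I -> nat -> R) (l : I -> R) :
  (forall i, f i n @[n --> \oo] --> l i) ->
  \sum_(i <- r) f i n @[n --> \oo] --> \sum_(i <- r) l i.
Proof.
move=> fl; elim: r => [|i r IH].
  by under eq_fun do rewrite big_nil; rewrite big_nil; exact: cvg_cst.
by under eq_fun do rewrite big_cons; rewrite big_cons; apply: cvgD.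
Qed.

Section gaussian_series.
Context d (Omega : measurableType d) (R : realType) (Q : probability Omega R).
Variable xi : nat -> Omega -> R.
Hypothesis mxi : forall i, measurable_fun [set: Omega] (xi i).
Hypothesis xi_indep : forall (J : seq nat) (A : nat -> set R), uniq J ->
  (forall i, measurable (A i)) ->
  Q (\big[setI/setT]_(i <- J) (xi i @^-1` A i)) =
  (\prod_(i <- J) normal0 1 (A i))%E.
Context (T : Type) (D : set T) (K : T -> T -> R) (a : nat -> T -> R).
Context (J L : nat -> seq nat) (c : R).
Hypothesis c0 : 0 <= c.
Hypothesis uJ : forall m, uniq (J m).
Hypothesis JS : forall m, J m.+1 = J m ++ L m.
(** Chebyshev's inequality at the threshold 2^-m costs a factor 4^m, so 8^m leaves a summable
    bound. *)
Hypothesis small : forall t m, D t -> \sum_(b <- L m) a b t ^+ 2 <= c / 8 ^+ m.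
Hypothesis Kcvg : forall s t, D s -> D t ->
  \sum_(b <- J m) a b s * a b t @[m --> \oo] --> K s t.

Let V m t w := \sum_(b <- J m) a b t * xi b w.
Let jump t m := [set w | 2^-1 ^+ m < `|V m.+1 t w - V m t w|].

Let measurable_V m t : measurable_fun [set: Omega] (V m t).
Proof. exact: measurable_sum_xi. Qed.

Let measurable_jump t m : measurable (jump t m).
Proof.
apply: measurable_set_gt; apply: measurableT_comp => //.
by apply: measurable_funB; exact: measurable_V.
Qed.

Let jump_prob t m : D t -> (Q (jump t m) <= (c / 2 ^+ m)%:E)%E.
Proof.
move=> Dt; have uL : uniq (L m).
  by have := uJ m.+1; rewrite JS cat_uniq => /and3P[].
have := sum_xi_normal mxi xi_indep (a ^~ t) uL.
move=> /centered_normal_tail h; have e0 : (0 : R) < 2^-1 ^+ m by rewrite exprn_gt0// invr_gt0.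
have VE w : V m.+1 t w - V m t w = \sum_(b <- L m) a b t * xi b w.
  by rewrite /V JS big_cat/= addrAC subrr add0r.
rewrite /jump; under eq_set do rewrite VE.
apply: (le_trans (h _ e0)).
rewrite lee_fin sqr_sqrtr; last by apply: sumr_ge0 => b _; exact: sqr_ge0.
rewrite ler_pdivrMr ?exprn_gt0// (le_trans (small m Dt))//.
have -> : (8 : R) = 2 ^+ 3 by ring.
rewrite -exprM mulnC exprM exprVn.
have p0 : (2 : R) ^+ m != 0 by rewrite expf_neq0.
by rewrite le_eqVlt; apply/orP; left; apply/eqP; field.
Qed.

(** Depends on [t]: here only finite-dimensional laws matter, and the paths are regularised
    afterwards by [limit_version]. *)
Definition series_good t : set Omega := ~` lim_sup_set (jump t).

Definition series_limit t w : R :=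
  if w \in series_good t then lim (V m t w @[m --> \oo]) else 0.

Let cvg_V t w : series_good t w -> V m t w @[m --> \oo] --> series_limit t w.
Proof.
move=> gw; rewrite /series_limit mem_set//.
move: gw => /not_lim_sup_setP[m0 h].
apply: (@cvg_of_geometric_steps _ (fun m => V m t w) m0) => m m0m.
by rewrite leNgt; apply/negP; exact: h.
Qed.

Let measurable_series_good t : measurable (series_good t).
Proof. by apply: measurableC; exact: measurable_lim_sup_set. Qed.

Let measurable_series_limit t : measurable_fun [set: Omega] (series_limit t).
Proof.
apply: (@measurable_fun_cvg _ _ _ _ (fun m w => \1_(series_good t) w * V m t w)).
  by move=> m; apply: measurable_funM => //; exact/measurable_indic.
move=> w _; have [gw|gw] := pselect (series_good t w).
  by rewrite indicE mem_set//; under eq_fun do rewrite mul1r; exact: cvg_V.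
rewrite /series_limit indicE memNset//; under eq_fun do rewrite mul0r.
exact: cvg_cst.
Qed.

Let ae_cvg_V t : D t -> {ae Q, forall w, V m t w @[m --> \oo] --> series_limit t w}.
Proof.
move=> Dt; exists (lim_sup_set (jump t)); split.
- exact: measurable_lim_sup_set.
- by apply: (lim_sup_set_geometric0 c0) => // n; exact: jump_prob.
- by move=> w /= Hw; apply: contrapT => gw; apply: Hw; exact: cvg_V.
Qed.

(** Partial sums of a combination are again finite sums of independent normals, with coefficients
    [e]; their variances converge to the quadratic form of [K], and [centered_normal_lim] passes to
    the limit. *)
Let combination_normal n (t : 'I_n -> T) (u : 'I_n -> R) : (forall i, D (t i)) ->
  centered_normal Q (fun w => \sum_(i < n) u i * series_limit (t i) w)
    (Num.sqrt (\sum_(i < n) \sum_(k < n) u i * u k * K (t i) (t k))).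
Proof.
move=> Dt; pose e b := \sum_(i < n) u i * a b (t i).
apply: (@centered_normal_lim _ _ _ _ (fun m w => \sum_(b <- J m) e b * xi b w) _
   (fun m => Num.sqrt (\sum_(b <- J m) e b ^+ 2))).
- by move=> m; exact: sum_xi_normal.
- by apply: measurable_sum => i; exact: measurable_funM.
- have E m : Num.sqrt (\sum_(b <- J m) e b ^+ 2) ^+ 2 =
      \sum_(i < n) \sum_(k < n) u i * u k * \sum_(b <- J m) a b (t i) * a b (t k).
    rewrite sqr_sqrtr; last by apply: sumr_ge0 => b _; exact: sqr_ge0.
    under eq_bigr do rewrite expr2 mulr_suml.
    rewrite exchange_big/=; apply: eq_bigr => i _.
    under eq_bigr do rewrite mulr_sumr.
    rewrite exchange_big/=; apply: eq_bigr => k _.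
    rewrite mulr_sumr; apply: eq_bigr => b _; ring.
  under eq_fun do rewrite E.
  apply: cvg_finite_sum => i; apply: cvg_finite_sum => k.
  by apply: cvgMr; exact: Kcvg.
- have : {ae Q, forall w, forall i, V m (t i) w @[m --> \oo] --> series_limit (t i) w}.
    by apply: filter_forall => i; exact: ae_cvg_V.
  apply: filterS => w h.
  have E m : \sum_(b <- J m) e b * xi b w = \sum_(i < n) u i * V m (t i) w.
    under eq_bigr do rewrite mulr_suml.
    rewrite exchange_big/=; apply: eq_bigr => i _.
    by rewrite mulr_sumr; apply: eq_bigr => b _; rewrite mulrA.
  under eq_fun do rewrite E.
  by apply: cvg_finite_sum => i; apply: cvgMr; exact: h.
Qed.

Let K_sym s t : D s -> D t -> K s t = K t s.
Proof.
move=> Ds Dt; have h1 := Kcvg Ds Dt; have h2 := Kcvg Dt Ds.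
have E : (fun m => \sum_(b <- J m) a b s * a b t) = (fun m => \sum_(b <- J m) a b t * a b s).
  by apply/funext => m; apply: eq_bigr => b _; rewrite mulrC.
rewrite E in h1.
exact: (@cvg_unique _ (@norm_hausdorff _ R) _ _ _ _ h1 h2).
Qed.

Let K_ge0 t : D t -> 0 <= K t t.
Proof.
move=> Dt; apply: (cvgr_to_ge (Kcvg Dt Dt)); apply: nearW => n.
by apply: sumr_ge0 => b _; rewrite -expr2 sqr_ge0.
Qed.

Let pair_ge0 s t : D s -> D t -> 0 <= K s s + K t t + 2 * K s t.
Proof.
move=> Ds Dt; have h : \sum_(b <- J m) a b s * a b s + \sum_(b <- J m) a b t * a b t
    + 2 * (\sum_(b <- J m) a b s * a b t) @[m --> \oo] --> K s s + K t t + 2 * K s t.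
  by apply: cvgD; [apply: cvgD|apply: cvgMr]; exact: Kcvg.
apply: (cvgr_to_ge h); apply: nearW => n.
rewrite mulr_sumr -!big_split/=; apply: sumr_ge0 => b _.
have := sqr_ge0 (a b s + a b t).
by rewrite (_ : (a b s + a b t) ^+ 2 = a b s * a b s + a b t * a b t + 2 * (a b s * a b t)); last ring.
Qed.

Let pair_normal s t : D s -> D t ->
  centered_normal Q (fun w => series_limit s w + series_limit t w)
    (Num.sqrt (K s s + K t t + 2 * K s t)).
Proof.
move=> Ds Dt; have Dst (i : 'I_2) : D (if i == ord0 then s else t) by case: ifP.
have := @combination_normal 2 (fun i => if i == ord0 then s else t) (fun=> 1) Dst.
under eq_fun do rewrite big_ord_recl big_ord1 /= !mul1r.
rewrite !(big_ord_recl, big_ord0) /= !mul1r !addr0 (K_sym Dt Ds).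
by rewrite (_ : K s s + K s t + (K s t + K t t) = K s s + K t t + 2 * K s t)//; ring.
Qed.

Let marginal_normal t : D t -> centered_normal Q (series_limit t) (Num.sqrt (K t t)).
Proof.
move=> Dt; have := @combination_normal 1 (fun=> t) (fun=> 1) (fun=> Dt).
by under eq_fun do rewrite big_ord1 mul1r; rewrite !big_ord1 !mul1r.
Qed.

(** The covariance is found by polarisation, from the variances of the two marginals and of their
    sum. *)
Lemma series_limit_gaussian : centered_gaussian_process Q D K series_limit.
Proof.
split=> //.
- move=> n t u Dt; exact: centered_normal_gaussian (combination_normal u Dt).
- by move=> t Dt; exact: (normal_rv_mean (centered_normal_rv (marginal_normal Dt))).
move=> s t Ds Dt.
have ns := centered_normal_rv (marginal_normal Ds).
have nt := centered_normal_rv (marginal_normal Dt).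
have nst := centered_normal_rv (pair_normal Ds Dt).
have Ls := normal_rv_Lfun2 ns; have Lt := normal_rv_Lfun2 nt.
have := varianceD Ls Lt.
have := normal_rv_variance nst; have := normal_rv_variance ns; have := normal_rv_variance nt.
rewrite !real_normK ?num_real// !sqr_sqrtr ?K_ge0 ?pair_ge0// => -> -> VE.
have cf : covariance Q (series_limit s) (series_limit t) \is a fin_num.
  apply: covariance_fin_num; [exact: normal_rv_Lfun1 ns|exact: normal_rv_Lfun1 nt|].
  exact: Lfun2_mul_Lfun1.
rewrite -[series_limit s \+ _]/(fun w => series_limit s w + series_limit t w) VE => VD.
rewrite -(fineK cf) in VD.
have [] : (K s s + K t t + 2 * K s t)%:E =
    (K s s + K t t + 2 * fine (covariance Q (series_limit s) (series_limit t)))%:E.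
  by rewrite VD !EFinD EFinM.
by rewrite -{2}(fineK cf); set x := fine _ => h; congr EFin; move: h; lra.
Qed.

End gaussian_series.

(** * Quantile transforms of the uniform law *)

Section ereal_limits.
Context {R : realType} (T : Type) (F : set_system T) {FF : Filter F}.
Implicit Types (f : T -> \bar R) (l b : \bar R).

Lemma near_cvge_lt f l b : f x @[x --> F] --> l -> (l < b)%E ->
  \forall x \near F, (f x < b)%E.
Proof.
move=> fl lb; apply: (fl [set y | (y < b)%E]); apply: open_nbhs_nbhs.
by split => //; exact: open_ereal_lt_ereal.
Qed.

Lemma near_cvge_gt f l b : f x @[x --> F] --> l -> (b < l)%E ->
  \forall x \near F, (b < f x)%E.
Proof.
move=> fl lb; apply: (fl [set y | (b < y)%E]); apply: open_nbhs_nbhs.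
by split => //; exact: open_ereal_gt_ereal.
Qed.

End ereal_limits.

Section quantile.
Context (R : realType) (mu : probability (measurableTypeR R) R).

Let idR : measurableTypeR R -> R := idfun.

#[local] HB.instance Definition _ :=
  @isMeasurableFun.Build _ _ _ _ idR (@measurable_id _ _ setT).

Let idX : {RV mu >-> R} := idR.

Let below u := [set x : R | (cdf idX x < u%:E)%E].

(** Off the open unit interval the set [below u] may be empty or unbounded; the default 0 there
    matters only on a null set of the uniform law. *)
Definition quantile (u : R) : R := if 0 < u < 1 then sup (below u) else 0.

Let cdf_eq x : cdf idX x = mu `]-oo, x]%classic.
Proof. by []. Qed.

Let has_sup_below u : 0 < u < 1 -> has_sup (below u).
Proof.
move=> /andP[u0 u1]; split.
  have : \forall x \near -oo, (cdf idX x < u%:E)%E.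
    by apply: (near_cvge_lt (cvg_cdfNy0 idX)).
  by move=> [M [_ h]]; exists (M - 1); apply: h; rewrite ltrBlDr ltrDl.
have : \forall x \near +oo, (u%:E < cdf idX x)%E.
  by apply: (near_cvge_gt (cvg_cdfy1 idX)).
move=> [M [_ h]]; exists (M + 1) => x /= xu; rewrite leNgt; apply/negP => Mx.
have : (u%:E < cdf idX x)%E by apply: h; apply: lt_trans Mx; rewrite ltrDl.
by rewrite ltNge (ltW xu).
Qed.

(** Right continuity of the distribution function moves [x] slightly to the right within [below u],
    which makes the inequality with the supremum strict. *)
Lemma quantile_gt u x : 0 < u < 1 -> (x < quantile u) = (cdf idX x < u%:E)%E.
Proof.
move=> u01; rewrite /quantile u01; have hs := has_sup_below u01.
apply/idP/idP => [xu|xu].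
  have [y yu xy] := sup_gt (proj1 hs) xu.
  by apply: le_lt_trans yu; apply: cdf_nondecreasing; exact: ltW.
have rc := @cdf_right_continuous _ _ _ _ idX x.
have : \forall y \near x^'+, (cdf idX y < u%:E)%E by apply: (near_cvge_lt rc).
move=> h.
have [y [xy yu]] : exists y, x < y /\ (cdf idX y < u%:E)%E.
  near x^'+ => y; exists y; split; near: y => //; exact: nbhs_right_gt.
by apply: (lt_le_trans xy); apply: sup_ubound => //; case: hs.
Unshelve. all: by end_near. Qed.

Lemma measurable_quantile : measurable_fun [set: R] quantile.
Proof.
suff h x : measurable (quantile @^-1` `]x, +oo[%classic).
  apply: (@measurability _ _ _ _ setT quantile (@RGenOInfty.G R)).
    exact: RGenOInfty.measurableE.
  by move=> _ [_ [x ->] <-]; rewrite setTI.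
have cf : cdf idX x \is a fin_num by exact: fin_num_measure.
(* Off []0, 1[] the quantile is 0, which exceeds [x] exactly when [x < 0]. *)
rewrite (_ : _ @^-1` _ = (`]fine (cdf idX x), +oo[%classic `&` `]0, 1[%classic) `|`
  (if x < 0 then ~` `]0, 1[%classic else set0)).
  apply: measurableU; first by apply: measurableI; exact: measurable_itv.
  by case: ifP => // _; apply: measurableC; exact: measurable_itv.
apply/seteqP; split => u /=; rewrite !in_itv/= !andbT.
  have [u01|u01] := boolP (0 < u < 1).
    by rewrite quantile_gt// -(fineK cf) lte_fin => h; left.
  rewrite /quantile (negbTE u01) => x0; right; rewrite x0.
  by rewrite /= in_itv/= ; exact/negP.
move=> [[h u01]|]; first by rewrite quantile_gt// -(fineK cf) lte_fin.
by case: ifP => // x0 /=; rewrite in_itv/= => /negP u01; rewrite /quantile (negbTE u01).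
Qed.

Lemma uniform_prob01E (A : set R) : measurable A ->
  uniform_prob (@ltr01 R) A = @lebesgue_measure R (A `&` `[0, 1]%classic).
Proof.
move=> mA; transitivity (\int[uniform_prob (@ltr01 R)]_x (\1_A x)%:E)%E.
  by rewrite integral_indic//= setIT.
rewrite integral_uniform//=.
- by rewrite subr0 invr1 mul1e integral_indic.
- by apply/measurable_EFinP; exact: measurable_indic.
Qed.

Lemma quantile_law (A : set R) : measurable A ->
  uniform_prob (@ltr01 R) (quantile @^-1` A) = mu A.
Proof.
apply: (@law_eq_of_rays _ (measurableTypeR R) R (uniform_prob (@ltr01 R)) quantile mu measurable_quantile) => x.
have mE : measurable (quantile @^-1` `]x, +oo[%classic).
  by apply: measurable_set_preimage => //; exact: measurable_quantile.
have cf : cdf idX x \is a fin_num by exact: fin_num_measure.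
set F := fine (cdf idX x).
have F01 : 0 <= F <= 1.
  by rewrite -!lee_fin /F (fineK cf) cdf_ge0 cdf_le1.
have -> : mu `]x, +oo[%classic = (1 - F)%:E.
  rewrite EFinB /F (fineK cf) cdf_eq -(probability_setC mu (measurable_itv _)).
  by rewrite setCitvl.
have qF u : 0 < u < 1 -> (x < quantile u) = (F < u).
  by move=> u01; rewrite quantile_gt// -(fineK cf) lte_fin.
transitivity (@lebesgue_measure R (quantile @^-1` `]x, +oo[%classic `&` `[0, 1]%classic)).
  exact: uniform_prob01E.
(* The preimage lies between []F, 1[] and [[F, 1]] with 0 added: at 0 and 1 the default value rules
   and [qF] does not apply. *)
apply/eqP; rewrite eq_le; apply/andP; split.
  apply: (@le_trans _ _ (@lebesgue_measure R ([set 0] `|` `[F, 1]%classic))).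
    apply: le_measure; rewrite ?inE; [exact: measurableI|exact: measurableU|].
    move=> u [/=]; rewrite !in_itv/= andbT => xu /andP[u0 u1].
    have [->|un0] := eqVneq u 0; [by left|right].
    rewrite u1 andbT; have [->|un1] := eqVneq u 1; first by case/andP: F01.
    by rewrite ltW// -qF// !lt_neqAle eq_sym un0 u0 un1.
  rewrite (le_trans (measureU2 _ _ _))//= lebesgue_measure_set1 add0e.
  by rewrite lebesgue_measure_itv/= lte_fin; case: ifP => // _; rewrite lee_fin subr_ge0; case/andP: F01.
apply: (@le_trans _ _ (@lebesgue_measure R `]F, 1[%classic)).
  rewrite lebesgue_measure_itv/= lte_fin; case: ifPn => //.
  by rewrite -leNgt lee_fin subr_le0.
apply: le_measure; rewrite ?inE; [exact: measurable_itv|exact: measurableI|].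
move=> u /=; rewrite !in_itv/= => /andP[Fu u1].
have u0 : 0 < u by apply: le_lt_trans Fu; case/andP: F01.
by rewrite andbT qF ?u0// Fu ltW// ltW.
Qed.

End quantile.

Lemma iid_uniform_cube_normals (R : realType) (d : nat) (hd : (0 < d)%N)
    (dO : measure_display) (Omega : measurableType dO)
    (P : probability Omega R) (X : nat -> {RV P >-> d.-tuple R}) :
  iid_with_law X (uniform_cube d) ->
  exists2 xi : nat -> Omega -> R, forall i, measurable_fun [set: Omega] (xi i) &
  forall (J : seq nat) (A : nat -> set R), uniq J ->
    (forall i, measurable (A i)) ->
    P (\big[setI/setT]_(i <- J) (xi i @^-1` A i)) = (\prod_(i <- J) normal0 1 (A i))%E.
Proof.
move=> [indep law]; pose k0 := Ordinal hd.
pose g (x : d.-tuple R) := quantile (normal0 1) (tnth x k0).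
have mg : measurable_fun [set: d.-tuple R] g.
  by apply: (measurableT_comp (measurable_quantile _)); exact: measurable_tnth.
exists (fun i w => g (X i w)).
  by move=> i; apply: measurableT_comp => //.
move=> J A uJ mA.
pose B i := g @^-1` A i.
have mB i : measurable (B i) by rewrite -[X in measurable X]setTI; exact: mg.
rewrite -[X in P X]/(\big[setI/setT]_(i <- J) (X i @^-1` B i)).
rewrite indep//; apply: eq_bigr => i _.
rewrite -[LHS]/(distribution P (X i) (B i)) law//.
pose C := quantile (normal0 1) @^-1` A i.
have mC : measurable C by rewrite -[X in measurable X]setTI; exact: measurable_quantile.
pose D (k : 'I_d) := if k == k0 then C else setT.
have mD k : measurable (D k) by rewrite /D; case: ifP.
have -> : B i = [set y | forall k, D k (tnth y k)].
  apply/seteqP; split => [y By k|y /(_ k0)]; rewrite /D ?eqxx//.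
  by case: eqP => // ->.
rewrite (uniform_cube_box mD) (bigD1 k0)//= big1 ?mule1.
  by rewrite /D eqxx; exact: quantile_law.
by move=> k /negbTE; rewrite /D => ->; exact: probability_setT.
Qed.

(** Here [p], [q] are the masses of two children of a cell, and [a], [a'], [b], [b'] those of two
    sets inside them: projecting on the children is projecting on the parent plus the Haar function.
    For a null child division by 0 makes its terms vanish. *)
Lemma haar_identity {R : rcfType} (p q a a' b b' : R) : 0 <= p -> 0 <= q ->
  (p = 0 -> a = 0 /\ b = 0) -> (q = 0 -> a' = 0 /\ b' = 0) ->
  (q * a - p * a') / Num.sqrt (p * q * (p + q)) *
    ((q * b - p * b') / Num.sqrt (p * q * (p + q))) +
  (a + a') * (b + b') / (p + q) = a * b / p + a' * b' / q.
Proof.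
move=> p0 q0 pz qz.
have [pe|pn] := eqVneq p 0.
  by have [-> ->] := pz pe; rewrite pe !(mulr0, mul0r) sqrtr0 invr0 !(mulr0, mul0r, add0r, addr0).
have [qe|qn] := eqVneq q 0.
  by have [-> ->] := qz qe; rewrite qe !(mulr0, mul0r) sqrtr0 invr0 !(mulr0, mul0r, add0r, addr0).
have pp : 0 < p by rewrite lt_neqAle eq_sym pn.
have qp : 0 < q by rewrite lt_neqAle eq_sym qn.
have pq : 0 < p + q by rewrite addr_gt0.
rewrite mulrACA -invfM -expr2 sqr_sqrtr; last by rewrite !mulr_ge0// addr_ge0.
by field; rewrite pn qn gt_eqF.
Qed.

(** * The Haar expansion along a binary tree of partitions *)

Fixpoint words n : seq (seq bool) :=
  if n is n'.+1 then map (cons true) (words n') ++ map (cons false) (words n')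
  else [:: [::]].

Lemma size_words n b : b \in words n -> size b = n.
Proof.
elim: n b => [|n IH] b /=; first by rewrite inE => /eqP ->.
by rewrite mem_cat => /orP[] /mapP[b' /IH <- ->].
Qed.

Lemma uniq_words n : uniq (words n).
Proof.
elim: n => //= n IH; rewrite cat_uniq !map_inj_uniq ?IH; [|by move=> ? ? []..].
rewrite /= andbT; apply/hasPn => _ /mapP[b _ ->]; apply/negP => /mapP[b' _].
by case.
Qed.

Definition levels m k := flatten (map words (iota m k)).

Lemma levelsS m k : levels m k.+1 = words m ++ levels m.+1 k.
Proof. by []. Qed.

Lemma levelsD m k l : levels m (k + l) = levels m k ++ levels (m + k) l.
Proof. by rewrite /levels iotaD map_cat flatten_cat. Qed.

Lemma size_levels m k b : b \in levels m k -> (m <= size b < m + k)%N.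
Proof.
elim: k m => [//|k IH] m; rewrite levelsS mem_cat => /orP[/size_words ->|/IH].
  by rewrite leqnn addnS ltnS leq_addr.
by rewrite addSnnS => /andP[/ltnW -> ->].
Qed.

Lemma uniq_levels m k : uniq (levels m k).
Proof.
elim: k m => // k IH m; rewrite levelsS cat_uniq uniq_words IH andbT /=.
apply/hasPn => b /size_levels /andP[mb _]; apply/negP => /size_words sb.
by rewrite sb ltnn in mb.
Qed.

Section haar_expansion.
Context (R : realType) (d : nat).
Local Notation S := (d.-tuple R).
Implicit Types (A B : set S) (b : seq bool).
Variable H : nat -> set S.
Hypothesis mH : forall i, measurable (H i).

(** The head of a word is the most recent split, so that a word of length n decides membership in
    [H 0], ..., [H (n - 1)]. *)
Fixpoint cell b : set S := if b is x :: b' then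
  cell b' `&` (if x then H (size b') else ~` H (size b')) else setT.

Lemma measurable_cell b : measurable (cell b).
Proof.
elim: b => [|x b IH] //=; apply: measurableI => //.
by case: x => //; exact: measurableC.
Qed.
Hint Resolve measurable_cell : core.

Lemma cprob_cell A b : measurable A ->
  cprob (A `&` cell b) = cprob (A `&` cell (true :: b)) + cprob (A `&` cell (false :: b)).
Proof.
move=> mA; rewrite /= !setIA; apply: cprob_setUD => //.
exact: measurableI.
Qed.

(* Up to sign, the coefficient of [\1_A] on the normalized Haar function of [cell b].
   If a child of [cell b] is null, the division by 0 makes it vanish. *)
Definition haar b A : R :=
  let p := cprob (cell (true :: b)) in let q := cprob (cell (false :: b)) in
  (q * cprob (A `&` cell (true :: b)) - p * cprob (A `&` cell (false :: b))) /
    Num.sqrt (p * q * (p + q)).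

(** Summed over the cells of level n, this is the inner product of the conditional expectations of
    the two indicators given the partition. *)
Definition leaf b A B : R :=
  cprob (A `&` cell b) * cprob (B `&` cell b) / cprob (cell b).

Lemma le_cprob_cell A b : measurable A -> cprob (A `&` cell b) <= cprob (cell b).
Proof.
move=> mA; apply: le_cprob => //; exact: measurableI.
Qed.

Lemma cprob_cell_null A b : measurable A -> cprob (cell b) = 0 -> cprob (A `&` cell b) = 0.
Proof.
move=> mA c0; apply/eqP; rewrite eq_le cprob_ge0 andbT -c0; exact: le_cprob_cell.
Qed.

Lemma haar_leaf A B b : measurable A -> measurable B ->
  haar b A * haar b B + leaf b A B = leaf (true :: b) A B + leaf (false :: b) A B.
Proof.
move=> mA mB; have cE : cprob (cell b) = cprob (cell (true :: b)) + cprob (cell (false :: b)).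
  by have := cprob_cell b measurableT; rewrite !setTI.
rewrite /leaf cE (cprob_cell b mA) (cprob_cell b mB).
by apply: haar_identity; rewrite ?cprob_ge0// => c0; rewrite !cprob_cell_null.
Qed.

Definition leaves n A B : R := \sum_(b <- words n) leaf b A B.

(** The constant function at the root accounts for the product of means subtracted in [corner_cov],
    so the series omits it. *)
Lemma leaves0 A B : leaves 0 A B = cprob A * cprob B.
Proof.
rewrite /leaves big_seq1 /leaf /= !setIT.
have -> : cprob [set: S] = 1 by apply: EFin_inj; rewrite cprobE// probability_setT.
by rewrite divr1.
Qed.

Lemma leavesS n A B : measurable A -> measurable B ->
  leaves n.+1 A B = leaves n A B + \sum_(b <- words n) haar b A * haar b B.
Proof.
move=> mA mB; rewrite /leaves /= big_cat !big_map /= -!big_split/=.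
by apply: eq_bigr => b _; rewrite [RHS]addrC; exact: esym (haar_leaf b mA mB).
Qed.

Lemma sum_levels m k A B : measurable A -> measurable B ->
  \sum_(b <- levels m k) haar b A * haar b B = leaves (m + k) A B - leaves m A B.
Proof.
move=> mA mB; elim: k m => [|k IH] m; first by rewrite big_nil addn0 subrr.
by rewrite levelsS big_cat/= IH leavesS// -addSnnS; ring.
Qed.

Lemma sum_cells n A : measurable A -> \sum_(b <- words n) cprob (A `&` cell b) = cprob A.
Proof.
move=> mA; elim: n => [|n IH]; first by rewrite big_seq1 /= setIT.
rewrite [words _]/= big_cat !big_map /= -big_split/= -IH.
by apply: eq_bigr => b _; rewrite (cprob_cell b mA).
Qed.

Definition resolved n A := forall b, size b = n ->
  cell b `<=` A \/ A `&` cell b = set0.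

Lemma resolved_level i n : (i < n)%N -> resolved n (H i).
Proof.
move=> + b sb; rewrite -sb => {n sb}; elim: b => //= x b IH.
rewrite ltnS leq_eqVlt => /predU1P[->|/IH [h|h]].
- case: x; [by left => s []|right].
  by rewrite setIC -setIA setICl setI0.
- by left => s [/h].
- by right; rewrite setIA h set0I.
Qed.

(** The indicator of a union of cells is its own conditional expectation; on null cells both sides
    vanish. *)
Lemma leaves_resolved n A B : measurable A -> measurable B -> resolved n A ->
  leaves n A B = cprob (A `&` B).
Proof.
move=> mA mB rA; rewrite -(sum_cells n (measurableI _ _ mA mB)).
apply: eq_big_seq => b /size_words /rA [bA|bA]; rewrite /leaf.
  have -> : A `&` cell b = cell b by apply/setIidPr.
  have -> : A `&` B `&` cell b = B `&` cell b by rewrite setIAC setIC; congr (_ `&` _); exact/setIidPr.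
  have [c0|c0] := eqVneq (cprob (cell b)) 0; first by rewrite c0 !mul0r cprob_cell_null.
  by rewrite mulrAC divff// mul1r.
rewrite setIAC bA set0I.
have -> : cprob (set0 : set S) = 0 by apply: EFin_inj; rewrite cprobE// measure0.
by rewrite !mul0r.
Qed.

Lemma cprob_dist A A' B : measurable A -> measurable A' -> measurable B ->
  `|cprob (A `&` B) - cprob (A' `&` B)| <= cprob (symdiff A A' `&` B).
Proof.
move=> mA mA' mB; have mD := measurable_symdiff mA mA'.
have h X Y : measurable X -> measurable Y -> symdiff X Y = symdiff A A' ->
    cprob (X `&` B) <= cprob (Y `&` B) + cprob (symdiff A A' `&` B).
  move=> mX mY E; rewrite -E.
  have mXB := measurableI _ _ mX mB; have mYB := measurableI _ _ mY mB.
  have mEB : measurable (symdiff X Y `&` B) by apply: measurableI => //; exact: measurable_symdiff.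
  apply: le_trans (cprobU_le mYB mEB); apply: le_cprob => //; first exact: measurableU.
  move=> s [Xs Bs]; have [Ys|Ys] := pselect (Y s); [by left|right].
  by split=> //; left.
have h1 := h _ _ mA mA' erefl.
have h2 : cprob (A' `&` B) <= cprob (A `&` B) + cprob (symdiff A A' `&` B).
  by apply: h => //; rewrite /symdiff setUC.
by rewrite ler_distl lerBlDr h2 h1.
Qed.

(** The conditional probability of [B] in a cell is at most 1, so the error is at most the mass of
    the symmetric difference, cell by cell. *)
Lemma leaves_dist n A A' B : measurable A -> measurable A' -> measurable B ->
  `|leaves n A B - leaves n A' B| <= cprob (symdiff A A').
Proof.
move=> mA mA' mB; have mD := measurable_symdiff mA mA'.
rewrite /leaves -sumrB (le_trans (ler_norm_sum _ _ _))// -(sum_cells n mD).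
apply: ler_sum => b _; rewrite /leaf -mulrBl -mulrBl !normrM.
rewrite normfV [`|cprob (B `&` _)|]ger0_norm ?[`|cprob (cell b)|]ger0_norm ?cprob_ge0//.
apply: le_trans (cprob_dist mA mA' (measurable_cell b)).
rewrite -mulrA ler_piMr//.
have [c0|c0] := eqVneq (cprob (cell b)) 0; first by rewrite c0 invr0 mulr0.
rewrite ler_pdivrMr; last by rewrite lt_neqAle eq_sym c0 cprob_ge0.
by rewrite mul1r le_cprob_cell.
Qed.

Lemma leaves_approx n A A' B : measurable A -> measurable A' -> measurable B ->
  resolved n A' -> `|leaves n A B - cprob (A `&` B)| <= 2 * cprob (symdiff A A').
Proof.
move=> mA mA' mB rA'.
rewrite (le_trans (ler_distD (leaves n A' B) _ _))// mulr_natl mulr2n lerD//.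
  exact: leaves_dist.
rewrite (leaves_resolved mA' mB rA') distrC (le_trans (cprob_dist mA mA' mB))//.
have mD := measurable_symdiff mA mA'.
apply: le_cprob => //; exact: measurableI.
Qed.

End haar_expansion.

(** * The corner Gaussian process as a Haar series *)

Section corner_gaussian_process.
Context (R : realType) (d : nat) (hd : (0 < d)%N) dQ (Omega : measurableType dQ)
  (Q : probability Omega R).
Local Notation T := (corner d * d.-tuple R)%type.

Definition grid_code m (p : grid_index d m) : nat :=
  pickle (Tagged (fun m => grid_index d m : countType) p).

(** A number that codes no node gives the whole space, a split that changes nothing. *)
Definition grid_half (i : nat) : set (d.-tuple R) :=
  if (unpickle i : option {m : nat & (grid_index d m : countType)}) is Some (existT m p)
  then cset (grid_node p) else setT.

Lemma measurable_grid_half i : measurable (grid_half i).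
Proof. by rewrite /grid_half; case: unpickle => [[]|]. Qed.

Lemma grid_half_code m (p : grid_index d m) : grid_half (grid_code p) = cset (grid_node p).
Proof. by rewrite /grid_half /grid_code pickleK. Qed.

(** Exceeds the code of every node up to level [m]; as a sum it is visibly monotone in the level. *)
Definition grid_depth m : nat :=
  \sum_(0 <= i < m.+1) \sum_(p : grid_index d i) (grid_code p).+1.

Lemma grid_depth_le m n : (m <= n)%N -> (grid_depth m <= grid_depth n)%N.
Proof.
move=> mn; rewrite /grid_depth [X in (_ <= X)%N](@big_cat_nat _ _ _ m.+1)//=.
exact: leq_addr.
Qed.

Lemma grid_code_lt m (p : grid_index d m) : (grid_code p < grid_depth m)%N.
Proof.
rewrite /grid_depth big_nat_recr//= (bigD1 p)//=.
by rewrite addnCA addSn ltnS leq_addr.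
Qed.

Let H := grid_half.
Let mH := measurable_grid_half.

Lemma leaves_corner n m j B : (grid_depth m <= n)%N -> corner_index d j ->
  measurable B -> `|leaves H n (cset j) B - cprob (cset j `&` B)| <= 2 * mesh d m.
Proof.
move=> mn Dj mB; have mj := measurable_cset j; have ml := measurable_cset (lower m j).
have r : resolved H n (cset (lower m j)).
  rewrite -grid_half_code; apply: resolved_level.
  exact: leq_trans (grid_code_lt _) mn.
apply: (le_trans (leaves_approx mH mj ml mB r)); rewrite ler_pM2l//.
by have := cdist_lower m Dj; rewrite cdistC.
Qed.

(** Doubling the level brings the mesh to [d / 16 ^ m], below the rate 8^-m that the series
    requires. *)
Let depth m := grid_depth (2 * m).
Let J m := map pickle (levels 0 (depth m)).
Let L m := map pickle (levels (depth m) (depth m.+1 - depth m)).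
Let a (i : nat) (j : T) : R :=
  if (unpickle i : option (seq bool)) is Some b then haar H b (cset j) else 0.

Let sum_a m k s t : \sum_(i <- map pickle (levels m k)) a i s * a i t =
  leaves H (m + k) (cset s) (cset t) - leaves H m (cset s) (cset t).
Proof.
rewrite big_map -(sum_levels mH)//.
by apply: eq_bigr => b _; rewrite /a pickleK.
Qed.

Let mesh_depth m : mesh d (2 * m) = d%:R / 16 ^+ m :> R.
Proof. by rewrite /mesh expnM natrX. Qed.

Lemma corner_gaussian_process_exists (xi : nat -> Omega -> R) :
  (forall i, measurable_fun [set: Omega] (xi i)) ->
  (forall (J : seq nat) (A : nat -> set R), uniq J -> (forall i, measurable (A i)) ->
    Q (\big[setI/setT]_(i <- J) (xi i @^-1` A i)) = (\prod_(i <- J) normal0 1 (A i))%E) ->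
  exists G : T -> Omega -> R,
    centered_gaussian_process Q (corner_index d) (@corner_cov R d) G.
Proof.
move=> mxi indep.
have depthS m : (depth m <= depth m.+1)%N by apply: grid_depth_le; rewrite leq_mul2l leqnSn.
exists (series_limit xi a J).
(* The constant [4 * d] adds two approximation errors of [2 * mesh d (2 * m)], one at each end of
   the block. *)
apply: (series_limit_gaussian mxi indep (L := L) (c := 4 * d%:R)) => //.
- by move=> m; rewrite map_inj_uniq ?uniq_levels//; exact: (pcan_inj pickleK).
- by move=> m; rewrite /J /L -map_cat -[X in map pickle (_ ++ levels X _)]add0n -levelsD subnKC.
- move=> t m Dt; under eq_bigr do rewrite expr2.
  rewrite sum_a subnKC//.
  have h1 := leaves_corner (depthS m) Dt (measurable_cset t).
  have h2 := leaves_corner (leqnn (depth m)) Dt (measurable_cset t).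
  rewrite (le_trans (ler_norm _))// (le_trans (ler_distD (cprob (cset t `&` cset t)) _ _))//.
  rewrite [X in _ + X]distrC (le_trans (lerD h1 h2))//.
  rewrite mesh_depth.
  rewrite -mulrDl -(natrD _ 2 2) mulrA ler_wpM2l ?mulr_ge0//.
  by rewrite lef_pV2 ?posrE ?exprn_gt0// lerXn2r ?nnegrE// ler_nat.
- move=> s t Ds Dt.
  have E m : \sum_(b <- J m) a b s * a b t = leaves H (depth m) (cset s) (cset t) -
      cprob (cset s) * cprob (cset t).
    by rewrite sum_a add0n leaves0.
  under eq_fun do rewrite E.
  rewrite corner_covE; apply: cvgB; last exact: cvg_cst.
  apply/cvgrPdist_le => e e0.
  have : (2 * d%:R) * 16^-1 ^+ m @[m --> \oo] --> (2 * d%:R) * (0 : R).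
    by apply: cvgMr; apply: cvg_expr; rewrite ger0_norm// invf_lt1// ltr1n.
  rewrite mulr0 => /cvgr_le /(_ _ e0) h; near=> m.
  rewrite distrC (le_trans (leaves_corner (leqnn (depth m)) Ds (measurable_cset t)))//.
  by rewrite mesh_depth mulrA -exprVn; near: m.
Unshelve. all: by end_near. Qed.

End corner_gaussian_process.

Theorem corollary3p12 (R : realType) (d : nat) (hd : (0 < d)%N)
    (dO : measure_display) (Omega : measurableType dO)
    (P : probability Omega R) (X : nat -> {RV P >-> d.-tuple R})
    (hX : iid_with_law X (uniform_cube d)) :
  [/\
    (* asymptotic equicontinuity of the empirical process *)
    forall eps : R, 0 < eps ->
      (fun delta : R => limn_esup (fun n : nat =>
        (P^*)%mu [set w : Omega |
          (eps%:E < oscillation (corner_index d) (@rho R d) delta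
            (empirical_process (fun i => X i w) n))%E]))
        @ 0^'+ --> 0%E,
    (* the limit process exists *)
    exists (dQ : measure_display) (Omega' : measurableType dQ)
      (Q : probability Omega' R) (G : corner d * d.-tuple R -> Omega' -> R),
      centered_gaussian_process Q (corner_index d) (@corner_cov R d) G,
    (* any such process has a version with the stated sample paths *)
    forall (dQ : measure_display) (Omega' : measurableType dQ)
      (Q : probability Omega' R) (G : corner d * d.-tuple R -> Omega' -> R),
      centered_gaussian_process Q (corner_index d) (@corner_cov R d) G ->
      exists H : corner d * d.-tuple R -> Omega' -> R,
        version_of Q (corner_index d) G H /\
        forall w : Omega',
          [/\ bounded_path (corner_index d) (fun j => H j w),
              uniformly_continuous_path (corner_index d) (@rho R d)
                (fun j => H j w) &
              forall c : corner d,
                {within [set v : 'rV[R]_d | unit_cube (tuple_of_row v)],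
                  continuous (fun v => H (c, tuple_of_row v) w)}] &
    forall (c : corner d) (x y : d.-tuple R),
      unit_cube x -> unit_cube y ->
      rho (c, x) (c, y) ^+ 2 <= \sum_(k < d) `|tnth x k - tnth y k|].
Proof.
split.
- by move=> eps eps0; exact: asymptotic_equicontinuity.
(* The limit process lives on the probability space of the sample itself. *)
- have [xi mxi indep] := iid_uniform_cube_normals hd hX.
  have [G hG] := corner_gaussian_process_exists d mxi indep.
  by exists dO, Omega, P, G.
- move=> dQ Omega' Q G hG; exists (limit_version G); split=> [j Dj|w].
    by split; [exact: (measurable_limit_version hd hG Dj)|exact: (limit_version_ae hd hG Dj)].
  have uc := limit_version_uniformly_continuous hd G w.
  split; [exact: (limit_version_bounded hd G w)|exact: uc|move=> c].
  exact: (corner_path_continuous (g := fun j => limit_version G j w)).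
- by move=> c x y ux uy; rewrite rho_sqr; exact: cdist_lipschitz.
Qed.
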